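(* Let $H\in(0,1)$, let $b:\mathbb{R}^d\to\mathbb{R}^d$ be continuous and let $\sigma$ be a real $d\times d$ matrix. Assume that there exist $\alpha>0$ and $L\ge 0$ such that for all $x,y\in\mathbb{R}^d$, $\langle b(x)-b(y),x-y\rangle\le-\alpha|x-y|^2$ and $|b(x)-b(y)|\le L|x-y|$, and that $\sigma$ is invertible. Let $(X_t)_{t\ge0}$ be the stationary solution of $X_t=X_0+\int_0^t b(X_s)\,ds+\sigma B^H_t$, $t\ge 0$. Let $(\Delta_n)_{n\ge1}$ be the fixed sequence of sampling steps (positive, non-increasing, $n\Delta_n\to\infty$) and $t_k=k\Delta_n$ for $1\le k\le n$. Put $a_H=\max\{2H,1\}$ and $\beta_H=\min\{1,2-2H\}$. Then there exists a positive constant $\mathfrak{C}=C(H,L,\alpha,|b(0)|,\|\sigma\|)$ such that for every integer $n\ge1$ with $n\Delta_n\ge1$, every Lipschitz function $F:((\mathbb{R}^d)^n,d_n)\to(\mathbb{R},|\cdot|)$ and every $\lambda>0$, writing $F_X=F(X_{t_1},\dots,X_{t_n})$, $$\mathbf{E}\left[\exp\left(\lambda(F_X-\mathbf{E}[F_X])\right)\right]\le\exp\left(\mathfrak{C}\,\|F\|_{\rm Lip}^2\,\lambda^2\,n^{a_H}\Delta_n^{-\beta_H}\right).$$ Moreover, for every $r>0$, $$\mathbf{P}\left(F_X-\mathbf{E}[F_X]>r\right)\le\exp\left(\frac{-r^2}{4\mathfrak{C}\,n^{a_H}\Delta_n^{-\beta_H}\|F\|_{\rm Lip}^2}\right)$$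 (the right-hand side being read as $0$ if $\|F\|_{\rm Lip}=0$).
   Context: The dimension $d\ge1$ and the sequence $(\Delta_n)$ are fixed data. $|\cdot|$ is the Euclidean norm on $\mathbb{R}^d$, $\|\cdot\|$ a matrix norm subordinated to it, and $d_n(x,y)=\sum_{i=1}^n|x_i-y_i|$ for $x,y\in(\mathbb{R}^d)^n$; $\|F\|_{\rm Lip}$ is the best Lipschitz constant of $F$ with respect to $d_n$. $B^H$ is a $d$-dimensional two-sided fractional Brownian motion with Hurst parameter $H$, given by the Mandelbrot–Van Ness representation $B^H_t=c_H\int_{\mathbb{R}}\left((t-s)_+^{H-1/2}-(-s)_+^{H-1/2}\right)dW_s$, where $W=(W_t)_{t\in\mathbb{R}}$ is a two-sided $d$-dimensional Brownian motion and $c_H>0$ is a normalizing constant. Stationary solution: an initial condition is a probability distribution $\mu$ on $\mathbb{R}^d\times\mathcal{W}$ ($\mathcal{W}$ a suitable space of Hölder functions on $(-\infty,0]$ carrying Wiener measure) whose second marginal is the law of $W^-=(W_t)_{t\le0}$; it prescribes the law of $(X_0,W^-)$, and $(W_t)_{t\ge0}$ is independent of $(X_0,W^-)$. An initial condition $\nu$ is an invariant distribution if the law of the resulting process $(X_t)_{t\ge0}$ is invariant under time shifts. Under the stated assumptions an invariant distribution exists and the law of the resulting process is unique; $(X_t)_{t\ge0}$ started from it is called the stationary solution. *)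

(* Defs.v *)
From HB Require Import structures.
From mathcomp Require Import all_boot all_order all_algebra.
From mathcomp Require Import all_classical all_reals all_analysis.

Set Implicit Arguments.
Unset Strict Implicit.
Unset Printing Implicit Defensive.

Import Order.TTheory GRing.Theory Num.Theory.
Import numFieldNormedType.Exports.

Local Open Scope classical_set_scope.
Local Open Scope ring_scope.

(* Column vectors carry the sup norm in the library (same topology); the norm
   below is the Euclidean one. *)
Definition dotp (R : realType) (d : nat) (x y : 'cV[R]_d) : R :=
  \sum_(i < d) x i 0 * y i 0.

Definition enorm (R : realType) (d : nat) (x : 'cV[R]_d) : R :=
  Num.sqrt (dotp x x).

Definition opnorm (R : realType) (d : nat) (M : 'M[R]_d) : R :=
  sup [set enorm (M *m x) | x in [set x : 'cV[R]_d | enorm x <= 1]].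

Definition dist_sum (R : realType) (d n : nat) (x y : 'I_n -> 'cV[R]_d) : R :=
  \sum_(k < n) enorm (x k - y k).

Definition lip_consts (R : realType) (d n : nat)
    (F : ('I_n -> 'cV[R]_d) -> R) : set R :=
  [set K | 0 <= K /\ forall x y, `|F x - F y| <= K * dist_sum x y].

Definition lipschitz_dn (R : realType) (d n : nat)
    (F : ('I_n -> 'cV[R]_d) -> R) : Prop :=
  lip_consts F !=set0.

Definition lip_norm (R : realType) (d n : nat)
    (F : ('I_n -> 'cV[R]_d) -> R) : R :=
  inf (lip_consts F).

(* A process indexed by R with values in R^d.  The Borel sigma-algebra of R^d
   is handled through coordinates: a random vector is a function all of whose
   coordinates are measurable. *)
Notation process R Omega d := (R -> Omega -> 'cV[R]_d).

Definition random_vector (R : realType) (disp : measure_display)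
    (Omega : measurableType disp) (d : nat) (Y : Omega -> 'cV[R]_d) : Prop :=
  forall i : 'I_d, measurable_fun [set: Omega] (fun w => Y w i 0).

Definition mutually_independent (R : realType) (disp : measure_display)
    (Omega : measurableType disp) (P : probability Omega R)
    (I : finType) (Y : I -> Omega -> R) : Prop :=
  forall A : I -> set R, (forall i, measurable (A i)) ->
    P [set w | forall i, A i (Y i w)] = (\prod_(i : I) P (Y i @^-1` A i))%E.

Definition two_sided_BM (R : realType) (disp : measure_display)
    (Omega : measurableType disp) (P : probability Omega R) (d : nat)
    (W : process R Omega d) : Prop :=
  [/\ forall t, random_vector (W t),
      {ae P, forall w, W 0 w = 0},
      {ae P, forall w, continuous (fun t => W t w)},
      forall (i : 'I_d) (s t : R), s < t ->
        forall A : set R, measurable A ->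
          P [set w | A (W t w i 0 - W s w i 0)]
            = normal_prob 0 (Num.sqrt (t - s)) A
    & forall (n : nat) (t : nat -> R), {homo t : j k / (j < k)%N >-> j < k} ->
        @mutually_independent R disp Omega P ('I_n * 'I_d)%type
          (fun p w => W (t p.1.+1) w p.2 0 - W (t p.1) w p.2 0)].

(* A step function is a list of triples (a, u, v), standing for the sum of the
   a * 1_(u, v]. *)
Definition step_fun (R : realType) (g : seq (R * R * R)) (s : R) : R :=
  \sum_(p <- g) (if (p.1.2 < s) && (s <= p.2) then p.1.1 else 0).

(* Only used for triples (a, u, v) with u <= v. *)
Definition step_integral (R : realType) (Omega : Type)
    (Z : R -> Omega -> R) (g : seq (R * R * R)) (w : Omega) : R :=
  \sum_(p <- g) p.1.1 * (Z p.2 w - Z p.1.2 w).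

(* Y is (a version of) the Wiener integral of f over R with respect to the
   two-sided real Brownian motion Z, i.e. the L^2(P)-limit of the integrals of
   step functions converging to f in L^2(R). *)
Definition is_wiener_integral (R : realType) (disp : measure_display)
    (Omega : measurableType disp) (P : probability Omega R)
    (Z : R -> Omega -> R) (f : R -> R) (Y : Omega -> R) : Prop :=
  measurable_fun [set: R] f /\ measurable_fun [set: Omega] Y /\
  exists g : nat -> seq (R * R * R),
    [/\ forall m p, p \in g m -> p.1.2 <= p.2,
        (\int[lebesgue_measure]_s ((f s - step_fun (g m) s) ^+ 2)%:E)%E
          @[m --> \oo] --> 0%E
      & 'E_P[(fun w => (Y w - step_integral Z (g m) w) ^+ 2)%R]%E
          @[m --> \oo] --> 0%E].

(* u_+^a, equal to 0 for u <= 0 whatever the sign of a.  (powR 0 0 = 1, so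
   powR (Num.max u 0) a would give the wrong kernel for H = 1/2.) *)
Definition pos_powR (R : realType) (u a : R) : R :=
  if 0 < u then u `^ a else 0.

Definition mvn_kernel (R : realType) (H t s : R) : R :=
  pos_powR (t - s) (H - 2^-1) - pos_powR (- s) (H - 2^-1).

(* c_H, normalized so that each coordinate of B^H_1 has variance 1. *)
Definition mvn_const (R : realType) (H : R) : R :=
  (Num.sqrt (\int[lebesgue_measure]_(s in [set: R]) (mvn_kernel H 1 s) ^+ 2))^-1.

(* The Wiener integral determines B t only up to a null set for each t; B is
   the continuous modification. *)
Definition mvn_fBM (R : realType) (disp : measure_display)
    (Omega : measurableType disp) (P : probability Omega R) (d : nat) (H : R)
    (W B : process R Omega d) : Prop :=
  (forall (t : R) (i : 'I_d),
     is_wiener_integral P (fun s w => W s w i 0)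
       (fun s => mvn_const H * mvn_kernel H t s) (fun w => B t w i 0)) /\
  {ae P, forall w, continuous (fun t => B t w)}.

Definition past_sigma (R : realType) (Omega : Type) (d : nat)
    (X0 : Omega -> 'cV[R]_d) (W : process R Omega d) : set (set Omega) :=
  <<s [set E | exists i : 'I_d, exists2 A : set R, measurable A &
         E = (fun w => X0 w i 0) @^-1` A \/
         exists2 s : R, s <= 0 & E = (fun w => W s w i 0) @^-1` A] >>.

Definition future_sigma (R : realType) (Omega : Type) (d : nat)
    (W : process R Omega d) : set (set Omega) :=
  <<s [set E | exists i : 'I_d, exists2 A : set R, measurable A &
         exists2 t : R, 0 <= t & E = (fun w => W t w i 0) @^-1` A] >>.

Definition independent_sigma (R : realType) (disp : measure_display)
    (Omega : measurableType disp) (P : probability Omega R)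
    (S1 S2 : set (set Omega)) : Prop :=
  forall E1 E2, S1 E1 -> S2 E2 -> P (E1 `&` E2) = (P E1 * P E2)%E.

(* X solves X_t = X_0 + int_0^t b(X_s) ds + sigma B_t on [0, +oo); its values
   at negative times are irrelevant. *)
Definition sde_solution (R : realType) (disp : measure_display)
    (Omega : measurableType disp) (P : probability Omega R) (d : nat)
    (b : 'cV[R]_d -> 'cV[R]_d) (sigma : 'M[R]_d)
    (B X : process R Omega d) : Prop :=
  [/\ forall t, 0 <= t -> random_vector (X t),
      {ae P, forall w, {within `[0, +oo[, continuous (fun t : R => X t w)}}
    & {ae P, forall w, forall t, 0 <= t ->
        X t w = X 0 w
          + \col_(i < d) (\int[lebesgue_measure]_(s in `[0, t]) b (X s w) i 0)
          + sigma *m B t w}].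

(* Product sigma-algebra on the path space of processes indexed by [0, +oo). *)
Definition path_sigma (R : realType) (d : nat) : set (set (R -> 'cV[R]_d)) :=
  <<s [set E | exists t : R, exists i : 'I_d, exists2 A : set R,
         0 <= t /\ measurable A & E = [set x : R -> 'cV[R]_d | A (x t i 0)]] >>.

Definition shift_invariant_law (R : realType) (disp : measure_display)
    (Omega : measurableType disp) (P : probability Omega R) (d : nat)
    (X : process R Omega d) : Prop :=
  forall h : R, 0 <= h -> forall E, path_sigma (R := R) (d := d) E ->
    P [set w | E (fun t => X (h + t) w)] = P [set w | E (fun t => X t w)].

(* X is a realization, on some probability space carrying the Brownian motion
   W, of the solution started from an invariant initial condition; the initial
   condition is the joint law of X 0 and (W_t)_{t <= 0}. *)
Definition stationary_solution (R : realType) (disp : measure_display)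
    (Omega : measurableType disp) (P : probability Omega R) (d : nat) (H : R)
    (b : 'cV[R]_d -> 'cV[R]_d) (sigma : 'M[R]_d)
    (W B X : process R Omega d) : Prop :=
  [/\ two_sided_BM P W,
      mvn_fBM P H W B,
      independent_sigma P (past_sigma (X 0) W) (future_sigma W),
      sde_solution P b sigma B X
    & shift_invariant_law P X].

Definition sampling_steps (R : realType) (Delta : nat -> R) : Prop :=
  [/\ forall n, (0 < n)%N -> 0 < Delta n,
      forall m n, (0 < m)%N -> (m <= n)%N -> Delta n <= Delta m
    & n%:R * Delta n @[n --> \oo] --> +oo].

Definition drift_assumption (R : realType) (d : nat) (alpha L : R)
    (b : 'cV[R]_d -> 'cV[R]_d) : Prop :=
  forall x y, dotp (b x - b y) (x - y) <= - alpha * enorm (x - y) ^+ 2 /\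
              enorm (b x - b y) <= L * enorm (x - y).

(* n^(a_H) Delta_n^(- beta_H). *)
Definition conc_rate (R : realType) (H : R) (n : nat) (delta : R) : R :=
  n%:R `^ (Num.max (2 * H) 1) * delta `^ (- Num.min 1 (2 - 2 * H)).

(* F(X_(t_1), ..., X_(t_n)) with t_k = k delta; the index k : 'I_n starts
   at 0. *)
Definition sampled (R : realType) (Omega : Type) (d n : nat)
    (F : ('I_n -> 'cV[R]_d) -> R) (X : process R Omega d) (delta : R)
    (w : Omega) : R :=
  F (fun k => X (k.+1%:R * delta) w).

(* Main.v *)
Require Import Defs.
From mathcomp Require Import all_boot all_order all_algebra.
From mathcomp Require Import all_classical all_reals all_analysis.
From mathcomp Require Import measurable_realfun.
From mathcomp Require Import ring lra.

Set Implicit Arguments.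
Unset Strict Implicit.
Unset Printing Implicit Defensive.

Import Order.TTheory GRing.Theory Num.Theory.
Import numFieldNormedType.Exports.

Local Open Scope classical_set_scope.
Local Open Scope ring_scope.

(* The expectation never has to be estimated directly: it suffices to bound the
   product E exp(l F_X) * E exp(- l F_X), because E exp(- l (F_X - E F_X)) >= 1
   by Jensen's inequality.  Such a product bound passes to limits in probability
   and depends only on the law.  By stationarity F_X has the law of
   F (X_(T + t_1), ..., X_(T + t_n)), and for T large the contraction given by the
   drift replaces X by an Euler scheme started from 0 and driven by B^H; replacing
   the Mandelbrot-Van Ness kernels by step functions, one is left with a function
   of finitely many independent Gaussian increments of W.  For such a function,
   with Lipschitz constant c_i in the i-th variable, of variance s_i, the product
   is at most exp(sum_i c_i^2 s_i).  Here c_i is bounded by the sensitivity S(s)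
   of the scheme to dW_s, s in the i-th cell, so that the exponent is governed by
   the integral of S^2.  Up to a discounted average of translates, S(s) is
   sum_k kappa(t_k - s), where kappa dominates the singular part of the kernel
   u_+^(H - 1/2) as well as the slope of the remaining part, whose increments are
   damped by the drift; the square of this sum has integral at most a constant
   times n^(a_H) Delta_n^(- beta_H). *)

(** * Products of exponential moments over finite product spaces *)

(** The kernel u_+^(H - 1/2) is never square integrable at infinity, and near 0 its increments over
    a step h are not of order h, so it can be fed to the contraction neither as it is nor through
    its increments. This forces the splitting into a local part and a ramp: the local part is
    subtracted from the scheme before the comparison and is paid for by its size, at the present
    time and, with weight h, in the memory; the ramp enters through its increments, of order h,
    which the drift sums with total weight of order 1 / alpha. The slope u^(H - 3/2) is square
    integrable at infinity because H < 1. The rate is n / Delta_n times max(1, (n Delta_n)^(2H -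
    1)): about 1 / Delta_n sampling times lie in a window of bounded length, which gives (1 /
    Delta_n)^2 over a period n Delta_n, and the maximum is the effect of long memory. The
    approximation parameters are fixed in the order time shift, mesh, kernel error, rounding. Each
    error may depend badly on the parameters chosen before it, but the limiting exponent depends on
    none of them. *)

Section finite_product.
Context {R : realType} {I T : finType}.
Variables (mu : I -> T -> R) (x : T -> R).
Hypothesis mu_ge0 : forall p t, 0 <= mu p t.
Hypothesis mu_sum1 : forall p, \sum_t mu p t = 1.

Implicit Types (u : {ffun I -> T} -> R) (w : {ffun I -> T}) (c : I -> R).

Definition upd w p t : {ffun I -> T} := [ffun q => if q == p then t else w q].

Lemma updE w p t q : upd w p t q = if q == p then t else w q.
Proof. by rewrite ffunE. Qed.

Definition pmean u : R := \sum_(w : {ffun I -> T}) (\prod_p mu p (w p)) * u w.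

Definition pavg p u w : R := \sum_t mu p t * u (upd w p t).

(** Resampling one coordinate preserves a product measure: exchanging [w p] with the fresh value t
    is an involution that preserves the weight of the pair (w, t). *)
Lemma pmean_pavg p u : pmean (pavg p u) = pmean u.
Proof.
rewrite /pmean /pavg.
under eq_bigr do rewrite mulr_sumr.
under [RHS]eq_bigr => w _ do rewrite -[_ * _]mul1r -[X in X * _](mu_sum1 p) mulr_suml.
rewrite !pair_big /=.
pose phi (v : {ffun I -> T} * T) := (upd v.1 p v.2, v.1 p).
have phiK : involutive phi.
  move=> [w t]; rewrite /phi /= updE eqxx; congr pair.
  by apply/ffunP => q; rewrite !updE; case: eqP => // ->.
rewrite [RHS](reindex_inj (inv_inj phiK)) /=.
apply: eq_bigr => -[w t] _ /=.
rewrite !mulrA; congr (_ * _).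
rewrite (bigD1 p) //= [in RHS](bigD1 p) //= updE eqxx.
rewrite [in RHS](eq_bigr (fun q => mu q (w q))); last first.
  by move=> q qp; rewrite updE (negPf qp).
by rewrite -!mulrA; congr (_ * _); rewrite mulrC.
Qed.

Lemma pmean_cst a : pmean (cst a) = a.
Proof.
rewrite /pmean -mulr_suml -(bigA_distr_bigA (fun p t => mu p t)) /=.
by rewrite big1 ?mul1r.
Qed.

Lemma ler_pmean u v : (forall w, u w <= v w) -> pmean u <= pmean v.
Proof.
by move=> uv; apply: ler_sum => w _; apply: ler_wpM2l => //; exact: prodr_ge0.
Qed.

Lemma pmeanZ a u : pmean (fun w => a * u w) = a * pmean u.
Proof. by rewrite /pmean mulr_sumr; apply: eq_bigr => w _; rewrite mulrCA. Qed.

(** The product of the two exponential moments for the linear function c x of coordinate p, which is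
    the extremal case of [one_coordinate_exp]. *)
Definition two_exp p (c : R) : R :=
  (\sum_t mu p t * expR (c * x t)) * (\sum_t mu p t * expR (- c * x t)).

Lemma two_exp_ge0 p (c : R) : 0 <= two_exp p c.
Proof.
by apply: mulr_ge0; apply: sumr_ge0 => t _; rewrite mulr_ge0 ?expR_ge0.
Qed.

(** On [exp(- a), exp a] the function r + 1/r is largest at the end points, as one sees by expanding
    (exp a - r)(r - exp(- a)) >= 0. *)
Lemma addrV_le_cosh (r a : R) : 0 <= a -> expR (- a) <= r -> r <= expR a ->
  r + r^-1 <= expR a + expR (- a).
Proof.
move=> a0 ar ra; have r0 : 0 < r by apply: lt_le_trans ar; exact: expR_gt0.
have ea : expR a * expR (- a) = 1 by rewrite -expRD subrr expR0.
have h : 0 <= (expR a - r) * (r - expR (- a)) by apply: mulr_ge0; lra.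
have : (r + r^-1) * r <= (expR a + expR (- a)) * r.
  rewrite mulrDl mulVf ?gt_eqF //; nra.
by rewrite ler_pM2r.
Qed.

(* Both sides are symmetrized into double sums over independent copies. *)
Lemma one_coordinate_exp p (c : R) (f : T -> R) :
  0 <= c -> (forall t, 0 < f t) ->
  (forall t t', f t <= f t' * expR (c * `|x t - x t'|)) ->
  (\sum_t mu p t * f t) * (\sum_t mu p t * (f t)^-1) <= two_exp p c.
Proof.
move=> c0 f0 fL.
pose m2 t t' := mu p t * mu p t'.
have prodE (g h : T -> R) : (\sum_t mu p t * g t) * (\sum_t mu p t * h t)
    = 2^-1 * \sum_t \sum_t' m2 t t' * (g t * h t' + g t' * h t).
  have E : (\sum_t mu p t * g t) * (\sum_t mu p t * h t)
      = \sum_t \sum_t' m2 t t' * (g t * h t').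
    rewrite mulr_suml; apply: eq_bigr => t _; rewrite mulr_sumr.
    by apply: eq_bigr => t' _; rewrite /m2; ring.
  have -> : \sum_t \sum_t' m2 t t' * (g t * h t' + g t' * h t)
      = \sum_t \sum_t' m2 t t' * (g t * h t')
        + \sum_t \sum_t' m2 t t' * (g t * h t').
    rewrite [X in _ = _ + X]exchange_big -big_split /=; apply: eq_bigr => t _.
    by rewrite -big_split; apply: eq_bigr => t' _; rewrite /m2 /=; ring.
  rewrite -E; lra.
rewrite /two_exp !prodE; apply: ler_wpM2l => //.
apply: ler_sum => t _; apply: ler_sum => t' _.
apply: ler_wpM2l; first by rewrite mulr_ge0.
have a0 : 0 <= c * `|x t - x t'| by rewrite mulr_ge0.
have -> : f t' * (f t)^-1 = (f t * (f t')^-1)^-1.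
  by rewrite invfM invrK mulrC.
apply: (le_trans (addrV_le_cosh (a := c * `|x t - x t'|) a0 _ _)).
- by rewrite ler_pdivlMr // expRN mulrC ler_pdivrMr ?expR_gt0 // distrC.
- by rewrite ler_pdivrMr // mulrC.
rewrite -!expRD.
have [h|h] := ger0P (x t - x t').
  rewrite (_ : c * x t + _ = c * (x t - x t')); last by ring.
  by rewrite (_ : c * x t' + _ = - (c * (x t - x t'))); last by ring.
rewrite addrC (_ : c * x t + _ = - (c * - (x t - x t'))); last by ring.
by rewrite (_ : c * x t' + _ = c * - (x t - x t')); last by ring.
Qed.

Definition depends_on (s : seq I) u :=
  forall w w', {in s, w =1 w'} -> u w = u w'.

(** A Lipschitz condition on ln u in each coordinate, written multiplicatively because this form
    passes to averages of u. *)
Definition log_lip c u := forall p w w', (forall q, q != p -> w q = w' q) ->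
  u w <= u w' * expR (c p * `|x (w p) - x (w' p)|).

Lemma log_lip_pavg c u p : (forall q, 0 <= c q) -> (forall w, 0 < u w) ->
  log_lip c u -> log_lip c (pavg p u).
Proof.
move=> c0 u0 uL q w w' ww'; rewrite /pavg mulr_suml; apply: ler_sum => t _.
rewrite -mulrA; apply: ler_wpM2l => //.
have [qp|qp] := eqVneq q p.
  have -> : upd w p t = upd w' p t.
    by apply/ffunP => r; rewrite !updE; case: eqP => // /eqP rp; rewrite ww' ?qp.
  by rewrite ler_peMr ?(ltW (u0 _)) // -[leLHS]expR0 ler_expR mulr_ge0.
have := uL q (upd w p t) (upd w' p t).
rewrite !updE (negPf qp); apply => r rq.
by rewrite !updE ww'.
Qed.

Lemma pavg_gt0 p u : (forall w, 0 < u w) -> forall w, 0 < pavg p u w.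
Proof.
move=> u0 w; rewrite lt0r sumr_ge0 ?andbT; last first.
  by move=> t _; rewrite mulr_ge0 // ltW.
apply/eqP => /psumr_eq0P h.
suff : \sum_t mu p t = 0 by rewrite mu_sum1 => /eqP; rewrite oner_eq0.
apply: big1 => t _; apply/eqP.
have := h (fun t _ => mulr_ge0 (mu_ge0 p t) (ltW (u0 (upd w p t)))) t isT.
by move=> /eqP; rewrite mulf_eq0 (gt_eqF (u0 _)) orbF.
Qed.

(** Tensorization. With the other coordinates frozen, [one_coordinate_exp] bounds the average of 1 /
    u over coordinate p by [two_exp] divided by the average of u; that average keeps the Lipschitz
    constants and depends on one coordinate fewer. *)
Lemma pmean_mulV_rec c s u : (forall q, 0 <= c q) -> (forall w, 0 < u w) ->
  log_lip c u -> depends_on s u ->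
  pmean u * pmean (fun w => (u w)^-1) <= \prod_(p <- s) two_exp p (c p).
Proof.
move=> c0; elim: s u => [|p s IH] u u0 uL uD.
  (* A function of no coordinate is constant; if there is no configuration at all, both means are
     empty sums. *)
  have [w0|noT] := pselect (inhabited {ffun I -> T}).
    case: w0 => w0.
    have -> : u = cst (u w0) by apply/funext => w; exact: uD.
    by rewrite /= !pmean_cst big_nil divff // gt_eqF.
  by rewrite big_nil /pmean big1 ?mul0r // => w; case: noT.
have v0 := pavg_gt0 p u0.
rewrite big_cons -(pmean_pavg p u) -(pmean_pavg p (fun w => (u w)^-1)).
have step w : pavg p (fun w => (u w)^-1) w
    <= two_exp p (c p) * (pavg p u w)^-1.
  rewrite ler_pdivlMr // mulrC.
  apply: (@one_coordinate_exp p (c p) (fun t => u (upd w p t))) => // t t'.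
  have := uL p (upd w p t) (upd w p t'); rewrite !updE eqxx; apply => q qp.
  by rewrite !updE (negPf qp).
apply: (@le_trans _ _ (pmean (pavg p u)
    * (two_exp p (c p) * pmean (fun w => (pavg p u w)^-1)))).
  apply: ler_wpM2l.
    by rewrite -(pmean_cst 0); apply: ler_pmean => w; rewrite ltW.
  by rewrite -pmeanZ; exact: ler_pmean.
rewrite mulrCA; apply: ler_wpM2l; first exact: two_exp_ge0.
apply: IH => //; first exact: log_lip_pavg.
move=> w w' ww'; apply: eq_bigr => t _; congr (_ * _); apply: uD => q.
rewrite inE !updE; case: eqP => //= qp qs; exact: ww'.
Qed.

Lemma pmean_mulV c u : (forall q, 0 <= c q) -> (forall w, 0 < u w) ->
  log_lip c u ->
  pmean u * pmean (fun w => (u w)^-1) <= \prod_p two_exp p (c p).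
Proof.
move=> c0 u0 uL.
rewrite -[in leRHS]big_enum; apply: pmean_mulV_rec => //.
by move=> w w' ww'; congr u; apply/ffunP => p; apply: ww'; rewrite mem_enum.
Qed.

End finite_product.

(** * Euclidean norm and contraction of the Euler scheme *)

Section euclidean.
Context {R : realType} {d : nat}.
Implicit Types (x y z : 'cV[R]_d) (M : 'M[R]_d).

Lemma dotpC x y : dotp x y = dotp y x.
Proof. by apply: eq_bigr => i _; rewrite mulrC. Qed.

Lemma dotpDl x y z : dotp (x + y) z = dotp x z + dotp y z.
Proof. by rewrite -big_split; apply: eq_bigr => i _; rewrite !mxE mulrDl. Qed.

Lemma dotpZl a x y : dotp (a *: x) y = a * dotp x y.
Proof. by rewrite /dotp mulr_sumr; apply: eq_bigr => i _; rewrite !mxE mulrA. Qed.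

Lemma dotpDr x y z : dotp x (y + z) = dotp x y + dotp x z.
Proof. by rewrite dotpC dotpDl !(dotpC x). Qed.

Lemma dotpZr a x y : dotp x (a *: y) = a * dotp x y.
Proof. by rewrite dotpC dotpZl dotpC. Qed.

Lemma dotpp_ge0 x : 0 <= dotp x x.
Proof. by apply: sumr_ge0 => i _; rewrite -expr2 sqr_ge0. Qed.

Lemma enorm_ge0 x : 0 <= enorm x.
Proof. exact: sqrtr_ge0. Qed.

Lemma sqr_enorm x : enorm x ^+ 2 = dotp x x.
Proof. by rewrite sqr_sqrtr ?dotpp_ge0. Qed.

Lemma enorm0 : enorm (0 : 'cV[R]_d) = 0.
Proof. by rewrite /enorm /dotp big1 ?sqrtr0 // => i _; rewrite mxE mul0r. Qed.

Lemma ler_coord_enorm x i : `|x i 0| <= enorm x.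
Proof.
rewrite -sqrtr_sqr ler_wsqrtr // /dotp (bigD1 i) //= -expr2 lerDl.
by apply: sumr_ge0 => j _; rewrite -expr2 sqr_ge0.
Qed.

Lemma enorm_eq0 x : enorm x = 0 -> x = 0.
Proof.
move=> x0; apply/matrixP => i j; rewrite (ord1 j) mxE; apply/eqP.
by rewrite -normr_le0 -x0 ler_coord_enorm.
Qed.

Lemma enorm_le_sum x : enorm x <= \sum_i `|x i 0|.
Proof.
have s0 : 0 <= \sum_i `|x i 0| by exact: sumr_ge0.
rewrite -(ler_pXn2r (ltn0Sn 1)) ?nnegrE ?enorm_ge0 //.
rewrite sqr_enorm /dotp expr2 mulr_suml; apply: ler_sum => i _.
rewrite -expr2 -real_normK ?num_real // expr2 ler_wpM2l //.
by rewrite (bigD1 i) //= lerDl sumr_ge0.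
Qed.

Lemma cauchy_schwarz x y : dotp x y <= enorm x * enorm y.
Proof.
have [x0|xn0] := eqVneq (enorm x) 0.
  rewrite (enorm_eq0 x0) enorm0 mul0r /dotp big1 // => i _.
  by rewrite mxE mul0r.
have [y0|yn0] := eqVneq (enorm y) 0.
  rewrite (enorm_eq0 y0) enorm0 mulr0 /dotp big1 // => i _.
  by rewrite mxE mulr0.
set a := enorm x in xn0 *; set b := enorm y in yn0 *.
have a0 : 0 < a by rewrite lt_def xn0 enorm_ge0.
have b0 : 0 < b by rewrite lt_def yn0 enorm_ge0.
have := dotpp_ge0 (b *: x + (- a) *: y).
rewrite !(dotpDl, dotpDr, dotpZl, dotpZr) (dotpC y x) -!sqr_enorm -/a -/b => h.
rewrite -subr_ge0 -(pmulr_rge0 _ (mulr_gt0 a0 b0)); nra.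
Qed.

Lemma ler_enormD x y : enorm (x + y) <= enorm x + enorm y.
Proof.
rewrite -(ler_pXn2r (ltn0Sn 1)) ?nnegrE ?addr_ge0 ?enorm_ge0 //.
rewrite sqr_enorm !(dotpDl, dotpDr) (dotpC y x) -!sqr_enorm.
have := cauchy_schwarz x y; nra.
Qed.

Lemma enormZ a x : enorm (a *: x) = `|a| * enorm x.
Proof.
by rewrite /enorm dotpZl dotpZr mulrA -expr2 sqrtrM ?sqr_ge0 // sqrtr_sqr.
Qed.

Lemma enormN x : enorm (- x) = enorm x.
Proof. by rewrite -scaleN1r enormZ normrN1 mul1r. Qed.

Lemma opnorm_has_sup M :
  has_sup [set enorm (M *m x) | x in [set x : 'cV[R]_d | enorm x <= 1]].
Proof.
split; first by exists (enorm (M *m 0)), 0 => //=; rewrite enorm0.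
exists (\sum_i \sum_j `|M i j|) => _ [x /= x1 <-].
apply: le_trans (enorm_le_sum _) _; apply: ler_sum => i _.
rewrite mxE; apply: le_trans (ler_norm_sum _ _ _) _; apply: ler_sum => j _.
by rewrite normrM ler_piMr // (le_trans (ler_coord_enorm x j)).
Qed.

Lemma opnorm_ge0 M : 0 <= opnorm M.
Proof.
apply: le_trans (enorm_ge0 (M *m 0)) _.
by apply: sup_upper_bound; [exact: opnorm_has_sup|exists 0 => //=; rewrite enorm0].
Qed.

Lemma enorm_mulmx M x : enorm (M *m x) <= opnorm M * enorm x.
Proof.
have [/enorm_eq0 ->|xn0] := eqVneq (enorm x) 0.
  by rewrite mulmx0 enorm0 mulr0.
have x0 : 0 < enorm x by rewrite lt_def xn0 enorm_ge0.
rewrite -ler_pdivrMr // mulrC.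
rewrite -[(enorm x)^-1]ger0_norm ?invr_ge0 ?enorm_ge0 // -enormZ scalemxAr.
apply: sup_upper_bound; first exact: opnorm_has_sup.
exists ((enorm x)^-1 *: x) => //=.
by rewrite enormZ ger0_norm ?invr_ge0 ?enorm_ge0 // mulVf.
Qed.

(** The defining inequalities are closed in K, so the infimum is attained and the estimates may be
    run with [lip_norm F] itself. *)
Lemma lip_norm_const n (F : ('I_n -> 'cV[R]_d) -> R) :
  lipschitz_dn F -> lip_consts F (lip_norm F).
Proof.
move=> FL; have lb0 : lbound (lip_consts F) 0 by move=> K [].
have hi : has_inf (lip_consts F) by split => //; exists 0.
have L0 : 0 <= lip_norm F by apply: lb_le_inf.
split=> // x y.
have D0 : 0 <= dist_sum x y by apply: sumr_ge0 => k _; exact: enorm_ge0.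
have [D00|Dn0] := eqVneq (dist_sum x y) 0.
  by case: FL => K [_ /(_ x y)]; rewrite D00 !mulr0.
have {D0}Dn0 : 0 < dist_sum x y by rewrite lt_def Dn0.
rewrite -ler_pdivrMr //; apply: lb_le_inf => //= K [_ /(_ x y)].
by rewrite ler_pdivrMr.
Qed.

End euclidean.

Lemma linear_recursion_le {R : realType} (g : R) (a r : nat -> R) :
  0 <= g -> (forall l, a l.+1 <= g * a l + r l) ->
  forall l, a l <= g ^+ l * a 0%N + \sum_(i < l) g ^+ i * r (l - i.+1)%N.
Proof.
move=> g0 ar; elim=> [|l IH]; first by rewrite big_ord0 expr0 mul1r addr0.
apply: le_trans (ar l) _; rewrite big_ord_recl expr0 mul1r subn1 /=.
rewrite addrCA [leLHS]addrC lerD2l exprS -mulrA.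
apply: le_trans (ler_wpM2l g0 IH) _; rewrite mulrDr lerD2l mulr_sumr.
by apply: ler_sum => i _; rewrite exprS mulrA subSS.
Qed.

Section euler.
Context {R : realType} {d : nat}.
Variables (alpha L h : R) (b : 'cV[R]_d -> 'cV[R]_d).
Hypotheses (alpha_gt0 : 0 < alpha) (L_ge0 : 0 <= L) (h_ge0 : 0 <= h).
Hypotheses (h_alpha : h * alpha <= 1) (h_L : h * L ^+ 2 <= alpha).
Hypothesis (hb : drift_assumption alpha L b).

Local Notation g := (1 - alpha * h / 2).

Lemma contraction_ge0 : 0 <= g.
Proof. by rewrite subr_ge0 ler_pdivrMr // mul1r mulrC (le_trans h_alpha) // ler1n. Qed.

(** Expanding the square gives at most (1 - 2 alpha h + h^2 L^2) |x - y|^2; the condition h L^2 <=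
    alpha absorbs the last term, and 1 - alpha h <= g^2. *)
Lemma euler_contraction x y :
  enorm (x - y + h *: (b x - b y)) <= g * enorm (x - y).
Proof.
rewrite -(ler_pXn2r (ltn0Sn 1)) ?nnegrE ?enorm_ge0 //; last first.
  by rewrite mulr_ge0 ?enorm_ge0 ?contraction_ge0.
have [] := hb x y; move: (x - y) (b x - b y) => e f h1 h2.
rewrite sqr_enorm !(dotpDl, dotpDr, dotpZl, dotpZr) (dotpC e f) exprMn.
have h3 : enorm f ^+ 2 <= L ^+ 2 * enorm e ^+ 2.
  by rewrite -exprMn ler_pXn2r ?nnegrE ?mulr_ge0 ?enorm_ge0.
have A0 := sqr_ge0 (enorm e); rewrite -!sqr_enorm.
move: (enorm f ^+ 2) (enorm e ^+ 2) (dotp _ _) h1 A0 h3 => B A D h1 A0 h3.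
have e1 : h * D <= h * (- alpha * A) by rewrite ler_wpM2l.
have e2 : h * (h * B) <= h * (h * (L ^+ 2 * A)) by rewrite !ler_wpM2l.
have e3 : h * (h * (L ^+ 2 * A)) <= h * (alpha * A).
  by rewrite ler_wpM2l // mulrA ler_wpM2r.
have e4 : 0 <= (alpha * h / 2) ^+ 2 * A by rewrite mulr_ge0 ?sqr_ge0.
nra.
Qed.

(* The difference is compared with v, which absorbs the rough part of the noise. *)
Lemma euler_comparison (y y' xi xi' v : nat -> 'cV[R]_d) :
  (forall l, y l.+1 = y l + h *: b (y l) + xi l) ->
  (forall l, y' l.+1 = y' l + h *: b (y' l) + xi' l) ->
  forall l, enorm (y' l - y l - v l) <= g ^+ l * enorm (y' 0%N - y 0%N - v 0%N)
    + \sum_(i < l) g ^+ i * (h * L * enorm (v (l - i.+1)%N)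
        + enorm (xi' (l - i.+1)%N - xi (l - i.+1)%N
                 - (v (l - i.+1).+1 - v (l - i.+1)%N))).
Proof.
move=> yE y'E; apply: (@linear_recursion_le _ _ (fun l => enorm (y' l - y l - v l))
  (fun l => h * L * enorm (v l) + enorm (xi' l - xi l - (v l.+1 - v l)))).
  exact: contraction_ge0.
move=> l; rewrite yE y'E.
(* The contraction is applied to y' - v against y; the price is b(y') - b(y' - v), of norm at most L
   |v|. *)
have -> : y' l + h *: b (y' l) + xi' l - (y l + h *: b (y l) + xi l) - v l.+1
    = ((y' l - v l) - y l + h *: (b (y' l - v l) - b (y l)))
      + (h *: (b (y' l) - b (y' l - v l)) + (xi' l - xi l - (v l.+1 - v l))).
  by apply/matrixP => i j; rewrite !mxE; ring.
apply: le_trans (ler_enormD _ _) _; apply: lerD.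
  apply: le_trans (euler_contraction _ _) _.
  by rewrite (_ : y' l - v l - y l = y' l - y l - v l) // addrAC.
apply: le_trans (ler_enormD _ _) _; rewrite lerD2r enormZ ger0_norm // -mulrA.
rewrite ler_wpM2l //; apply: le_trans (hb _ _).2 _.
by rewrite opprB addrC subrK.
Qed.

End euler.

(** * Integrals of powers *)

Section lebesgue_invariance.
Context {R : realType}.
Implicit Type f : R -> \bar R.
Local Notation mu := (@lebesgue_measure R).
Local Open Scope ereal_scope.

Lemma measurable_reflection (a : R) : measurable_fun [set: R] (fun s : R => (a - s)%R).
Proof. exact: measurable_funB. Qed.

Lemma lebesgue_measure_reflection (a : R) (A : set R) : measurable A ->
  mu ((fun s => (a - s)%R) @^-1` A) = mu A.
Proof.
have mr := measurable_reflection a.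
move=> mA; rewrite -[LHS]/(pushforward mu (fun s : R => (a - s)%R : measurableTypeR R) A).
apply/esym/lebesgue_measure_unique => //= X [[u v] _ <-]; rewrite /pushforward /=.
have -> : (fun s : R => (a - s)%R) @^-1` `]u, v]%classic = `[(a - v)%R, (a - u)%R[%classic.
  by apply/seteqP; split => s /=; rewrite !in_itv /=; lra.
rewrite !lebesgue_measure_itv /= !lte_fin.
have -> : (a - v < a - u)%R = (u < v)%R by apply/idP/idP; lra.
by case: ifP => // _; rewrite -!EFinB; congr EFin; ring.
Qed.

Lemma ge0_integral_reflection (a : R) f : measurable_fun [set: R] f ->
  (forall s, 0 <= f s) -> \int[mu]_s f (a - s)%R = \int[mu]_s f s.
Proof.
move=> mf f0.
have mr := measurable_reflection a.
have E : setT = (fun s => (a - s)%R : measurableTypeR R) @^-1` setT by rewrite preimage_setT.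
rewrite [in LHS]E -ge0_integral_pushforward //=.
by apply: eq_measure_integral => //= A mA _; rewrite -(lebesgue_measure_reflection a mA).
Qed.

(** A translation is the composition of two reflections. *)
Lemma ge0_integral_shift (a : R) f : measurable_fun [set: R] f ->
  (forall s, 0 <= f s) -> \int[mu]_s f (s + a)%R = \int[mu]_s f s.
Proof.
move=> mf f0; rewrite -(ge0_integral_reflection 0 mf f0).
rewrite -(@ge0_integral_reflection (- a) (fun s => f (0 - s)%R)) //.
  by apply: eq_integral => s _; rewrite sub0r opprB opprK.
exact: (measurableT_comp mf (measurable_reflection 0)).
Qed.

End lebesgue_invariance.

Section power_functions.
Context {R : realType}.
Implicit Types (x y p a : R).

Lemma powR_ln x p : 0 < x -> x `^ p = expR (p * ln x).
Proof. by move=> x0; rewrite /powR gt_eqF. Qed.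

Lemma powRS x p : 0 < x -> x `^ p = x * x `^ (p - 1).
Proof.
move=> x0; have xn0 : x != 0 by rewrite gt_eqF.
by rewrite powRB ?xn0 ?implybT // powRr1 ?ltW // mulrC divfK.
Qed.

Lemma ln_sub_le x y : 0 < x -> 0 < y -> ln y - ln x <= (y - x) / x.
Proof.
move=> x0 y0; rewrite -ln_div ?posrE //.
have E : y / x = 1 + (y - x) / x by field; rewrite gt_eqF.
by rewrite {1}E le_ln1Dx // -subr_gt0 opprK addrC -E divr_gt0.
Qed.

(** Concavity of the power. After factoring x^(p - 1) this is the weighted arithmetic-geometric
    inequality, proved by comparing ln x and ln y with the tangent of ln at their weighted mean
    a. *)
Lemma powR_tangent_le x y p : 0 < x -> 0 < y -> 0 <= p <= 1 ->
  y `^ p <= x `^ p + p * x `^ (p - 1) * (y - x).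
Proof.
move=> x0 y0 /andP[p0 p1].
rewrite [x `^ p]powRS //.
have -> : x * x `^ (p - 1) + p * x `^ (p - 1) * (y - x)
    = x `^ (p - 1) * (x + p * (y - x)) by ring.
have a0 : 0 < x + p * (y - x).
  have -> : x + p * (y - x) = (1 - p) * x + p * y by ring.
  have [->|pn0] := eqVneq p 0; first by rewrite subr0 mul1r mul0r addr0.
  by apply: ltr_wpDl; rewrite ?mulr_ge0 ?subr_ge0 ?(ltW x0) // mulr_gt0 // lt_def pn0.
set a := x + _ in a0 *.
rewrite !powR_ln // -[leRHS]lnK ?posrE ?mulr_gt0 ?expR_gt0 // ler_expR.
rewrite lnM ?posrE ?expR_gt0 // expRK.
have h1 := ln_sub_le a0 y0; have h2 := ln_sub_le a0 x0.
have h3 : p * (ln y - ln a) + (1 - p) * (ln x - ln a)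
    <= p * ((y - a) / a) + (1 - p) * ((x - a) / a).
  by apply: lerD; rewrite ler_wpM2l // subr_ge0.
have h4 : p * ((y - a) / a) + (1 - p) * ((x - a) / a) = 0.
  have -> : p * ((y - a) / a) + (1 - p) * ((x - a) / a)
      = (p * y + (1 - p) * x - a) / a by ring.
  by rewrite (_ : p * y + (1 - p) * x - a = 0) ?mul0r // /a; ring.
lra.
Qed.

Lemma powR_tangent_ge x y p : 0 < x -> 0 < y -> p <= 0 ->
  x `^ p + p * x `^ (p - 1) * (y - x) <= y `^ p.
Proof.
move=> x0 y0 p0.
have -> : y `^ p = x `^ p * expR (p * (ln y - ln x)).
  by rewrite !powR_ln // -expRD; congr expR; ring.
rewrite [x `^ p]powRS //.
have -> : x * x `^ (p - 1) + p * x `^ (p - 1) * (y - x)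
    = x * x `^ (p - 1) * (1 + p * ((y - x) / x)) by field; rewrite gt_eqF.
apply: ler_wpM2l; first by rewrite mulr_ge0 ?powR_ge0 ?ltW.
apply: le_trans (expR_ge1Dx _); rewrite lerD2l.
by rewrite ler_wnM2l // ln_sub_le.
Qed.

(** Each of the two bounds is the tangent inequality at one of the two points, by concavity for p >=
    0 and by convexity for p < 0. *)
Lemma powR_increment x y p : 0 < x -> x <= y -> p <= 1 ->
  `|p| * y `^ (p - 1) * (y - x) <= `|y `^ p - x `^ p| <= `|p| * x `^ (p - 1) * (y - x).
Proof.
move=> x0 xy p1; have y0 : 0 < y by apply: lt_le_trans xy.
have d0 : 0 <= y - x by rewrite subr_ge0.
have [p0|p0] := leP 0 p.
  have h1 := powR_tangent_le (p := p) x0 y0; have h2 := powR_tangent_le (p := p) y0 x0.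
  rewrite p0 p1 in h1 h2; move/(_ isT) in h1; move/(_ isT) in h2.
  have h3 : 0 <= p * y `^ (p - 1) * (y - x) by rewrite !mulr_ge0 ?powR_ge0.
  by rewrite (ger0_norm p0) ger0_norm; [apply/andP; split; lra|lra].
have h1 := powR_tangent_ge x0 y0 (ltW p0); have h2 := powR_tangent_ge y0 x0 (ltW p0).
have h3 : p * y `^ (p - 1) * (y - x) <= 0.
  by rewrite -mulrA mulr_le0_ge0 ?(ltW p0) // mulr_ge0 ?powR_ge0.
by rewrite (ltr0_norm p0) ler0_norm; [apply/andP; split; lra|lra].
Qed.

Lemma integral_powR_segment x y a : 0 < x -> x < y -> a != -1 ->
  (\int[lebesgue_measure]_(u in `[x, y]) (u `^ a)%:E
    = ((y `^ (a + 1) - x `^ (a + 1)) / (a + 1))%:E)%E.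
Proof.
move=> x0 xy an1; have a1 : a + 1 != 0 by rewrite addr_eq0.
pose F (u : R) := (a + 1)^-1 * u `^ (a + 1).
have dF (u : R) : 0 < u -> is_derive u 1 F (u `^ a).
  move=> u0; have := @is_derive1_powR R (a + 1) u u0.
  rewrite addrK => h.
  have -> : u `^ a = (a + 1)^-1 *: ((a + 1) * u `^ a) by rewrite /GRing.scale /= mulKf.
  exact: is_deriveZ.
have cF (u : R) : 0 < u -> {for u, continuous F}.
  by move=> u0; apply/differentiable_continuous/derivable1_diffP; have [] := dF _ u0.
rewrite (@continuous_FTC2 _ _ F) //.
- by rewrite -EFinB /F; congr EFin; ring.
- apply: derivable_within_continuous => u; rewrite in_itv /= => /andP[xu _].
  have u0 : 0 < u by apply: lt_le_trans xu.
  by have [] := @is_derive1_powR R a u u0.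
- split.
  + move=> u; rewrite in_itv /= => /andP[xu _].
    by have [] := dF _ (lt_trans x0 xu).
  + exact: cvg_at_right_filter (cF _ x0).
  + exact: cvg_at_left_filter (cF _ (lt_trans x0 xy)).
- move=> u; rewrite in_itv /= => /andP[xu _].
  by rewrite derive1E; have [] := dF _ (lt_trans x0 xu).
Qed.

(* The integral is the supremum of the integrals over [eps, 1]. *)
Lemma integral_powR_01_le a : -1 < a ->
  (\int[lebesgue_measure]_(u in `]0%R, 1%R]) (u `^ a)%:E <= ((a + 1)^-1)%:E)%E.
Proof.
move=> a1; have a10 : 0 < a + 1 by lra.
pose D (n : nat) : set R := `[n.+2%:R^-1, 1%R]%classic.
have -> : `]0%R, 1%R]%classic = \bigcup_n D n.
  apply/seteqP; split => u /=; rewrite ?in_itv /=.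
    move=> /andP[u0 u1]; exists (Num.truncn u^-1) => //.
    rewrite /D /= in_itv /= u1 andbT -[leRHS]invrK lef_pV2 ?posrE ?invr_gt0 //.
    have := truncnS_gt u^-1; move=> /ltW /le_trans; apply.
    by rewrite ler_nat.
  move=> [n _]; rewrite /D /= in_itv /= => /andP[nu ->]; rewrite andbT.
  by apply: lt_le_trans nu; rewrite invr_gt0.
have mf n : measurable_fun (D n) (fun u : R => (u `^ a)%:E).
  by apply/measurable_EFinP; apply: measurable_funTS; exact: measurable_powR.
have ndD : {homo D : n m / (n <= m)%N >-> (n <= m)%O}.
  move=> n m nm; apply/subsetPset => u; rewrite /D /= !in_itv /= => /andP[nu ->].
  rewrite andbT; apply: le_trans nu; rewrite lef_pV2 ?posrE // ler_nat.
  by rewrite !ltnS.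
have cv := ge0_nondecreasing_set_cvg_integral (mu := lebesgue_measure) ndD
  (fun n => measurable_itv _) mf (fun n u _ => powR_ge0 u a).
apply: (cvge_le _ cv).
apply: nearW => n; rewrite integral_powR_segment ?invr_gt0 //; last first.
  + by rewrite gt_eqF.
  + by rewrite invf_lt1 // ltr1n.
  by rewrite lee_fin powR1 ler_pdivrMr // mulVf ?gt_eqF // gerBl powR_ge0.
Qed.

Lemma integral_powR_tail_le a x : a < -1 -> 0 < x ->
  (\int[lebesgue_measure]_(u in `[x, +oo[) (u `^ a)%:E
    <= (x `^ (a + 1) / (- (a + 1)))%:E)%E.
Proof.
move=> a1 x0; have a10 : a + 1 < 0 by lra.
pose D (n : nat) : set R := `[x, x + n.+1%:R]%classic.
have -> : `[x, +oo[%classic = \bigcup_n D n.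
  apply/seteqP; split => u /=; rewrite ?in_itv /= ?andbT.
    move=> xu; exists (Num.truncn (u - x)) => //.
    by rewrite /D /= in_itv /= xu /= -lerBlDl ltW // truncnS_gt.
  by move=> [n _]; rewrite /D /= in_itv /= => /andP[].
have mf n : measurable_fun (D n) (fun u : R => (u `^ a)%:E).
  by apply/measurable_EFinP; apply: measurable_funTS; exact: measurable_powR.
have ndD : {homo D : n m / (n <= m)%N >-> (n <= m)%O}.
  move=> n m nm; apply/subsetPset => u; rewrite /D /= !in_itv /= => /andP[-> nu] /=.
  by apply: le_trans nu _; rewrite lerD2l ler_nat ltnS.
have cv := ge0_nondecreasing_set_cvg_integral (mu := lebesgue_measure) ndD
  (fun n => measurable_itv _) mf (fun n u _ => powR_ge0 u a).
apply: (cvge_le _ cv).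
apply: nearW => n; rewrite integral_powR_segment ?ltrDl ?lt_eqF //.
  rewrite lee_fin -mulrNN -invrN opprB ler_pM2r ?invr_gt0 ?oppr_gt0 //.
  by rewrite gerBl powR_ge0.
Qed.

End power_functions.

Section ge0_real_integral.
Context {disp : measure_display} {T : measurableType disp} {R : realType}.
Variable mu : {measure set T -> \bar R}.
Implicit Types f g : T -> R.

Lemma ge0_integral_le f g : measurable_fun setT f -> measurable_fun setT g ->
  (forall x, 0 <= f x) -> (forall x, f x <= g x) ->
  (\int[mu]_x (f x)%:E <= \int[mu]_x (g x)%:E)%E.
Proof.
move=> mf mg f0 fg; apply: ge0_le_integral => //.
- by move=> x _; rewrite lee_fin.
- exact/measurable_EFinP.
- exact/measurable_EFinP.
- by move=> x _; rewrite lee_fin.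
Qed.

Lemma ge0_integral_add f g : measurable_fun setT f -> measurable_fun setT g ->
  (forall x, 0 <= f x) -> (forall x, 0 <= g x) ->
  (\int[mu]_x (f x + g x)%:E = \int[mu]_x (f x)%:E + \int[mu]_x (g x)%:E)%E.
Proof.
move=> mf mg f0 g0; rewrite -ge0_integralD //.
- by move=> x _; rewrite lee_fin.
- exact/measurable_EFinP.
- by move=> x _; rewrite lee_fin.
- exact/measurable_EFinP.
Qed.

Lemma ge0_integral_scale f (a : R) : measurable_fun setT f ->
  (forall x, 0 <= f x) -> 0 <= a ->
  (\int[mu]_x (a * f x)%:E = a%:E * \int[mu]_x (f x)%:E)%E.
Proof.
move=> mf f0 a0; rewrite -ge0_integralZl_EFin //.
- by move=> x _; rewrite lee_fin.
- exact/measurable_EFinP.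
Qed.

Lemma ge0_integral_bigsum (I : Type) (s : seq I) (f : I -> T -> R) :
  (forall i, measurable_fun setT (f i)) -> (forall i x, 0 <= f i x) ->
  (\int[mu]_x (\sum_(i <- s) f i x)%:E = \sum_(i <- s) \int[mu]_x (f i x)%:E)%E.
Proof.
move=> mf f0; rewrite -ge0_integral_sum //.
- by apply: eq_integral => x _; rewrite sumEFin.
- by move=> i; exact/measurable_EFinP.
- by move=> i x _; rewrite lee_fin.
Qed.

End ge0_real_integral.

(** The right side minus the left side is half the double sum of a_i a_j (x_i - x_j)^2. *)
Lemma sqr_wsum_le {R : realType} (I : Type) (s : seq I) (a x : I -> R) :
  (forall i, 0 <= a i) ->
  (\sum_(i <- s) a i * x i) ^+ 2
    <= (\sum_(i <- s) a i) * \sum_(i <- s) a i * x i ^+ 2.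
Proof.
move=> a0.
have E (u v : I -> R) : (\sum_(i <- s) a i * u i) * (\sum_(i <- s) a i * v i)
    = \sum_(i <- s) \sum_(j <- s) a i * a j * (u i * v j).
  rewrite mulr_suml; apply: eq_bigr => i _; rewrite mulr_sumr.
  by apply: eq_bigr => j _; ring.
have E1 : (\sum_(i <- s) a i) * (\sum_(i <- s) a i * x i ^+ 2)
    = \sum_(i <- s) \sum_(j <- s) a i * a j * x j ^+ 2.
  rewrite mulr_suml; apply: eq_bigr => i _; rewrite mulr_sumr.
  by apply: eq_bigr => j _; ring.
have E2 : (\sum_(i <- s) a i) * (\sum_(i <- s) a i * x i ^+ 2)
    = \sum_(i <- s) \sum_(j <- s) a i * a j * x i ^+ 2.
  rewrite E1 exchange_big; apply: eq_bigr => i _; apply: eq_bigr => j _.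
  by rewrite [a i * _]mulrC.
suff : 2 * (\sum_(i <- s) a i * x i) ^+ 2
    <= (\sum_(i <- s) a i) * (\sum_(i <- s) a i * x i ^+ 2)
       + (\sum_(i <- s) a i) * (\sum_(i <- s) a i * x i ^+ 2) by lra.
rewrite {1}E1 E2 -big_split expr2 E mulr_sumr /=.
apply: ler_sum => i _; rewrite -big_split mulr_sumr; apply: ler_sum => j _ /=.
have h : 0 <= a i * a j * (x i - x j) ^+ 2
  by apply: mulr_ge0; [exact: mulr_ge0|exact: sqr_ge0].
move: (a i * a j) h => c h; nra.
Qed.

Lemma sqrD_le {R : realType} (x y : R) : (x + y) ^+ 2 <= 2 * (x ^+ 2 + y ^+ 2).
Proof. by have := sqr_ge0 (x - y); nra. Qed.

Lemma le0_ler_powR {R : realType} (x y q : R) :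
  q <= 0 -> 0 < x -> x <= y -> y `^ q <= x `^ q.
Proof.
move=> q0 x0 xy; have y0 := lt_le_trans x0 xy.
rewrite -(opprK q) !(powRN _ (- q)) lef_pV2 ?posrE ?powR_gt0 //.
by apply: ge0_ler_powR; rewrite ?nnegrE ?oppr_ge0 // ltW.
Qed.

(** * Square integral of the sampled kernel *)

Section noise_kernel.
Context {R : realType}.
Variable p : R.
Hypotheses (p_lo : - 2^-1 < p) (p_hi : p < 2^-1).

(* The power function is split into a Lipschitz ramp and a part supported in
   (0, 1), which carries the singularity at 0. *)
Definition ramp (u : R) : R :=
  if u <= 0 then 0 else if u < 1 then u else u `^ p.

Definition loc_ker (u : R) : R := pos_powR u p - ramp u.

(** The indicator of (-1, 1) is there for the increments of [ramp] over steps of length at most 1: a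
    step that crosses 0 starts above -1, and the slope of [ramp] is at most 1. *)
Definition short_ker (u : R) : R :=
  `|loc_ker u| + (if (-1 < u) && (u < 1) then 1 else 0).

(** The slope of u^p in absolute value, cut off below 1, where [short_ker] takes over. *)
Definition tail_ker (u : R) : R := if 1 <= u then `|p| * u `^ (p - 1) else 0.

(** The function kappa of the overview: it bounds [loc_ker], and h times it bounds the increments of
    [ramp] over a step h. *)
Definition noise_ker (u : R) : R := short_ker u + tail_ker u.

Lemma normp_le1 : `|p| <= 1.
Proof. by have := p_lo; have := p_hi; rewrite ler_norml => ? ?; apply/andP; split; lra. Qed.

Lemma tail_ker_ge0 u : 0 <= tail_ker u.
Proof. by rewrite /tail_ker; case: ifP => // _; rewrite mulr_ge0 ?powR_ge0. Qed.

Lemma short_ker_ge0 u : 0 <= short_ker u.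
Proof. by rewrite addr_ge0 //; case: ifP. Qed.

Lemma noise_ker_ge0 u : 0 <= noise_ker u.
Proof. by rewrite addr_ge0 ?short_ker_ge0 ?tail_ker_ge0. Qed.

Lemma loc_ker_le u : `|loc_ker u| <= noise_ker u.
Proof.
rewrite /noise_ker /short_ker -addrA lerDl addr_ge0 ?tail_ker_ge0 //.
by case: ifP.
Qed.

Lemma powR_increment_le (u v : R) : 1 <= u -> u <= v ->
  `|v `^ p - u `^ p| <= tail_ker u * (v - u).
Proof.
have hp1 := p_lo; have hp2 := p_hi.
move=> u1 uv; rewrite /tail_ker u1.
have p1 : p <= 1 by lra.
by have /andP[] := powR_increment (lt_le_trans ltr01 u1) uv p1.
Qed.

Lemma ramp_increment (u h : R) : 0 <= h <= 1 ->
  `|ramp (u + h) - ramp u| <= h * noise_ker u.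
Proof.
move=> /andP[h0 h1].
have rampE v : 1 <= v -> ramp v = v `^ p.
  by move=> v1; rewrite /ramp ltNge v1 leNgt (lt_le_trans ltr01 v1).
have uh : u <= u + h by rewrite lerDl.
have [u1|u1] := leP 1 u.
  rewrite !rampE ?(le_trans u1) //.
  apply: le_trans (powR_increment_le u1 uh) _.
  rewrite [u + h]addrC addrK mulrC ler_wpM2l //.
  by rewrite lerDr short_ker_ge0.
have [um1|um1] := leP u (-1).
  have -> : ramp (u + h) = 0 by rewrite /ramp; case: ifP => //; lra.
  have -> : ramp u = 0 by rewrite /ramp; case: ifP => //; lra.
  by rewrite subrr normr0 mulr_ge0 ?noise_ker_ge0.
(* On (-1, 1) the indicator makes the kernel at least 1, so a Lipschitz bound with constant 1
   suffices. A step ending beyond 1 is cut at 1, where [ramp] equals 1. *)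
suff H : `|ramp (u + h) - ramp u| <= h.
  apply: le_trans H _; rewrite ler_peMr //.
  rewrite /noise_ker /short_ker um1 u1 /= -addrA addrCA lerDl.
  by rewrite addr_ge0 ?tail_ker_ge0.
have ru : ramp u = Num.max u 0.
  by rewrite /ramp u1; case: leP.
have [v1|v1] := ltP (u + h) 1.
  have -> : ramp (u + h) = Num.max (u + h) 0.
    by rewrite /ramp v1; case: leP.
  by rewrite ru; case: (leP (u + h) 0) => ?; case: (leP u 0) => ?; rewrite ger0_norm; lra.
have r1 : `|(u + h) `^ p - 1| <= u + h - 1.
  have := powR_increment_le (lexx 1) v1; rewrite powR1 => /le_trans; apply.
  rewrite ler_piMl ?subr_ge0 // /tail_ker lexx powR1 mulr1; exact: normp_le1.
have r2 : `|1 - ramp u| <= 1 - u.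
  by rewrite ru; case: (leP u 0) => ?; rewrite ger0_norm; lra.
rewrite rampE // (_ : _ - _ = ((u + h) `^ p - 1) + (1 - ramp u)); last by ring.
by apply: le_trans (ler_normD _ _) _; lra.
Qed.

(** On (0, 1) the local part is u^p - u, which lies between 0 and u^p; the square u^(2p) is
    integrable at 0 because p > - 1/2. *)
Lemma short_ker_sqr_le u : short_ker u ^+ 2
  <= 2 * ((if (-1 < u) && (u < 1) then 1 else 0)
          + (if (0 < u) && (u < 1) then u `^ (2 * p) else 0)).
Proof.
have hp1 := p_lo; have hp2 := p_hi.
rewrite /short_ker; have [u0|u0] := leP u 0.
  have -> : loc_ker u = 0.
    by rewrite /loc_ker /pos_powR /ramp u0 ltNge u0 /= subrr.
  by rewrite normr0 add0r addr0; case: ifP => _; lra.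
have [u1|u1] := ltP u 1; last first.
  have -> : loc_ker u = 0.
    by rewrite /loc_ker /pos_powR /ramp u0 leNgt u0 ltNge u1 /= subrr.
  by rewrite normr0 add0r addr0 andbF; lra.
rewrite (lt_trans _ u0) ?ltrN10 //=.
apply: le_trans (sqrD_le _ _) _; rewrite expr1n addrC ler_wpM2l // lerD2l.
have -> : u `^ (2 * p) = (u `^ p) ^+ 2 by rewrite mulrC powRrM powR_mulrn ?powR_ge0.
rewrite ler_pXn2r ?nnegrE ?powR_ge0 // /loc_ker /pos_powR /ramp u0 [u <= 0]leNgt u0 u1 /=.
have : u <= u `^ p by rewrite ger1_powR ?u0 ?(ltW u1) //; lra.
by move=> h; rewrite ger0_norm ?subr_ge0 // gerBl ltW.
Qed.

Lemma measurable_pos_powR a : measurable_fun [set: R] (fun u : R => pos_powR u a).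
Proof.
by apply: measurable_fun_ifT => //; exact: measurable_fun_ltr.
Qed.

Lemma measurable_short_ker : measurable_fun [set: R] short_ker.
Proof.
apply: measurable_funD.
  apply: measurableT_comp => //; apply: measurable_funB.
    exact: measurable_pos_powR.
  apply: measurable_fun_ifT => //; first exact: measurable_fun_ler.
  apply: measurable_fun_ifT => //; exact: measurable_fun_ltr.
apply: measurable_fun_ifT => //.
by apply: measurable_and; exact: measurable_fun_ltr.
Qed.

Lemma measurable_tail_ker : measurable_fun [set: R] tail_ker.
Proof.
apply: measurable_fun_ifT => //; first exact: measurable_fun_ler.
by apply: measurable_funM => //; exact: measurable_powR.
Qed.

Lemma measurable_noise_ker : measurable_fun [set: R] noise_ker.
Proof.
by apply: measurable_funD; [exact: measurable_short_ker|exact: measurable_tail_ker].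
Qed.

(** A substitute for comparing a sum with an integral: f plays the part of an antiderivative of
    c. *)
Lemma telescoping_sum_le (c f : R -> R) (D : R) :
  (forall u, D * c u <= f (u + D) - f u) ->
  forall n s, D * \sum_(k < n) c (k.+1%:R * D - s)
    <= f (n.+1%:R * D - s) - f (D - s).
Proof.
move=> cf n s; elim: n => [|n IH]; first by rewrite big_ord0 mulr0 mul1r subrr.
rewrite big_ord_recr mulrDr /=; apply: le_trans (lerD IH (cf _)) _.
rewrite (_ : n.+1%:R * D - s + D = n.+2%:R * D - s); last by rewrite -[n.+2]addn1 natrD; ring.
by lra.
Qed.

Lemma unit_window_count (D : R) n s : 0 < D ->
  \sum_(k < n) (if (-1 < k.+1%:R * D - s) && (k.+1%:R * D - s < 1) then 1 else 0 : R)
    <= (2 + D) / D.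
Proof.
move=> D0; rewrite ler_pdivlMr // mulrC.
(* The identity clipped to [-1, 1 + D]: from u in (-1, 1) to u + D it increases by exactly D, and
   its total increase is 2 + D. *)
pose f (u : R) := if u <= -1 then -1 else if u <= 1 + D then u else 1 + D.
have f_lo u : -1 <= f u.
  by rewrite /f; case: (leP u (-1)) => ?; case: (leP u (1 + D)) => ?; lra.
have f_hi u : f u <= 1 + D.
  by rewrite /f; case: (leP u (-1)) => ?; case: (leP u (1 + D)) => ?; lra.
apply: le_trans (@telescoping_sum_le
  (fun u => if (-1 < u) && (u < 1) then 1 else 0) f D _ n s) _.
  move=> u; rewrite /f.
  case: (leP u (-1)) => ?; case: (leP (u + D) (-1)) => ?; case: (leP u (1 + D)) => ?;
    case: (leP (u + D) (1 + D)) => ?; case: (ltP u 1) => ? /=; lra.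
by have := f_lo (D - s); have := f_hi (n.+1%:R * D - s); lra.
Qed.

Lemma tail_sum_le (D : R) n s : 0 < D -> 1 <= n%:R * D -> - (n%:R * D) <= s ->
  D * \sum_(k < n) tail_ker (k.+1%:R * D - s)
    <= (1 + D) ^+ 2 * (2 + D) * Num.max 1 ((n%:R * D) `^ p).
Proof.
have hp1 := p_lo; have hp2 := p_hi.
move=> D0 nD sn.
pose m (u : R) := Num.max u 1.
(* An increasing antiderivative of the slope, hence the sign. The factor (1 + D)^2 pays for
   replacing (u + D)^(p - 1) by u^(p - 1): for u >= 1 their ratio is at most (1 + D)^(1 - p), and 1
   - p <= 2. *)
pose f (u : R) := (1 + D) ^+ 2 * (if 0 <= p then m u `^ p else - m u `^ p).
have m0 u : 0 < m u by rewrite /m lt_max ltr01 orbT.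
have mono u v : u <= v -> f u <= f v.
  move=> uv; have muv : m u <= m v by rewrite /m ge_max !le_max uv lexx orbT.
  rewrite /f ler_wpM2l ?sqr_ge0 //; case: (leP 0 p) => p0.
    by apply: ge0_ler_powR; rewrite ?nnegrE ?(ltW (m0 _)).
  by rewrite lerN2 le0_ler_powR // ltW.
apply: le_trans (@telescoping_sum_le tail_ker f D _ n s) _.
  move=> u; rewrite /tail_ker; case: ifP => u1; last first.
    by rewrite mulr0 subr_ge0 mono // lerDl ltW.
  have u0 : 0 < u by lra.
  have p1 : p <= 1 by lra.
  have v1 : 1 <= u + D by lra.
  have uv : u <= u + D by lra.
  have /andP[h _] := powR_increment u0 uv p1.
  have fE : f (u + D) - f u = (1 + D) ^+ 2 * `|(u + D) `^ p - u `^ p|.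
    rewrite /f /m !max_l // -mulrBr; congr (_ * _).
    case: (leP 0 p) => p0.
      rewrite ger0_norm // subr_ge0.
      by apply: ge0_ler_powR; rewrite ?nnegrE //; lra.
    rewrite ler0_norm; first by ring.
    by rewrite subr_le0 le0_ler_powR // ltW.
  rewrite fE; apply: le_trans (ler_wpM2l (sqr_ge0 _) h).
  rewrite (_ : u + D - u = D); last by ring.
  have : u `^ (p - 1) <= (1 + D) ^+ 2 * (u + D) `^ (p - 1).
    have -> : u `^ (p - 1) = (u / (u + D)) `^ (p - 1) * (u + D) `^ (p - 1).
      by rewrite -powRM ?divr_ge0 ?divfK ?gt_eqF //; lra.
    apply: ler_wpM2r; first exact: powR_ge0.
    rewrite -[u / _]invrK invf_div -powR_inv1; last by rewrite divr_ge0; lra.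
    rewrite -powRrM -powR_mulrn; last by lra.
    apply: (@le_trans _ _ ((1 + D) `^ (-1 * (p - 1)))); last first.
      by apply: ler_powR; lra.
    apply: ge0_ler_powR; rewrite ?nnegrE ?divr_ge0 //; try lra.
    rewrite ler_pdivrMr //; nra.
  move=> h2; have : 0 <= D * `|p| by rewrite mulr_ge0 // ltW.
  move=> /ler_wpM2l /(_ _ _ h2); lra.
rewrite -mulrA -mulrBr ler_wpM2l ?sqr_ge0 //.
set M := Num.max 1 _; have M1 : 1 <= M by rewrite /M le_max lexx.
have D2 : 1 <= 2 + D by lra.
case: (leP 0 p) => p0; last first.
  have : m (D - s) `^ p <= 1.
    have h : 1 <= m (D - s) by rewrite /m le_max lexx orbT.
    by have := le0_ler_powR (ltW p0) ltr01 h; rewrite powR1.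
  have := powR_ge0 (m (n.+1%:R * D - s)) p; nra.
(* Since s >= - n D and n D >= 1, the largest argument (n + 1) D - s is at most (2 + D) n D. *)
have : m (n.+1%:R * D - s) `^ p <= (2 + D) * M.
  apply: (@le_trans _ _ (((2 + D) * (n%:R * D)) `^ p)).
    apply: ge0_ler_powR; rewrite ?nnegrE ?(ltW (m0 _)) //; first by nra.
    rewrite /m ge_max; apply/andP; split; last by nra.
    by rewrite -natr1; nra.
  rewrite powRM; [|lra|lra]; apply: ler_pM; rewrite ?powR_ge0 //.
    by apply: ler1_powR => //; lra.
  by rewrite /M le_max lexx orbT.
have := powR_ge0 (m (D - s)) p; nra.
Qed.

Lemma tail_sum_far_le (D : R) n s : 0 < D -> 1 <= n%:R * D -> s <= - (n%:R * D) ->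
  \sum_(k < n) tail_ker (k.+1%:R * D - s) <= n%:R * (- s) `^ (p - 1).
Proof.
have hp1 := p_lo; have hp2 := p_hi.
move=> D0 nD sn; rewrite -[X in X%:R * _](card_ord n) -sum1_card natr_sum mulr_suml.
apply: ler_sum => k _; rewrite mul1r.
have kD : 0 < k.+1%:R * D by rewrite mulr_gt0.
rewrite /tail_ker ifT; last by lra.
apply: le_trans (ler_piMl (powR_ge0 _ _) normp_le1) _.
by apply: le0_ler_powR; lra.
Qed.

Lemma tail_sum_late (D : R) n s : 0 < D -> n%:R * D < s ->
  \sum_(k < n) tail_ker (k.+1%:R * D - s) = 0.
Proof.
have hp1 := p_lo; have hp2 := p_hi.
move=> D0 sn; apply: big1 => k _; rewrite /tail_ker ifF //; apply/negbTE.
rewrite -ltNge; have : k.+1%:R * D <= n%:R * D by rewrite ler_pM2r // ler_nat.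
lra.
Qed.

End noise_kernel.

Section ker_sum.
Context {R : realType}.
Local Notation leb := (@lebesgue_measure R).

Lemma integral_if_itv (i : interval R) (f : R -> R) :
  (\int[leb]_u (if u \in i then f u else 0)%:E = \int[leb]_(u in [set` i]) (f u)%:E)%E.
Proof.
rewrite [RHS]integral_mkcond; apply: eq_integral => u _.
by rewrite patchE mem_setE; case: ifP.
Qed.

Lemma integral_one_itv (i : interval R) :
  (\int[leb]_u (if u \in i then 1 else 0)%:E = leb [set` i])%E.
Proof.
have := @integral_indic _ _ R leb setT measurableT _ (measurable_itv i).
rewrite setIT => <-; by apply: eq_integral => u _; rewrite indicE mem_setE; case: (u \in i).
Qed.

Lemma measurable_if_itv (i : interval R) (f : R -> R) : measurable_fun [set: R] f ->
  measurable_fun [set: R] (fun u => if u \in i then f u else 0).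
Proof.
move=> mf; have -> : (fun u => if u \in i then f u else 0) = f \* \1_[set` i].
  apply/funext => u /=; rewrite indicE mem_setE.
  by case: (u \in i); rewrite ?mulr1 ?mulr0.
by apply: measurable_funM => //; exact: measurable_indic.
Qed.

Variable p : R.
Hypotheses (p_lo : - 2^-1 < p) (p_hi : p < 2^-1).

Definition ker_sum (n : nat) (D s : R) : R :=
  \sum_(k < n) noise_ker p (k.+1%:R * D - s).

Lemma ker_sum_ge0 n D s : 0 <= ker_sum n D s.
Proof. by apply: sumr_ge0 => k _; exact: noise_ker_ge0. Qed.

Lemma measurable_ker_sum n D : measurable_fun [set: R] (ker_sum n D).
Proof.
apply: measurable_sum => k.
apply: (measurableT_comp (measurable_noise_ker p)); exact: measurable_funB.
Qed.

Definition short_dom (u : R) : R :=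
  2 * ((if u \in `]-1, 1[ then 1 else 0) + (if u \in `]0, 1] then u `^ (2 * p) else 0)).

Definition short_mass : R := 2 * (2 + (2 * p + 1)^-1).

Lemma short_dom_ge0 u : 0 <= short_dom u.
Proof.
by rewrite /short_dom mulr_ge0 ?addr_ge0 //; case: ifP => //; rewrite powR_ge0.
Qed.

Lemma measurable_short_dom : measurable_fun [set: R] short_dom.
Proof.
apply: measurable_funM => //; apply: measurable_funD.
  by apply: (@measurable_if_itv _ (cst 1)).
by apply: measurable_if_itv; exact: measurable_powR.
Qed.

Lemma integral_short_dom : (\int[leb]_u (short_dom u)%:E <= short_mass%:E)%E.
Proof.
have m1 : measurable_fun [set: R] (fun u : R => if u \in `](-1 : R), (1 : R)[ then 1 else 0 : R).
  exact: (@measurable_if_itv _ (cst 1)).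
have m2 : measurable_fun [set: R] (fun u : R => if u \in `](0 : R), (1 : R)] then u `^ (2 * p) else 0 : R).
  by apply: measurable_if_itv; exact: measurable_powR.
rewrite ge0_integral_scale //; last 2 first.
- exact: measurable_funD.
- by move=> u; rewrite addr_ge0 //; case: ifP => // _; rewrite powR_ge0.
rewrite ge0_integral_add //; last 2 first.
- by move=> u; case: ifP.
- by move=> u; case: ifP => // _; rewrite powR_ge0.
rewrite /short_mass EFinM lee_pmul2l // EFinD; apply: leeD.
  rewrite integral_one_itv lebesgue_measure_itv /=.
  by rewrite lte_fin ifT ?lee_fin; lra.
rewrite (integral_if_itv _ (fun u => u `^ (2 * p))).
by apply: integral_powR_01_le; have := p_lo; lra.
Qed.

(** Cauchy-Schwarz with the indicator of (-1, 1) as weight: at most (2 + D) / D sampling points fall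
    in the window where the short kernel lives. *)
Lemma short_sum_sqr_le (D : R) n s : 0 < D ->
  (\sum_(k < n) short_ker p (k.+1%:R * D - s)) ^+ 2
    <= (2 + D) / D * \sum_(k < n) short_dom (k.+1%:R * D - s).
Proof.
move=> D0; pose a (u : R) : R := if (-1 < u) && (u < 1) then 1 else 0.
have domE u : short_ker p u ^+ 2 <= short_dom u.
  apply: le_trans (short_ker_sqr_le p_lo p_hi u) _; rewrite ler_wpM2l // !in_itv /= lerD2l.
  case: ifP => [/andP[u0 u1]|_]; first by rewrite u0 (ltW u1).
  by case: ifP => // _; rewrite powR_ge0.
have aE u : short_ker p u = a u * short_ker p u.
  rewrite /a; case: ifP => h; first by rewrite mul1r.
  rewrite mul0r; apply/eqP; rewrite -sqrf_eq0 eq_le sqr_ge0 andbT.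
  apply: le_trans (short_ker_sqr_le p_lo p_hi u) _; rewrite h add0r ifF ?mulr0 //.
  by apply: contraFF h => /andP[u0 ->]; rewrite andbT (lt_trans _ u0) // ltrN10.
under eq_bigr do rewrite aE.
have a0 u : 0 <= a u by rewrite /a; case: ifP.
apply: le_trans (sqr_wsum_le _ _ (fun=> a0 _)) _.
apply: ler_pM.
- exact: sumr_ge0.
- by apply: sumr_ge0 => k _; rewrite mulr_ge0 ?sqr_ge0.
- exact: unit_window_count.
- apply: ler_sum => k _; apply: le_trans (domE _).
  by rewrite /a; case: ifP; rewrite ?mul1r // mul0r sqr_ge0.
Qed.

(** For p = H - 1/2 > 0 this is, at T >= 1, the ratio T^(2H) / T of the variances of B^H and of
    Brownian motion. *)
Definition growth (T : R) : R := Num.max 1 (T `^ (2 * p)).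

Lemma growth_ge1 T : 1 <= growth T.
Proof. by rewrite le_max lexx. Qed.

Lemma sqr_max_growth T : Num.max 1 (T `^ p) ^+ 2 = growth T.
Proof.
have -> : growth T = Num.max 1 ((T `^ p) ^+ 2).
  by rewrite /growth mulrC powRrM powR_mulrn ?powR_ge0.
have := powR_ge0 T p; move: (T `^ p) => y y0.
case: (leP 1 y) => h; case: leP => h'; rewrite ?expr1n //; exfalso; nra.
Qed.

(** Two regimes. For |s| <= n D the sum behaves like 1 / D times an integral of the slope, of order
    max(1, (n D)^p); in the remote past s <= - n D each of the n terms is at most (- s)^(p - 1). *)
Definition tail_dom (n : nat) (D s : R) : R :=
  ((1 + D) ^+ 2 * (2 + D) / D) ^+ 2 * growth (n%:R * D)
    * (if s \in `[- (n%:R * D), n%:R * D] then 1 else 0)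
  + n%:R ^+ 2 * (if - s \in `[n%:R * D, +oo[ then (- s) `^ (2 * p - 2) else 0).

Lemma tail_sum_sqr_le (D : R) n s : 0 < D -> 1 <= n%:R * D ->
  (\sum_(k < n) tail_ker p (k.+1%:R * D - s)) ^+ 2 <= tail_dom n D s.
Proof.
move=> D0 nD; have S0 : 0 <= \sum_(k < n) tail_ker p (k.+1%:R * D - s).
  by apply: sumr_ge0 => k _; exact: tail_ker_ge0.
rewrite /tail_dom !in_itv /= andbT.
have c0 : 0 <= ((1 + D) ^+ 2 * (2 + D) / D) ^+ 2 * growth (n%:R * D).
  by rewrite mulr_ge0 ?sqr_ge0 // (le_trans ler01) ?growth_ge1.
have far0 : 0 <= n%:R ^+ 2 * (if n%:R * D <= - s then (- s) `^ (2 * p - 2) else 0).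
  by rewrite mulr_ge0 ?sqr_ge0 //; case: ifP => // _; rewrite powR_ge0.
have [s1|s1] := ltP (n%:R * D) s.
  by rewrite tail_sum_late // expr2 mul0r addr_ge0 // mulr_ge0 //; case: ifP.
have [s2|s2] := leP (- (n%:R * D)) s.
  rewrite ?s1 ?s2 /= mulr1; apply: ler_wpDr => //.
  rewrite -sqr_max_growth -exprMn ler_pXn2r ?nnegrE //; last first.
    apply: mulr_ge0; last by rewrite le_max ler01.
    by rewrite divr_ge0 ?(ltW D0) // mulr_ge0 ?sqr_ge0 //; lra.
  rewrite mulrAC ler_pdivlMr // mulrC; exact: tail_sum_le.
rewrite /= mulr0 add0r ifT; last by lra.
have sn : s <= - (n%:R * D) by exact: ltW.
have := tail_sum_far_le p_lo p_hi D0 nD sn.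
rewrite -(@ler_pXn2r _ 2) ?nnegrE ?mulr_ge0 ?powR_ge0 //; move/le_trans; apply.
rewrite exprMn ler_wpM2l ?sqr_ge0 // -powR_mulrn ?powR_ge0 // -powRrM.
by rewrite (_ : (p - 1) * 2%:R = 2 * p - 2) //; ring.
Qed.

Lemma measurable_tail_dom n D : measurable_fun [set: R] (tail_dom n D).
Proof.
apply: measurable_funD; apply: measurable_funM => //.
  by apply: (@measurable_if_itv _ (cst 1)).
have mf := @measurable_if_itv `[n%:R * D, +oo[ _ (measurable_powR (2 * p - 2)).
have mN : measurable_fun [set: R] (fun s : R => - s) by exact: measurable_funN.
exact: (measurableT_comp mf mN).
Qed.

(** Both regimes produce the factor n / D: the first as n D / D^2, the second as n^2 (n D)^(2p - 1)
    = (n / D) (n D)^(2p), where p < 1/2 gives convergence at infinity. *)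
Lemma integral_tail_dom (n : nat) (D : R) : 0 < D -> 1 <= n%:R * D ->
  (\int[leb]_s (tail_dom n D s)%:E
    <= ((2 * ((1 + D) ^+ 2 * (2 + D)) ^+ 2 + (1 - 2 * p)^-1)
        * (n%:R / D * growth (n%:R * D)))%:E)%E.
Proof.
move=> D0 nD; have hp1 := p_lo; have hp2 := p_hi.
set T := n%:R * D in nD *; set W := growth T; have W1 : 1 <= W by exact: growth_ge1.
have T0 : 0 < T by lra.
have c0 : 0 <= ((1 + D) ^+ 2 * (2 + D) / D) ^+ 2 * W by rewrite mulr_ge0 ?sqr_ge0 //; lra.
have m1 : measurable_fun [set: R] (fun s : R => if s \in `[(- T : R), (T : R)] then 1 else 0 : R).
  exact: (@measurable_if_itv _ (cst 1)).
have mf := @measurable_if_itv `[T, +oo[ _ (measurable_powR (2 * p - 2)).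
have mN : measurable_fun [set: R] (fun s : R => - s) by exact: measurable_funN.
have m2 := measurableT_comp mf mN.
rewrite /tail_dom -/T -/W ge0_integral_add //; last 4 first.
- exact: measurable_funM.
- exact: measurable_funM.
- by move=> s; apply: mulr_ge0; [exact: c0|case: ifP].
- by move=> s; rewrite mulr_ge0 ?sqr_ge0 //; case: ifP => // _; rewrite powR_ge0.
rewrite !ge0_integral_scale //; last 2 first.
- by move=> s; case: ifP => // _; rewrite powR_ge0.
- by move=> s; case: ifP.
have I1 : (\int[leb]_s (if s \in `[(- T : R), T] then 1 else 0)%:E = (2 * T)%:E)%E.
  rewrite integral_one_itv lebesgue_measure_itv /=.
  by rewrite lte_fin ifT; [rewrite -EFinB; congr EFin; ring|lra].
have I2 : (\int[leb]_s (if - s \in `[T, +oo[ then (- s) `^ (2 * p - 2) else 0)%:E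
    <= (T `^ (2 * p - 1) / (1 - 2 * p))%:E)%E.
  have := ge0_integral_reflection (f := fun u =>
    (if u \in `[T, +oo[ then u `^ (2 * p - 2) else 0)%:E) 0.
  under eq_integral do rewrite sub0r.
  move=> ->; last 2 first.
  - exact/measurable_EFinP.
  - by move=> s; rewrite lee_fin; case: ifP => // _; rewrite powR_ge0.
  rewrite (integral_if_itv _ (fun u => u `^ (2 * p - 2))).
  apply: le_trans (integral_powR_tail_le _ T0) _; first by lra.
  rewrite lee_fin (_ : 2 * p - 2 + 1 = 2 * p - 1); last by ring.
  by rewrite opprB.
rewrite I1; apply: (@le_trans _ _ (((((1 + D) ^+ 2 * (2 + D) / D) ^+ 2 * W)%:E * (2 * T)%:E
    + (n%:R ^+ 2)%:E * (T `^ (2 * p - 1) / (1 - 2 * p))%:E)%E)).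
  by rewrite leeD2l // lee_wpmul2l ?lee_fin ?sqr_ge0.
rewrite -!EFinM -EFinD lee_fin [leRHS]mulrDl; apply: lerD.
  by rewrite /T le_eqVlt; apply/orP; left; apply/eqP; field; rewrite gt_eqF.
have -> : n%:R ^+ 2 * (T `^ (2 * p - 1) / (1 - 2 * p))
    = (1 - 2 * p)^-1 * (n%:R / D * T `^ (2 * p)).
  rewrite (powRS (2 * p) T0) {2}/T; field.
  by rewrite gt_eqF //= gt_eqF //; lra.
have n0 : 0 <= n%:R / D by rewrite divr_ge0 // ltW.
rewrite ler_wpM2l ?invr_ge0 //; first by lra.
by rewrite ler_wpM2l // /W /growth le_max lexx orbT.
Qed.

(** D1 stands for an upper bound of all sampling steps, later [Delta 1], which makes the constant
    uniform in n. *)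
Definition ker_const (D1 : R) : R :=
  2 * ((2 + D1) * short_mass
       + (2 * ((1 + D1) ^+ 2 * (2 + D1)) ^+ 2 + (1 - 2 * p)^-1)).

Lemma short_mass_ge0 : 0 <= short_mass.
Proof.
have := p_lo; rewrite /short_mass => hp.
by rewrite mulr_ge0 // addr_ge0 // invr_ge0; lra.
Qed.

Lemma integral_ker_sum_sqr (D1 D : R) (n : nat) :
  0 < D -> D <= D1 -> 1 <= n%:R * D ->
  (\int[leb]_s (ker_sum n D s ^+ 2)%:E
    <= (ker_const D1 * (n%:R / D * growth (n%:R * D)))%:E)%E.
Proof.
move=> D0 DD1 nD; have hp1 := p_lo; have hp2 := p_hi.
pose f1 s := (2 + D) / D * \sum_(k < n) short_dom (k.+1%:R * D - s).
have msd (k : nat) : measurable_fun [set: R] (fun s => short_dom (k.+1%:R * D - s)).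
  by apply: (measurableT_comp measurable_short_dom); exact: measurable_funB.
have mS : measurable_fun [set: R]
    (fun s => \sum_(k < n) short_dom (k.+1%:R * D - s)).
  by apply: measurable_sum => k; exact: msd.
have S0 s : 0 <= \sum_(k < n) short_dom (k.+1%:R * D - s).
  by apply: sumr_ge0 => k _; exact: short_dom_ge0.
have cD : 0 <= (2 + D) / D by rewrite divr_ge0 ?(ltW D0) //; lra.
have mf1 : measurable_fun [set: R] f1 by exact: measurable_funM.
have f10 s : 0 <= f1 s by exact: mulr_ge0.
have t0 s : 0 <= tail_dom n D s by apply: le_trans (tail_sum_sqr_le _ D0 nD); exact: sqr_ge0.
have mt := measurable_tail_dom n D.
apply: (@le_trans _ _ (\int[leb]_s (2 * (f1 s + tail_dom n D s))%:E)%E).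
  apply: ge0_integral_le.
  - by apply: measurable_funX; exact: measurable_ker_sum.
  - by apply: measurable_funM => //; exact: measurable_funD.
  - by move=> s; exact: sqr_ge0.
  - move=> s; rewrite /ker_sum big_split /=; apply: le_trans (sqrD_le _ _) _.
    by rewrite ler_wpM2l // lerD ?short_sum_sqr_le ?tail_sum_sqr_le.
rewrite ge0_integral_scale //; last 2 first.
- exact: measurable_funD.
- by move=> s; rewrite addr_ge0.
rewrite ge0_integral_add // /f1 ge0_integral_scale // ge0_integral_bigsum; last 2 first.
- by move=> k; exact: msd.
- by move=> k s; exact: short_dom_ge0.
have I1 : (\sum_(k < n) \int[leb]_s (short_dom (k.+1%:R * D - s))%:E
    <= (n%:R * short_mass)%:E)%E.
  apply: (@le_trans _ _ (\sum_(k < n) short_mass%:E)%E); last first.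
    by rewrite sumEFin sumr_const card_ord mulr_natl.
  apply: lee_sum => k _.
  have := ge0_integral_reflection (f := fun u => (short_dom u)%:E) (k.+1%:R * D).
  move=> ->; [exact: integral_short_dom| |].
  - by apply/measurable_EFinP; exact: measurable_short_dom.
  - by move=> s; rewrite lee_fin short_dom_ge0.
apply: (@le_trans _ _ (2 * ((2 + D) / D * (n%:R * short_mass)
   + (2 * ((1 + D) ^+ 2 * (2 + D)) ^+ 2 + (1 - 2 * p)^-1)
        * (n%:R / D * growth (n%:R * D))))%:E).
  rewrite [leRHS](EFinM 2) [X in (_ <= _ * X)%E]EFinD [X in (_ <= _ * (X + _))%E]EFinM.
  rewrite lee_wpmul2l // leeD //; first by rewrite lee_wpmul2l // lee_fin.
  exact: integral_tail_dom.
rewrite lee_fin /ker_const -[leRHS]mulrA ler_wpM2l //.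
have N0 : 0 <= n%:R / D by rewrite divr_ge0 // ltW.
have W1 := growth_ge1 (n%:R * D); move: (growth _) W1 => W W1.
have NW : n%:R / D <= n%:R / D * W by rewrite ler_peMr.
rewrite [leRHS]mulrDl; apply: lerD.
  rewrite [leLHS](_ : _ = (2 + D) * short_mass * (n%:R / D)); last by ring.
  apply: ler_pM => //; first by rewrite mulr_ge0 ?short_mass_ge0 //; lra.
  by rewrite ler_wpM2r ?short_mass_ge0 // lerD2l.
rewrite ler_wpM2r ?(le_trans N0 NW) // lerD2r ler_wpM2l //.
rewrite ler_pXn2r ?nnegrE ?mulr_ge0 ?sqr_ge0 //; try lra.
rewrite ler_pM ?sqr_ge0 ?lerD2l //; try lra.
by rewrite ler_pXn2r ?nnegrE ?lerD2l //; lra.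
Qed.

End ker_sum.

(** With x = max(2H - 1, 0) one has a_H = 1 + x and beta_H = 1 - x, and n D >= 1 makes (n D)^x equal
    to [growth]. *)
Lemma conc_rateE {R : realType} (H D : R) (n : nat) : 0 < H < 1 -> (0 < n)%N -> 0 < D ->
  1 <= n%:R * D ->
  conc_rate H n D = n%:R / D * growth (H - 2^-1) (n%:R * D).
Proof.
move=> /andP[H0 H1] n0 D0 nD; rewrite /conc_rate /growth.
have N0 : 0 < n%:R :> R by rewrite ltr0n.
have -> : 2 * (H - 2^-1) = 2 * H - 1 by field.
have [h|h] := leP (2 * H) 1.
  rewrite max_l; last first.
    have := @le0_ler_powR R 1 (n%:R * D) (2 * H - 1).
    by rewrite powR1; apply => //; lra.
  rewrite min_l; last by lra.
  by rewrite mulr1 powRr1 ?ltW // powR_inv1 // ltW.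
rewrite max_r; last first.
  by rewrite -[leLHS](powRr0 (n%:R * D)); apply: ler_powR => //; lra.
rewrite min_r; last by lra.
rewrite powRM ?(ltW N0) ?(ltW D0) // (powRS (2 * H) N0).
have -> : - (2 - 2 * H) = (2 * H - 1) - 1 by ring.
by rewrite (powRS (2 * H - 1) D0); field; rewrite gt_eqF.
Qed.

Lemma ker_const_ge0 {R : realType} (p D : R) : - 2^-1 < p -> p < 2^-1 -> 0 <= D ->
  0 <= ker_const p D.
Proof.
move=> p_lo p_hi D0; apply: mulr_ge0 => //; apply: addr_ge0.
  by apply: mulr_ge0; [lra|exact: short_mass_ge0].
apply: addr_ge0; last by rewrite invr_ge0; lra.
by apply: mulr_ge0 => //; exact: sqr_ge0.
Qed.

(** * Exponential moments and convergence in probability *)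

Section lipschitz_measurable.
Context {disp : measure_display} {T : measurableType disp} {R : realType} {d n : nat}.

Lemma measurable_enorm_sub (Y : T -> 'cV[R]_d) (c : 'cV[R]_d) :
  (forall i, measurable_fun setT (fun w => Y w i 0)) ->
  measurable_fun setT (fun w => enorm (Y w - c)).
Proof.
move=> mY.
have mD : measurable_fun setT (fun w => dotp (Y w - c) (Y w - c)).
  apply: measurable_sum => i.
  under eq_fun do rewrite !mxE.
  by apply: measurable_funM; apply: measurable_funB.
exact: (measurableT_comp (continuous_measurable_fun (@sqrt_continuous R)) mD).
Qed.

(* F is the infimum of the functions F q + K * dist_sum x q, q rational. *)
Lemma measurable_lipschitz_comp (F : ('I_n -> 'cV[R]_d) -> R) (Y : 'I_n -> T -> 'cV[R]_d) :
  lipschitz_dn F -> (forall k i, measurable_fun setT (fun w => Y k w i 0)) ->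
  measurable_fun setT (fun w => F (fun k => Y k w)).
Proof.
move=> [K [K0 FK]] mY.
pose pt (q : {ffun 'I_n * 'I_d -> rat}) (k : 'I_n) : 'cV[R]_d :=
  \col_i (ratr (q (k, i)) : R).
pose q0 : {ffun 'I_n * 'I_d -> rat} := [ffun=> 0].
pose h (m : nat) (w : T) := let q := odflt q0 (unpickle m) in
  F (pt q) + K * dist_sum (fun k => Y k w) (pt q).
have hlb w m : F (fun k => Y k w) <= h m w.
  rewrite /h; set q := odflt _ _.
  have := FK (fun k => Y k w) (pt q).
  by move=> /(le_trans (ler_norm _)); lra.
have -> : (fun w => F (fun k => Y k w)) = (fun w => infs (h^~ w) 0%N).
  apply/funext => w; apply/eqP; rewrite eq_le; apply/andP; split.
    apply: lb_le_inf; first by exists (h 0%N w), 0%N.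
    by move=> _ [m _ <-]; exact: hlb.
  apply/ler_addgt0Pr => e e0.
  have hl : has_inf (sdrop (h^~ w) 0).
    split; first by exists (h 0%N w), 0%N.
    by exists (F (fun k => Y k w)) => _ [m _ <-]; exact: hlb.
  (* Chosen larger than 2 K n d: a rational point within e / N of Y in every coordinate then has F q
     + K dist at most e above F Y, one K dist being explicit and the other coming from F q. *)
  pose N : R := 2 * K * (n * d)%:R + 1.
  have N0 : 0 < N by rewrite /N ltr_wpDl // !mulr_ge0.
  pose eta := e / N; have eta0 : 0 < eta by rewrite divr_gt0.
  have rq (y : R) : exists r : rat, `|y - ratr r| <= eta.
    have : y < y + eta by rewrite ltrDl.
    move=> /rat_in_itvoo [r]; rewrite in_itv /= => /andP[r1 r2]; exists r.
    by rewrite ler0_norm; lra.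
  pose q : {ffun 'I_n * 'I_d -> rat} :=
    [ffun ki => xget 0 [set r : rat | `|Y ki.1 w ki.2 0 - ratr r| <= eta]].
  have dq : dist_sum (fun k => Y k w) (pt q) <= (n * d)%:R * eta.
    apply: (@le_trans _ _ (\sum_(k < n) \sum_(i < d) eta)).
      apply: ler_sum => k _; apply: le_trans (enorm_le_sum _) _.
      apply: ler_sum => i _; rewrite !mxE ffunE.
      by case: xgetP => [r -> //|h']; have [r hr] := rq (Y k w i 0); case: (h' r).
    by rewrite !sumr_const !card_ord -mulrnA mulnC mulr_natl.
  have hm : infs (h^~ w) 0 <= h (pickle q) w by apply: ge_inf; [case: hl|exists (pickle q)].
  apply: le_trans hm _; rewrite /h pickleK /=.
  have F1 : F (pt q) <= F (fun k => Y k w) + K * dist_sum (fun k => Y k w) (pt q).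
    have := FK (fun k => Y k w) (pt q); rewrite ler_norml; lra.
  have : 2 * (K * dist_sum (fun k => Y k w) (pt q)) <= e.
    apply: (@le_trans _ _ (2 * (K * ((n * d)%:R * eta)))); first by rewrite !ler_wpM2l.
    rewrite (_ : 2 * _ = (N - 1) * eta); last by rewrite /N; ring.
    rewrite /eta mulrA ler_pdivrMr // mulrC ler_wpM2l ?(ltW e0) //; lra.
  lra.
apply: measurable_fun_infs.
  by move=> w _; exists (F (fun k => Y k w)) => _ [m _ <-]; exact: hlb.
move=> m; rewrite /h; apply: measurable_funD => //; apply: measurable_funM => //.
by apply: measurable_sum => k; apply: measurable_enorm_sub => i; exact: mY.
Qed.

End lipschitz_measurable.

Section convergence_in_probability.
Context {disp : measure_display} {T : measurableType disp} {R : realType}.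
Variable P : probability T R.

Lemma measurable_gt (e : R) (Z : T -> R) : measurable_fun setT Z ->
  measurable [set w | e < Z w].
Proof.
move=> mZ; rewrite -[X in measurable X]setTI.
have -> : [set w | e < Z w] = Z @^-1` `]e, +oo[%classic.
  by apply/seteqP; split => w /=; rewrite in_itv /= andbT.
by apply: mZ => //; exact: measurable_itv.
Qed.

(** By Egorov's theorem the convergence is uniform off a set of probability less than e. *)
Lemma probability_gt_ae_cvg0 (Z : nat -> T -> R) (e : R) :
  (forall q, measurable_fun setT (Z q)) ->
  {ae P, forall w, Z q w @[q --> \oo] --> 0} -> 0 < e ->
  exists q0, forall q, (q0 <= q)%N -> (P [set w | (e < Z q w)%R] <= e%:E)%E.
Proof.
move=> mZ cZ e0.
have m0 : measurable_fun setT (cst 0 : T -> R) by [].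
have PT : (P setT < +oo)%E by rewrite probability_setT ltry.
have [|A [mA PA unifA]] := ae_pointwise_almost_uniform mZ m0 measurableT PT _ e0.
  by apply: filterS cZ => w cw _.
have nb : nbhs (cst 0 : {uniform` setT `\` A -> R})
    [set h : {uniform` setT `\` A -> R} | forall w, (setT `\` A) w -> `|h w| < e].
  apply/uniform_nbhs; exists [set xy : R * R | ball xy.1 e xy.2]; split.
    exact: (entourage_ball R (PosNum e0)).
  by move=> h hE w Aw; have := hE w Aw; rewrite /ball /= sub0r normrN.
have [q0 _ Hq] := unifA _ nb; exists q0 => q qq0.
apply: le_trans (ltW PA); apply: le_measure; rewrite ?inE //.
  exact: measurable_gt.
move=> w /= ew; apply: contrapT => Aw.
by have := Hq q qq0 w (conj I Aw) => /(le_lt_trans (ler_norm _)); rewrite ltNge ltW.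
Qed.

Lemma probability_gt_sqr (Z : T -> R) (e : R) : measurable_fun setT Z -> 0 < e ->
  (P [set w | (e < `|Z w|)%R] <= (e ^- 2)%:E * \int[P]_w (Z w ^+ 2)%:E)%E.
Proof.
move=> mZ e0.
have mA : measurable [set w | e < `|Z w|].
  by apply: measurable_gt; exact: measurableT_comp.
rewrite -ge0_integral_scale ?invr_ge0 ?sqr_ge0 //; last 2 first.
- exact: measurable_funX.
- by move=> w; exact: sqr_ge0.
have := @integral_indic _ _ R P setT measurableT _ mA; rewrite setIT => <-.
apply: ge0_integral_le.
- exact: measurable_indic.
- by apply: measurable_funM => //; exact: measurable_funX.
- by move=> w; rewrite indicE.
- move=> w; rewrite indicE; case: (boolP (w \in _)) => [|_]; last first.
    by rewrite mulr_ge0 ?invr_ge0 ?sqr_ge0.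
  rewrite inE /= => h; rewrite mulrC ler_pdivlMr ?exprn_gt0 // mul1r.
  by rewrite -[leRHS]real_normK ?num_real // ler_pXn2r ?nnegrE ?(ltW e0) // ltW.
Qed.

Lemma integral_eq_law (U U' : T -> R) (g : R -> R) :
  measurable_fun setT U -> measurable_fun setT U' ->
  measurable_fun [set: R] g -> (forall x, 0 <= g x) ->
  (forall A : set R, measurable A -> P (U @^-1` A) = P (U' @^-1` A)) ->
  (\int[P]_w (g (U w))%:E = \int[P]_w (g (U' w))%:E)%E.
Proof.
move=> mU mU' mg g0 UU'.
have mg' : measurable_fun [set: R] (EFin \o g) by exact/measurable_EFinP.
have E (V : T -> R) (mV : measurable_fun setT V) :
    (\int[P]_w (g (V w))%:E = \int[pushforward P V]_y (EFin \o g) y)%E.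
  rewrite (ge0_integral_pushforward mV) ?preimage_setT //.
  by move=> y _; rewrite lee_fin.
pose law (V : T -> R) (mV : measurable_fun setT V) :=
  measure_function_pushforward__canonical__measure_function_Measure P mV.
rewrite !E //; refine (@eq_measure_integral _ _ R setT (law U' mU') (law U mU) (EFin \o g) _) => A mA _.
exact: UU'.
Qed.

End convergence_in_probability.

(** * Truncated exponential moments and their stability *)

Section truncated_exponential.
Context {disp : measure_display} {T : measurableType disp} {R : realType}.
Variable P : probability T R.
Implicit Types (U : T -> R) (M V : R).

(** The level M truncates the exponential, not U; the integral is then finite for M >= 0 and [fine]
    loses nothing. *)
Definition trunc_exp M U : R := fine (\int[P]_w (Num.min M (expR (U w)))%:E).

Lemma measurable_min_expR M U : measurable_fun setT U ->
  measurable_fun setT (fun w => Num.min M (expR (U w))).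
Proof.
by move=> mU; apply: measurable_minr => //; apply: measurableT_comp.
Qed.

Lemma min_expR_ge0 M (x : R) : 0 <= M -> 0 <= Num.min M (expR x).
Proof. by move=> M0; rewrite le_min M0 expR_ge0. Qed.

Lemma integral_cst_prob (a : R) : (\int[P]_w a%:E = a%:E)%E.
Proof. by rewrite integral_cst // -[RHS]mule1; congr (_ * _)%E; exact: probability_setT. Qed.

Lemma trunc_expE M U : measurable_fun setT U -> 0 <= M ->
  ((trunc_exp M U)%:E = \int[P]_w (Num.min M (expR (U w)))%:E)%E.
Proof.
move=> mU M0; rewrite fineK // ge0_fin_numE; last first.
  by apply: integral_ge0 => w _; rewrite lee_fin min_expR_ge0.
apply: (@le_lt_trans _ _ (\int[P]_w M%:E)%E); last by rewrite integral_cst_prob ltry.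
apply: ge0_integral_le => //.
- exact: measurable_min_expR.
- by move=> w; exact: min_expR_ge0.
- by move=> w; rewrite ge_min lexx.
Qed.

Lemma trunc_exp_ge0 M U : 0 <= M -> 0 <= trunc_exp M U.
Proof.
by move=> M0; apply/fine_ge0/integral_ge0 => w _; rewrite lee_fin min_expR_ge0.
Qed.

Lemma trunc_exp_le M U : measurable_fun setT U -> 0 <= M -> trunc_exp M U <= M.
Proof.
move=> mU M0; rewrite -lee_fin trunc_expE // -[leRHS]integral_cst_prob.
apply: ge0_integral_le => //.
- exact: measurable_min_expR.
- by move=> w; exact: min_expR_ge0.
- by move=> w; rewrite ge_min lexx.
Qed.

Lemma trunc_exp_mono M M' U : measurable_fun setT U -> 0 <= M -> M <= M' ->
  trunc_exp M U <= trunc_exp M' U.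
Proof.
move=> mU M0 MM'; have M'0 := le_trans M0 MM'.
rewrite -lee_fin !trunc_expE //; apply: ge0_integral_le.
- exact: measurable_min_expR.
- exact: measurable_min_expR.
- by move=> w; exact: min_expR_ge0.
- by move=> w; rewrite le_min !ge_min MM' lexx orbT.
Qed.

Lemma trunc_exp_gt0 M U : measurable_fun setT U -> 0 < M -> 0 < trunc_exp M U.
Proof.
move=> mU M0; rewrite lt_def trunc_exp_ge0 ?(ltW M0) // andbT; apply/eqP => E0.
have mf : measurable_fun setT (fun w => (Num.min M (expR (U w)))%:E).
  by apply/measurable_EFinP; exact: measurable_min_expR.
have f0 w : (0 <= (Num.min M (expR (U w)))%:E)%E.
  by rewrite lee_fin min_expR_ge0 // ltW.
have : (\int[P]_w `|(Num.min M (expR (U w)))%:E| = 0)%E.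
  under eq_integral do rewrite gee0_abs //.
  by rewrite -trunc_expE ?(ltW M0) // E0.
move=> /(ae_eq_integral_abs P measurableT mf) ae0.
have : P setT = 0%E.
  have [N [mN PN h]] := ae0.
  apply/eqP; rewrite eq_le measure_ge0 andbT -PN le_measure ?inE //.
  move=> w _; apply: h => /= /(_ Logic.I) /eqP.
  by rewrite eqe; case: leP; rewrite ?gt_eqF ?expR_gt0.
by rewrite probability_setT => /eqP; rewrite onee_eq0.
Qed.

(** Off the exceptional event U <= U' + e, and the factor exp e >= 1 may be taken out of the
    minimum; on that event the integrand is at most M. *)
Lemma trunc_exp_perturb M (e : R) U U' : measurable_fun setT U -> measurable_fun setT U' ->
  0 <= M -> 0 <= e ->
  ((trunc_exp M U)%:E <=
    (expR e * trunc_exp M U')%:E + M%:E * P [set w | (e < `|U w - U' w|)%R])%E.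
Proof.
move=> mU mU' M0 e0.
have mA : measurable [set w | e < `|U w - U' w|].
  by apply: measurable_gt; apply: measurableT_comp => //; exact: measurable_funB.
have mI : measurable_fun setT (\1_[set w | e < `|U w - U' w|] : T -> R).
  exact: measurable_indic.
have := @integral_indic _ _ R P setT measurableT _ mA; rewrite setIT => <-.
rewrite EFinM !trunc_expE // -!ge0_integral_scale ?expR_ge0 //; last 2 first.
- exact: measurable_min_expR.
- by move=> w; exact: min_expR_ge0.
rewrite -ge0_integral_add; last 4 first.
- by apply: measurable_funM => //; exact: measurable_min_expR.
- exact: measurable_funM.
- by move=> w; rewrite mulr_ge0 ?expR_ge0 ?min_expR_ge0.
- by move=> w; rewrite mulr_ge0.
apply: ge0_integral_le.
- exact: measurable_min_expR.
- by apply: measurable_funD; apply: measurable_funM => //; exact: measurable_min_expR.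
- by move=> w; exact: min_expR_ge0.
- move=> w; rewrite indicE; case: (boolP (w \in _)) => [_|].
    by rewrite mulr1 ler_wpDl ?mulr_ge0 ?expR_ge0 ?min_expR_ge0 // ge_min lexx.
  rewrite notin_setE /= mulr0 addr0 => /negP; rewrite -leNgt => /(le_trans (ler_norm _)) h.
  have E1 : 1 <= expR e by rewrite -expR0 ler_expR.
  rewrite ge_min; case: (leP M (expR (U' w))) => hM; first by rewrite ler_peMl.
  by apply/orP; right; rewrite -expRD ler_expR; lra.
Qed.

(* Truncated form of E exp(U) * E exp(- U) <= V.  The product does not change
   when a constant is added to U, so no centering is needed, and the truncation
   makes the property stable under limits in probability. *)
Definition exp_product_le V U : Prop :=
  forall M, 0 < M -> trunc_exp M U * trunc_exp M (fun w => - U w) <= V.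

(** U' approximates a copy U1 of U in law rather than U itself. This is where stationarity will
    enter, U1 being the functional of the solution at later times. *)
Lemma exp_product_le_closed V U : measurable_fun setT U -> 0 <= V ->
  (forall e, 0 < e -> e < 1 -> exists U1 U', [/\ measurable_fun setT U1,
     measurable_fun setT U',
     forall A : set R, measurable A -> P (U @^-1` A) = P (U1 @^-1` A),
     exp_product_le (V + e) U' &
     (P [set w | (e < `|U1 w - U' w|)%R] <= e%:E)%E]) ->
  exp_product_le V U.
Proof.
move=> mU V0 H M M0.
have mN U1 : measurable_fun setT U1 -> measurable_fun setT (fun w => - U1 w).
  by move=> m1; exact: measurable_funN.
(* Sum of the coefficients of e in the estimates [F5] to [F7] below, which use e <= 1/2. *)
pose K := 8 * (V + 1) + 1 + (16 * M ^+ 2 + M ^+ 2).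
have K0 : 0 < K.
  by rewrite /K; have := sqr_ge0 M; lra.
apply/ler_addgt0Pr => r r0.
pose e := Num.min (2^-1) (r / K).
have e0 : 0 < e by rewrite /e lt_min invr_gt0 ltr0n divr_gt0.
have e2 : e <= 2^-1 by rewrite /e ge_min lexx.
have e1 : e < 1 by lra.
have eK : K * e <= r by rewrite mulrC -ler_pdivlMr // /e ge_min lexx orbT.
have E2 : expR e <= 1 + 2 * e.
  clear - e0 e2.
  have : 1 - e <= expR (- e) by exact: expR_ge1Dx.
  have -> : expR e = (expR (- e))^-1 by rewrite -expRN opprK.
  move=> h; rewrite -[leLHS]mul1r ler_pdivrMr ?expR_gt0 //.
  apply: le_trans (ler_wpM2l _ h); nra.
have [U1 [U' [mU1 mU' UU1 good PU]]] := H e e0 e1.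
have step U2 U2' : measurable_fun setT U2 -> measurable_fun setT U2' ->
    (forall w, `|U2 w - U2' w| = `|U1 w - U' w|) ->
    trunc_exp M U2 <= expR e * trunc_exp M U2' + M * e.
  move=> m1 m1' E; rewrite -lee_fin EFinD (EFinM M).
  apply: le_trans (trunc_exp_perturb m1 m1' (ltW M0) (ltW e0)) _.
  rewrite leeD2l // lee_wpmul2l ?lee_fin ?(ltW M0) //.
  by under eq_set do rewrite E.
have s1 := step _ _ mU1 mU' (fun=> erefl).
have NE w : `|- U1 w - - U' w| = `|U1 w - U' w| by rewrite -opprD normrN.
have s2 := step _ _ (mN _ mU1) (mN _ mU') NE.
have mmin : measurable_fun [set: R] (fun y : R => Num.min M (expR y)).
  by apply: measurable_minr => //; exact: measurable_expR.
have mminN : measurable_fun [set: R] (fun y : R => Num.min M (expR (- y))).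
  by apply: measurable_minr => //; apply: measurableT_comp => //; exact: measurable_funN.
have m0 (y : R) : 0 <= Num.min M (expR y) by rewrite min_expR_ge0 // ltW.
have law1 := @integral_eq_law _ _ R P U U1 (fun y => Num.min M (expR y)) mU mU1 mmin m0 UU1.
have law2 := @integral_eq_law _ _ R P U U1 (fun y => Num.min M (expR (- y))) mU mU1 mminN
  (fun y => m0 (- y)) UU1.
have t1 : trunc_exp M U = trunc_exp M U1 by rewrite /trunc_exp law1.
have t2 : trunc_exp M (fun w => - U w) = trunc_exp M (fun w => - U1 w).
  by rewrite /trunc_exp law2.
rewrite -t1 in s1; rewrite -t2 in s2; clear t1 t2 law1 law2 mmin mminN m0 NE.
have g := good M M0.
have a0 := trunc_exp_ge0 U' (ltW M0).
have b0 := trunc_exp_ge0 (fun w => - U' w) (ltW M0).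
have aM := trunc_exp_le mU' (ltW M0).
have bM := trunc_exp_le (mN _ mU') (ltW M0).
have x0 := trunc_exp_ge0 U (ltW M0).
have y0 := trunc_exp_ge0 (fun w => - U w) (ltW M0).
have E0 := expR_ge0 e.
move: (trunc_exp M U) (trunc_exp M (fun w => - U w)) (trunc_exp M U')
  (trunc_exp M (fun w => - U' w)) (expR e) s1 s2 g a0 b0 aM bM x0 y0 E2 E0
  => x y a b E s1 s2 g a0 b0 aM bM x0 y0 E2 E0.
have F1 : x * y <= (E * a + M * e) * (E * b + M * e) by exact: ler_pM.
have F2 : (E * a + M * e) * (E * b + M * e)
    <= ((1 + 2 * e) * a + M * e) * ((1 + 2 * e) * b + M * e).
  have Me : 0 <= M * e by rewrite mulr_ge0 // ltW.
  have Ea : 0 <= E * a by exact: mulr_ge0.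
  have Eb : 0 <= E * b by exact: mulr_ge0.
  by apply: ler_pM; [exact: addr_ge0|exact: addr_ge0|rewrite lerD2r ler_wpM2r
    |rewrite lerD2r ler_wpM2r].
have F3 : ((1 + 2 * e) * a + M * e) * ((1 + 2 * e) * b + M * e)
   = (1 + 2 * e) ^+ 2 * (a * b) + (1 + 2 * e) * (M * e) * (a + b) + M ^+ 2 * e ^+ 2.
  by ring.
have F4 : (1 + 2 * e) ^+ 2 * (a * b) <= (1 + 8 * e) * (V + e).
  apply: ler_pM => //; [exact: sqr_ge0|exact: mulr_ge0|nra].
have F5 : (1 + 2 * e) * (M * e) * (a + b) <= 16 * M ^+ 2 * e.
  apply: (@le_trans _ _ (2 * (M * e) * (2 * M))); last by nra.
  have Me : 0 <= M * e by rewrite mulr_ge0 // ltW.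
  have e12 : 1 + 2 * e <= 2 by lra.
  apply: ler_pM; [|lra| |lra]; last by rewrite ler_wpM2r.
  by apply: mulr_ge0 => //; lra.
have F6 : M ^+ 2 * e ^+ 2 <= M ^+ 2 * e by rewrite ler_wpM2l ?sqr_ge0 //; nra.
have F7 : (1 + 8 * e) * (V + e) <= V + (8 * (V + 1) + 1) * e by nra.
rewrite /K in eK; lra.
Qed.

Lemma integral_expR_le U (c : R) : measurable_fun setT U ->
  (forall M, 0 < M -> trunc_exp M U <= c) -> (\int[P]_w (expR (U w))%:E <= c%:E)%E.
Proof.
move=> mU Uc.
pose g (k : nat) w : \bar R := (Num.min k.+1%:R (expR (U w)))%:E.
have gE w : limn (g^~ w) = (expR (U w))%:E.
  apply/cvg_lim => //; apply: cvg_near_cst; near=> k; rewrite /g; congr EFin.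
  rewrite min_r //; apply: ltW; apply: lt_trans (truncnS_gt _) _.
  rewrite ltr_nat ltnS; near: k; exact: nbhs_infty_gt.
have cv : (\int[P]_w g k w)%E @[k --> \oo] --> (\int[P]_w (expR (U w))%:E)%E.
  have := @cvg_monotone_convergence _ _ R P setT measurableT g.
  under eq_integral do rewrite gE.
  apply.
  - by move=> k; apply/measurable_EFinP; exact: measurable_min_expR.
  - by move=> k w _; rewrite lee_fin min_expR_ge0.
  - move=> w _ k l kl; rewrite lee_fin le_min !ge_min lexx orbT andbT.
    by rewrite ler_nat ltnS kl.
apply: (cvge_le _ cv); apply: nearW => k.
by rewrite -trunc_expE // lee_fin Uc.
Unshelve. all: by end_near. Qed.

(** By [cross] the two truncation levels may differ, so they are removed one after the other; the
    first moment is finite because the other factor, truncated at 1, is positive. *)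
Lemma exp_product_integrals V U : measurable_fun setT U -> exp_product_le V U ->
  exists A B : R, [/\ (\int[P]_w (expR (U w))%:E = A%:E)%E,
    (\int[P]_w (expR (- U w))%:E = B%:E)%E, 0 < A, 0 < B & A * B <= V].
Proof.
move=> mU good.
have mN : measurable_fun setT (fun w => - U w) by exact: measurable_funN.
have cross M M' : 0 < M -> 0 < M' ->
    trunc_exp M U * trunc_exp M' (fun w => - U w) <= V.
  move=> M0 M'0; have m0 : 0 < Num.max M M' by rewrite lt_max M0.
  apply: le_trans (good _ m0); apply: ler_pM; rewrite ?trunc_exp_ge0 ?(ltW M0) ?(ltW M'0) //.
    by apply: trunc_exp_mono; rewrite ?(ltW M0) // le_max lexx.
  by apply: trunc_exp_mono; rewrite ?(ltW M'0) // le_max lexx orbT.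
have fin (U1 : T -> R) c : measurable_fun setT U1 ->
    (forall M, 0 < M -> trunc_exp M U1 <= c) ->
    exists A : R, [/\ (\int[P]_w (expR (U1 w))%:E = A%:E)%E, A <= c & 0 < A].
  move=> m1 h1; have hc := integral_expR_le m1 h1.
  have I0 : (0 <= \int[P]_w (expR (U1 w))%:E)%E.
    by apply: integral_ge0 => w _; rewrite lee_fin expR_ge0.
  exists (fine (\int[P]_w (expR (U1 w))%:E)).
  have E : (\int[P]_w (expR (U1 w))%:E = (fine (\int[P]_w (expR (U1 w))%:E))%:E)%E.
    by rewrite fineK // ge0_fin_numE // (le_lt_trans hc) ?ltry.
  rewrite -E; split => //; first by rewrite -lee_fin -E.
  rewrite -lte_fin -E; apply: (@lt_le_trans _ _ (trunc_exp 1 U1)%:E).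
    by rewrite lte_fin trunc_exp_gt0.
  rewrite trunc_expE //; apply: ge0_integral_le.
  - exact: measurable_min_expR.
  - exact: measurableT_comp.
  - by move=> w; exact: min_expR_ge0.
  - by move=> w; rewrite ge_min lexx orbT.
pose b1 := trunc_exp 1 (fun w => - U w).
have b1_gt0 : 0 < b1 by exact: trunc_exp_gt0.
have [|A [EA _ A0]] := fin U (V / b1) mU.
  by move=> M M0; rewrite ler_pdivlMr // cross.
have [|B [EB BA B0]] := fin _ (V / A) mN.
  move=> M M0; rewrite ler_pdivlMr // mulrC -ler_pdivlMr ?trunc_exp_gt0 //.
  rewrite -lee_fin -EA; apply: integral_expR_le => // M' M'0.
  by rewrite ler_pdivlMr ?trunc_exp_gt0 // cross.
by exists A, B; split => //; rewrite mulrC -ler_pdivlMr.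
Qed.

End truncated_exponential.

(** * Gaussian variables *)

Section gaussian_moment.
Context {R : realType}.
Local Notation leb := (@lebesgue_measure R).
Variable s : R.
Hypothesis s_neq0 : s != 0.

(** Completing the square. *)
Lemma expR_normal_pdf (c x : R) :
  expR (c * x) * normal_pdf 0 s x = expR (c ^+ 2 * s ^+ 2 / 2) * normal_pdf (c * s ^+ 2) s x.
Proof.
rewrite !normal_pdfE // [LHS]mulrCA [RHS]mulrCA; congr (_ * _).
rewrite /normal_fun -!expRD; congr expR.
by field.
Qed.

Lemma integral_expR_normal_pdf (c : R) :
  (\int[leb]_x (expR (c * x) * normal_pdf 0 s x)%:E = (expR (c ^+ 2 * s ^+ 2 / 2))%:E)%E.
Proof.
under eq_integral do rewrite expR_normal_pdf.
rewrite ge0_integral_scale ?expR_ge0 //; last 2 first.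
- exact: measurable_normal_pdf.
- by move=> x; exact: normal_pdf_ge0.
by rewrite integral_normal_pdf // mule1.
Qed.

Lemma cosh_le (x y : R) : `|x| <= `|y| -> expR x + expR (- x) <= expR y + expR (- y).
Proof.
have eV (z : R) : expR z * expR (- z) = 1 by rewrite -expRD subrr expR0.
have key (a b : R) : 0 <= a -> a <= b -> expR a + expR (- a) <= expR b + expR (- b).
  move=> a0 ab.
  have h1 : expR a <= expR b by rewrite ler_expR.
  have h2 : 1 <= expR a by rewrite -[leLHS]expR0 ler_expR.
  have h5 : expR (- b) <= expR (- a) by rewrite ler_expR lerN2.
  have h4 : expR b - expR a = (expR (- a) - expR (- b)) * (expR a * expR b).
    have -> : (expR (- a) - expR (- b)) * (expR a * expR b)
        = expR a * expR (- a) * expR b - expR b * expR (- b) * expR a by ring.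
    by rewrite !eV !mul1r.
  have : (expR (- a) - expR (- b)) * 1 <= (expR (- a) - expR (- b)) * (expR a * expR b).
    rewrite ler_wpM2l ?subr_ge0 // -[leLHS]mulr1.
    by apply: ler_pM => //; apply: le_trans h1.
  lra.
have E (z : R) : expR z + expR (- z) = expR `|z| + expR (- `|z|).
  by case: (ger0P z) => // _; rewrite opprK addrC.
by rewrite (E x) (E y); exact: key.
Qed.

(** By symmetry of the density and oddness of r, exp(c r(x)) may be replaced by cosh(c r(x)), which
    increases with |r(x)| and is thus at most cosh(c x). *)
Lemma integral_expR_odd_normal_pdf (c : R) (r : R -> R) : measurable_fun [set: R] r ->
  (forall x, r (- x) = - r x) -> (forall x, `|r x| <= `|x|) ->
  (\int[leb]_x (expR (c * r x) * normal_pdf 0 s x)%:E <= (expR (c ^+ 2 * s ^+ 2 / 2))%:E)%E.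
Proof.
move=> mr rN rle.
pose f c (r : R -> R) x := expR (c * r x) * normal_pdf 0 s x.
have mf a (g : R -> R) : measurable_fun [set: R] g -> measurable_fun [set: R] (f a g).
  move=> mg; apply: measurable_funM; last exact: measurable_normal_pdf.
  by apply: measurableT_comp => //; exact: measurable_funM.
have f0 a g x : 0 <= f a g x by rewrite mulr_ge0 ?expR_ge0 ?normal_pdf_ge0.
have pdfN x : normal_pdf 0 s (0 - x) = normal_pdf 0 s x.
  by rewrite !normal_pdfE // /normal_fun !subr0 sub0r sqrrN.
have IN : (\int[leb]_x (f (- c) r x)%:E = \int[leb]_x (f c r x)%:E)%E.
  rewrite -(ge0_integral_reflection 0 (f := fun x => (f c r x)%:E)).
  - by apply: eq_integral => x _; rewrite /f pdfN sub0r rN mulrN mulNr.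
  - by apply/measurable_EFinP; exact: mf.
  - by move=> x; rewrite lee_fin.
suff : (\int[leb]_x (f c r x)%:E <= (expR (c ^+ 2 * s ^+ 2 / 2))%:E)%E by [].
have mid : measurable_fun [set: R] (fun x : R => x) by exact: measurable_id.
have : (\int[leb]_x (f c r x)%:E + \int[leb]_x (f (- c) r x)%:E
    <= \int[leb]_x (f c id x)%:E + \int[leb]_x (f (- c) id x)%:E)%E.
  have A g (mg : measurable_fun [set: R] g) :=
    ge0_integral_add leb (mf c g mg) (mf (- c) g mg) (f0 c g) (f0 (- c) g).
  rewrite -(A r mr) -(A id mid).
  apply: ge0_integral_le.
  - by apply: measurable_funD; exact: mf.
  - by apply: measurable_funD; exact: mf.
  - by move=> x; rewrite addr_ge0.
  - move=> x; rewrite /f -!mulrDl ler_wpM2r ?normal_pdf_ge0 // !mulNr.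
    by apply: cosh_le; rewrite !normrM ler_wpM2l.
have E1 a : (\int[leb]_x (f a id x)%:E = (expR (a ^+ 2 * s ^+ 2 / 2))%:E)%E.
  exact: integral_expR_normal_pdf.
rewrite IN (E1 c) (E1 (- c)) sqrrN.
have : (0 <= \int[leb]_x (f c r x)%:E)%E by apply: integral_ge0 => x _; rewrite lee_fin.
move: (\int[leb]_x (f c r x)%:E)%E; case => [I| |] //=.
by rewrite -!EFinD !lee_fin; lra.
Qed.

End gaussian_moment.

Section rounding.
Context {R : realType}.

Lemma truncn_le_self (y : R) : 0 <= y -> (Num.truncn y)%:R <= y.
Proof. by move=> /truncn_itv /andP[]. Qed.

Lemma measurable_truncn_eq (n : nat) : measurable [set x : R | Num.truncn x = n].
Proof.
have le_n k : measurable [set x : R | (Num.truncn x <= k)%N].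
  have -> : [set x : R | (Num.truncn x <= k)%N] = `]-oo, k.+1%:R[%classic.
    by apply/seteqP; split => x /=; rewrite in_itv /= truncn_le_nat.
  exact: measurable_itv.
case: n => [|n].
  have -> : [set x : R | Num.truncn x = 0%N] = [set x : R | (Num.truncn x <= 0)%N].
    by apply/seteqP; split => x /=; [move=> ->|rewrite leqn0 => /eqP].
  exact: le_n.
have -> : [set x : R | Num.truncn x = n.+1]
    = [set x : R | (Num.truncn x <= n.+1)%N] `\` [set x : R | (Num.truncn x <= n)%N].
  apply/seteqP; split => x /=.
    by move=> ->; split => //; rewrite ltnn.
  by move=> [h1 /negP]; rewrite -ltnNge => h2; apply/eqP; rewrite eqn_leq h1.
exact: measurableD.
Qed.

Lemma measurable_truncn : measurable_fun [set: R] (fun x : R => Num.truncn x : nat).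
Proof.
move=> _ Y _; rewrite setTI.
have -> : (fun x : R => Num.truncn x : nat) @^-1` Y
    = \bigcup_(n in Y) [set x : R | Num.truncn x = n].
  by apply/seteqP; split => [x Yx|x [n Yn /= E]]; [exists (Num.truncn x)|rewrite /preimage /= E].
by apply: bigcup_measurable => n _; exact: measurable_truncn_eq.
Qed.

Variable m : nat.
Local Notation M := (m.+1%:R : R).
Local Notation N := ((m.+1 * m.+1)%N).

(* Rounding is towards 0, hence odd and bounded by the identity, so that the
   exponential moments of a rounded symmetric variable are dominated by the
   original ones. *)
Definition level (x : R) : nat :=
  if M * `|x| < N%:R then Num.truncn (M * `|x|) else 0.

Lemma level_lt (x : R) : (level x < N.+1)%N.
Proof.
rewrite /level; case: ifP => // h; rewrite ltnS.
by rewrite -(ler_nat R) (le_trans (truncn_le_self _)) ?mulr_ge0 // ltW.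
Qed.

Definition code (x : R) : bool * 'I_N.+1 := (x < 0, inord (level x)).

Definition decode (t : bool * 'I_N.+1) : R := (-1) ^+ t.1 * (t.2%:R / M).

Definition rnd (x : R) : R := decode (code x).

Lemma rndE x : rnd x = (-1) ^+ (x < 0)%R * ((level x)%:R / M).
Proof. by rewrite /rnd /decode /code /= inordK // level_lt. Qed.

Lemma rndN x : rnd (- x) = - rnd x.
Proof.
have lN : level (- x) = level x by rewrite /level normrN.
rewrite !rndE lN oppr_lt0.
case: ltgtP => [x0|x0|<-]; rewrite ?expr0 ?expr1 ?mul1r ?mulN1r ?opprK //.
by rewrite /level normr0 mulr0 truncn0 if_same mul0r oppr0.
Qed.

Lemma level_le x : (level x)%:R / M <= `|x|.
Proof.
rewrite ler_pdivrMr // mulrC /level; case: ifP => _; last by rewrite mulr_ge0.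
by rewrite truncn_le_self ?mulr_ge0.
Qed.

Lemma norm_rnd_le x : `|rnd x| <= `|x|.
Proof.
by rewrite rndE normrM normrX normrN1 expr1n mul1r ger0_norm ?level_le // divr_ge0.
Qed.

Lemma rnd_approx x : `|x| < M -> `|rnd x - x| <= M^-1.
Proof.
move=> xM; rewrite rndE.
have xE : x = (-1) ^+ (x < 0)%R * `|x|.
  have [x0|x0] := ltP x 0; first by rewrite expr1 mulN1r ltr0_norm // opprK.
  by rewrite expr0 mul1r ger0_norm.
rewrite {3}xE -mulrBr normrM normrX normrN1 expr1n mul1r.
rewrite ler0_norm ?subr_le0 ?level_le // opprB.
rewrite lerBlDr (_ : M^-1 + _ = ((level x)%:R + 1) / M); last by ring.
rewrite ler_pdivlMr // mulrC /level ifT.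
  by rewrite natr1 ltW // truncnS_gt.
by rewrite natrM ltr_pM2l.
Qed.

Lemma measurable_code t : measurable [set x : R | code x = t].
Proof.
have mf : measurable_fun [set: R] (fun x : R => M * `|x|).
  by apply: measurable_funM => //; exact: measurableT_comp.
have mlevel : measurable_fun [set: R] level.
  apply: measurable_fun_ifT => //; first exact: measurable_fun_ltr.
  exact: (measurableT_comp measurable_truncn).
case: t => b k.
have -> : [set x : R | code x = (b, k)]
    = (fun x : R => x < 0) @^-1` [set b] `&` level @^-1` [set (k : nat)].
  apply/seteqP; split => x /=.
    by move=> [<- <-]; rewrite inordK // level_lt.
  by move=> [<- hk]; rewrite /code hk inord_val.
apply: measurableI.
  rewrite -[X in measurable X]setTI.
  by apply: (measurable_fun_ltr (f := fun x : R => x) (g := cst 0)).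
by rewrite -[X in measurable X]setTI; exact: mlevel.
Qed.

Lemma finite_fun_indic {S : Type} {F : finType} (c : S -> F) (f : F -> R) (x : S) :
  f (c x) = \sum_t f t * \1_[set y | c y = t] x.
Proof.
rewrite (bigD1 (c x)) //= indicE mem_set // mulr1 big1 ?addr0 // => t tx.
by rewrite indicE memNset ?mulr0 //= => E; rewrite E eqxx in tx.
Qed.

Lemma measurable_finite_fun {disp : measure_display} {S : measurableType disp} {F : finType}
    (c : S -> F) (f : F -> R) : (forall t, measurable [set y | c y = t]) ->
  measurable_fun setT (fun x => f (c x)).
Proof.
move=> mc; under eq_fun do rewrite finite_fun_indic.
by apply: measurable_sum => t; apply: measurable_funM => //; exact: measurable_indic.
Qed.

Lemma measurable_rnd : measurable_fun [set: R] rnd.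
Proof. exact: (measurable_finite_fun decode measurable_code). Qed.

End rounding.

Lemma rnd_cvg {R : realType} (x : R) : rnd m x @[m --> \oo] --> x.
Proof.
apply/cvgrPdist_le => e e0; near=> m.
have h1 : `|x| < m.+1%:R.
  apply: lt_trans (truncnS_gt _) _; rewrite ltr_nat ltnS.
  by near: m; exact: nbhs_infty_gt.
rewrite distrC; apply: le_trans (rnd_approx h1) _.
rewrite -[leRHS]invrK lef_pV2 ?posrE ?invr_gt0 //.
apply: ltW; apply: lt_trans (truncnS_gt _) _; rewrite ltr_nat ltnS.
by near: m; exact: nbhs_infty_gt.
Unshelve. all: by end_near. Qed.

Section finite_integral.
Context {disp : measure_display} {T : measurableType disp} {R : realType}.
Variable mu : {measure set T -> \bar R}.

Lemma integral_finite_fun {F : finType} (c : T -> F) (f : F -> R) (g : T -> R) :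
  (forall t, measurable [set y | c y = t]) -> measurable_fun setT g ->
  (forall t, 0 <= f t) -> (forall x, 0 <= g x) ->
  (\int[mu]_x (f (c x) * g x)%:E
    = \sum_t (f t)%:E * \int[mu]_(x in [set y | c y = t]) (g x)%:E)%E.
Proof.
move=> mc mg f0 g0.
under eq_integral => x _ do rewrite (finite_fun_indic c f) mulr_suml.
have mI t : measurable_fun setT (fun x => \1_[set y | c y = t] x * g x).
  by apply: measurable_funM => //; exact: measurable_indic.
have I0 t x : 0 <= \1_[set y | c y = t] x * g x by rewrite mulr_ge0.
rewrite ge0_integral_bigsum; last 2 first.
- move=> t; under eq_fun do rewrite -mulrA.
  exact: measurable_funM.
- by move=> t x; rewrite -mulrA mulr_ge0.
apply: eq_bigr => t _.
under eq_integral do rewrite -mulrA.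
rewrite ge0_integral_scale //; congr (_ * _)%E.
rewrite [RHS]integral_mkcond; apply: eq_integral => x _.
by rewrite patchE indicE; case: ifP; rewrite ?mul1r ?mul0r.
Qed.

End finite_integral.

Section gaussian_concentration.
Context {disp : measure_display} {T : measurableType disp} {R : realType}.
Variable P : probability T R.
Variables (I : finType) (xi : I -> T -> R) (s c : I -> R).
Hypothesis s_gt0 : forall p, 0 < s p.
Hypothesis c_ge0 : forall p, 0 <= c p.
Hypothesis mxi : forall p, measurable_fun setT (xi p).
Hypothesis xi_law : forall p (A : set R), measurable A ->
  P (xi p @^-1` A) = normal_prob 0 (Num.sqrt (s p)) A.
Hypothesis xi_indep : mutually_independent P xi.

Variable G : (I -> R) -> R.
Hypothesis G_lip : forall p x y, (forall q, q != p -> x q = y q) ->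
  `|G x - G y| <= c p * `|x p - y p|.

Section rounded.
Variable m : nat.
Local Notation code := (@code R m).
Local Notation decode := (@decode R m).
Local Notation F := ((bool * 'I_(m.+1 * m.+1).+1)%type).

Let mu p (t : F) : R := fine (P [set w | code (xi p w) = t]).

Let codes (w : T) : {ffun I -> F} := [ffun p => code (xi p w)].

Let measurable_code_xi p t : measurable [set w | code (xi p w) = t].
Proof.
have := mxi p; move=> /(_ measurableT _ (measurable_code t)).
by rewrite setTI.
Qed.

Let muE p t : (mu p t)%:E = P [set w | code (xi p w) = t].
Proof. by rewrite fineK // fin_num_measure. Qed.

Let mu_ge0 p t : 0 <= mu p t.
Proof. exact: fine_ge0. Qed.

Let mu_sum1 p : \sum_t mu p t = 1.
Proof.
apply: EFin_inj; rewrite -sumEFin.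
have := @integral_finite_fun _ _ R P _ (fun w => code (xi p w)) (fun=> 1) (fun=> 1)
  (measurable_code_xi p) (measurable_cst _) (fun=> ler01) (fun=> ler01).
rewrite mulr1 integral_cst_prob => ->; apply: eq_bigr => t _.
rewrite mul1e muE integral_cst ?mul1e //.
Qed.

Let codesE w (v : {ffun I -> F}) :
  codes w = v <-> forall p, code (xi p w) = v p.
Proof.
split=> [<- p|h]; first by rewrite ffunE.
by apply/ffunP => p; rewrite ffunE.
Qed.

Let codes_law (v : {ffun I -> F}) :
  P [set w | codes w = v] = (\prod_p mu p (v p))%:E.
Proof.
have -> : [set w | codes w = v] = [set w | forall p, [set x | code x = v p] (xi p w)].
  by apply/seteqP; split => w /= /codesE.
have E := xi_indep (A := fun p => [set x | code x = v p]) (fun p => measurable_code (v p)).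
by rewrite E -prodEFin; apply: eq_bigr => p _; rewrite muE.
Qed.

Let measurable_codes v : measurable [set w | codes w = v].
Proof.
have -> : [set w | codes w = v] = \bigcap_(p in setT) [set w | code (xi p w) = v p].
  by apply/seteqP; split => w /=; [move=> /codesE h p _|move=> h; apply/codesE => p; exact: h].
by apply: fin_bigcap_measurable => // p _; exact: measurable_code_xi.
Qed.

(** Since the rounding is odd and decreases absolute values, each factor is at most the exact
    Gaussian moment exp(c^2 s / 2), with no error term in m. *)
Let two_exp_le p : two_exp mu decode p (c p) <= expR (c p ^+ 2 * s p).
Proof.
have sp : Num.sqrt (s p) != 0 by rewrite gt_eqF // sqrtr_gt0.
have one a : \sum_t mu p t * expR (a * decode t) <= expR (a ^+ 2 * s p / 2).
  have mf : measurable_fun [set: R] (normal_pdf 0 (Num.sqrt (s p))).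
    exact: measurable_normal_pdf.
  have := integral_expR_odd_normal_pdf sp a (@measurable_rnd R m)
    (@rndN R m) (@norm_rnd_le R m).
  have := @integral_finite_fun _ _ R (@lebesgue_measure R) _ code
    (fun t => expR (a * decode t)) _ (@measurable_code R m) mf (fun=> expR_ge0 _)
    (fun x => normal_pdf_ge0 _ _ x).
  rewrite /rnd => -> ; rewrite sqr_sqrtr ?(ltW (s_gt0 p)) // => h.
  rewrite -lee_fin; apply: le_trans h; rewrite -sumEFin; apply: lee_sum => t _.
  by rewrite mulrC EFinM muE (xi_law _ (measurable_code t)).
rewrite /two_exp.
have -> : expR (c p ^+ 2 * s p) = expR (c p ^+ 2 * s p / 2) * expR ((- c p) ^+ 2 * s p / 2).
  by rewrite -expRD sqrrN; congr expR; field.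
apply: ler_pM => //; apply: sumr_ge0 => t _; rewrite mulr_ge0 ?expR_ge0 //.
Qed.

Let u (v : {ffun I -> F}) : R := expR (G (fun p => decode (v p))).

Let trunc_exp_pmean (M : R) (f : {ffun I -> F} -> R) (U : T -> R) :
  0 < M -> (forall w, expR (U w) = f (codes w)) -> (forall v, 0 <= f v) ->
  trunc_exp P M U <= pmean mu f.
Proof.
move=> M0 UE f0.
have mU : measurable_fun setT (fun w => expR (U w)).
  under eq_fun do rewrite UE.
  exact: measurable_finite_fun.
have : (\int[P]_w (Num.min M (expR (U w)))%:E <= (pmean mu f)%:E)%E.
  apply: (@le_trans _ _ (\int[P]_w (expR (U w))%:E)%E).
    apply: ge0_integral_le => //.
    - exact: measurable_minr.
    - by move=> w; rewrite min_expR_ge0 // ltW.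
    - by move=> w; rewrite ge_min lexx orbT.
  have := @integral_finite_fun _ _ R P _ codes f (fun=> 1)
    measurable_codes (measurable_cst _) f0 (fun=> ler01).
  under eq_integral do rewrite mulr1 -UE.
  move=> ->; rewrite /pmean -sumEFin; apply: lee_sum => v _.
  have -> : (\int[P]_(x in [set y | codes y = v]) 1%:E = (\prod_p mu p (v p))%:E)%E.
    by rewrite integral_cst // mul1e; exact: codes_law.
  by rewrite -EFinM mulrC.
move=> h; rewrite -lee_fin fineK // ge0_fin_numE; last first.
  by apply: integral_ge0 => w _; rewrite lee_fin min_expR_ge0 // ltW.
by apply: le_lt_trans h _; rewrite ltry.
Qed.

Lemma rounded_exp_product :
  exp_product_le P (expR (\sum_p c p ^+ 2 * s p)) (fun w => G (fun p => rnd m (xi p w))).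
Proof.
move=> M M0.
have u0 v : 0 < u v by exact: expR_gt0.
have uE w : expR (G (fun p => rnd m (xi p w))) = u (codes w).
  by congr (expR (G _)); apply/funext => p; rewrite ffunE.
have h1 := @trunc_exp_pmean M u _ M0 uE (fun v => ltW (u0 v)).
have h2 := @trunc_exp_pmean M (fun v => (u v)^-1) (fun w => - G (fun p => rnd m (xi p w))) M0.
have uV v : 0 <= (u v)^-1 by rewrite invr_ge0 ltW.
have {}h2 := h2 (fun w => etrans (expRN _) (congr1 _ (uE w))) uV.
apply: (@le_trans _ _ (pmean mu u * pmean mu (fun v => (u v)^-1))).
  by apply: ler_pM => //; exact/trunc_exp_ge0/ltW.
apply: le_trans (pmean_mulV (x := decode) mu_ge0 mu_sum1 c_ge0 u0 _) _.
  move=> p v v' vv'; rewrite /u -expRD ler_expR -lerBlDl.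
  apply: le_trans (ler_norm _) _; apply: (G_lip (p := p)) => q qp.
  by rewrite vv'.
rewrite expR_sum; apply: ler_prod => p _; rewrite two_exp_le andbT.
exact: two_exp_ge0.
Qed.

Lemma measurable_rounded : measurable_fun setT (fun w => G (fun p => rnd m (xi p w))).
Proof.
have -> : (fun w => G (fun p => rnd m (xi p w)))
    = (fun w => (fun v : {ffun I -> F} => G (fun p => decode (v p))) (codes w)).
  by apply/funext => w; congr (G _); apply/funext => p; rewrite ffunE.
exact: (measurable_finite_fun (fun v : {ffun I -> F} => G (fun p => decode (v p)))
  measurable_codes).
Qed.

End rounded.

Lemma G_lip_sum x y : `|G x - G y| <= \sum_p c p * `|x p - y p|.
Proof.
(* The coordinates are switched from y to x one at a time. *)
pose z (l : seq I) : I -> R := fun p => if p \in l then x p else y p.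
have step l : uniq l -> `|G (z l) - G y| <= \sum_(p <- l) c p * `|x p - y p|.
  elim: l => [|p l IH]; first by rewrite subrr normr0 big_nil.
  rewrite /= => /andP[pl ul]; rewrite big_cons.
  rewrite (_ : _ - _ = (G (z (p :: l)) - G (z l)) + (G (z l) - G y)); last by ring.
  apply: le_trans (ler_normD _ _) _; apply: lerD; last exact: IH.
  have := @G_lip p (z (p :: l)) (z l); rewrite /z mem_head (negPf pl); apply.
  by move=> q qp; rewrite inE (negPf qp).
have := step _ (enum_uniq I); rewrite big_enum.
by have -> : z (enum I) = x by apply/funext => p; rewrite /z mem_enum.
Qed.

Lemma gaussian_exp_product : measurable_fun setT (fun w => G (fun p => xi p w)) ->
  exp_product_le P (expR (\sum_p c p ^+ 2 * s p)) (fun w => G (fun p => xi p w)).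
Proof.
move=> mG; apply: exp_product_le_closed => // e e0 _.
pose Z m w := \sum_p c p * `|xi p w - rnd m (xi p w)|.
have mr m p : measurable_fun setT (fun w => rnd m (xi p w)).
  exact: (measurableT_comp (measurable_rnd m)).
have mZ m : measurable_fun setT (Z m).
  apply: measurable_sum => p; apply: measurable_funM => //.
  by apply: measurableT_comp => //; exact: measurable_funB.
have cZ w : Z m w @[m --> \oo] --> 0.
  rewrite (_ : 0 = \sum_p c p * `|xi p w - xi p w|); last first.
    by rewrite big1 // => p _; rewrite subrr normr0 mulr0.
  apply: cvg_big => [|p _]; first exact: add_continuous.
  apply: cvgM; first exact: cvg_cst.
  by apply: cvg_norm; apply: cvgB; [exact: cvg_cst|exact: rnd_cvg].
have [m0 /(_ m0 (leqnn _)) Pm] := probability_gt_ae_cvg0 mZ (aeW P cZ) e0.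
exists (fun w => G (fun p => xi p w)), (fun w => G (fun p => rnd m0 (xi p w))).
split=> //; first exact: measurable_rounded.
- by move=> M M0; apply: le_trans (rounded_exp_product m0 M0) _; rewrite lerDl ltW.
- apply: le_trans Pm; apply: le_measure; rewrite ?inE.
  + apply: measurable_gt; apply: measurableT_comp => //; apply: measurable_funB => //.
    exact: measurable_rounded.
  + exact: measurable_gt.
  + by move=> w /= ew; apply: lt_le_trans ew _; exact: G_lip_sum.
Qed.

End gaussian_concentration.

(** * Step functions and the driven Euler scheme *)

Section grid.
Context {R : realType}.

Lemma grid_exists (pts : seq R) : exists (u : nat -> R) (J : nat),
  {homo u : j k / (j < k)%N >-> j < k} /\
  forall x, x \in pts -> exists2 j, (j <= J)%N & x = u j.
Proof.
pose srt := sort <=%R (undup pts).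
have ss : sorted <%R srt.
  by rewrite lt_sorted_uniq_le sort_uniq undup_uniq sort_sorted //; exact: le_total.
(* Past the last point the grid continues with unit steps, because [two_sided_BM] speaks of strictly
   increasing sequences on all of nat. With no points it is 0, 1, 2 and so on. *)
pose u j : R := if (j < size srt)%N then nth 0 srt j else last 0 srt + (j - (size srt).-1)%:R.
exists u, (size srt); split; last first.
  move=> x xp; exists (index x srt); first exact: index_size.
  have xs : x \in srt by rewrite mem_sort mem_undup.
  by rewrite /u index_mem xs nth_index.
apply: homo_ltn => [x y z|j]; first exact: lt_trans.
rewrite /u; have [js|js] := ltnP j.+1 (size srt).
  by rewrite (ltnW js) (sorted_ltn_nth lt_trans) // inE // ltnW.
case: ltnP => js'.
  have jE : j.+1 = size srt by apply/eqP; rewrite eqn_leq js' js.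
  by rewrite -nth_last -jE /= ltrDl ltr0n subSnn.
rewrite ltrD2l ltr_nat subSn ?ltnS //.
by apply: leq_trans (leq_pred _) _.
Qed.

Variable u : nat -> R.
Hypothesis u_incr : {homo u : j k / (j < k)%N >-> j < k}.
Variable J : nat.

Lemma grid_ltE j k : (u j < u k) = (j < k)%N.
Proof. exact: (leW_mono (le_mono u_incr)). Qed.

Lemma grid_leE j k : (u j <= u k) = (j <= k)%N.
Proof. exact: (le_mono u_incr). Qed.

Definition on_grid (g : seq (R * R * R)) : Prop :=
  forall p, p \in g -> exists i j, [/\ (i <= j)%N, (j <= J)%N, p.1.2 = u i & p.2 = u j].

(** Both the steps and the cells are open on the left and closed on the right, so a cell is
    represented by its right end. *)
Lemma step_fun_cell g k s : on_grid g -> u k < s -> s <= u k.+1 ->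
  step_fun g s = step_fun g (u k.+1).
Proof.
move=> gG ks sk; apply: eq_big_seq => p /gG [i [j [_ _ -> ->]]].
rewrite grid_ltE grid_leE ltnS; congr (if _ then _ else _); congr (_ && _).
  have [ik|ki] := leqP i k; first by rewrite (le_lt_trans _ ks) // grid_leE.
  by apply/negbTE; rewrite -leNgt (le_trans sk) // grid_leE.
have [kj|jk] := ltnP k j; first by rewrite (le_trans sk) // grid_leE.
by apply/negbTE; rewrite -ltNge (le_lt_trans _ ks) // grid_leE.
Qed.

Lemma step_integral_cells {Omega : Type} (Z : R -> Omega -> R) g w : on_grid g ->
  step_integral Z g w = \sum_(k < J) step_fun g (u k.+1) * (Z (u k.+1) w - Z (u k) w).
Proof.
move=> gG; rewrite /step_integral /step_fun.
under [RHS]eq_bigr do rewrite mulr_suml.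
rewrite exchange_big; apply: eq_big_seq => p /gG [i [j [ij jJ -> ->]]] /=.
pose F k := (if (u i < u k.+1) && (u k.+1 <= u j) then p.1.1 else 0)
  * (Z (u k.+1) w - Z (u k) w).
rewrite -(big_mkord xpredT F) (big_cat_nat (n := i)) ?(leq_trans ij) //=.
rewrite (big_cat_nat (m := i) (n := j)) //=.
have -> : \sum_(0 <= k < i) F k = 0.
  rewrite big_nat big1 // => k /andP[_ ki].
  by rewrite /F grid_ltE ltnS leqNgt ki mul0r.
have -> : \sum_(j <= k < J) F k = 0.
  rewrite big_nat big1 // => k /andP[jk _].
  by rewrite /F grid_leE [(k < j)%N]ltnNge jk andbF mul0r.
rewrite add0r addr0 (eq_big_nat _ _ (F2 := fun k => p.1.1 * (Z (u k.+1) w - Z (u k) w))).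
  by rewrite -mulr_sumr (telescope_sumr (fun k => Z (u k) w)).
by move=> k /andP[ik kj]; rewrite /F grid_ltE grid_leE ltnS ik kj.
Qed.

Lemma sum_cells_le_integral (f : R -> R) (c : nat -> R) : measurable_fun [set: R] f ->
  (forall s, 0 <= f s) -> (forall k, 0 <= c k) ->
  (forall k s, u k < s -> s <= u k.+1 -> c k <= f s) ->
  ((\sum_(k < J) c k * (u k.+1 - u k))%:E <= \int[@lebesgue_measure R]_s (f s)%:E)%E.
Proof.
move=> mf f0 c0 cf.
pose I k (s : R) : R := if s \in `]u k, u k.+1] then 1 else 0.
have mI k : measurable_fun [set: R] (I k) by exact: (measurable_if_itv _ (f := cst 1)).
have I0 k s : 0 <= I k s by rewrite /I; case: ifP.
have -> : (\sum_(k < J) c k * (u k.+1 - u k))%:E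
    = (\int[@lebesgue_measure R]_s (\sum_(k < J) c k * I k s)%:E)%E.
  rewrite ge0_integral_bigsum; last 2 first.
  - by move=> k; apply: measurable_funM => //; exact: mI.
  - by move=> k s; exact: mulr_ge0.
  rewrite -sumEFin; apply: eq_bigr => k _; rewrite ge0_integral_scale //; last exact: mI.
  rewrite EFinM; congr (_ * _)%E; rewrite integral_one_itv lebesgue_measure_itv /=.
  by rewrite lte_fin u_incr.
apply: ge0_integral_le => //.
- by apply: measurable_sum => k; apply: measurable_funM => //; exact: mI.
- by move=> s; apply: sumr_ge0 => k _; exact: mulr_ge0.
- move=> s; have [[k ks]|no] := pselect (exists k : 'I_J, s \in `]u k, u k.+1]).
    rewrite (bigD1 k) //= big1 ?addr0.
      by rewrite /I ks mulr1; move: ks; rewrite in_itv /= => /andP[]; exact: cf.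
    move=> l lk; rewrite /I ifF ?mulr0 //; apply: contraNF lk => ls.
    move: ks ls; rewrite !in_itv /= => /andP[k1 k2] /andP[l1 l2].
    have h1 := lt_le_trans k1 l2; have h2 := lt_le_trans l1 k2.
    rewrite grid_ltE ltnS in h1; rewrite grid_ltE ltnS in h2.
    by apply/eqP/val_inj/eqP; rewrite eqn_leq h1 h2.
  rewrite big1 // => k _; rewrite /I ifF ?mulr0 //; apply/negP => ks.
  by apply: no; exists k.
Qed.

End grid.

Section euler_scheme.
Context {R : realType} {d : nat}.
Variables (alpha L h : R) (b : 'cV[R]_d -> 'cV[R]_d) (sigma : 'M[R]_d).
Hypotheses (alpha_gt0 : 0 < alpha) (L_ge0 : 0 <= L) (h_ge0 : 0 <= h) (h_le1 : h <= 1).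
Hypotheses (h_alpha : h * alpha <= 1) (h_L : h * L ^+ 2 <= alpha).
Hypothesis (hb : drift_assumption alpha L b).
Implicit Types z : nat -> 'cV[R]_d.

Local Notation g := (1 - alpha * h / 2).

Let g_ge0 : 0 <= g. Proof. exact: contraction_ge0. Qed.

Let g_le1 : g <= 1.
Proof. by rewrite gerBl divr_ge0 // mulr_ge0 // ltW. Qed.

(** The noise acts only through its increments, so a part of it that is constant in time, such as
    the term (- s)_+^(H - 1/2) of the kernel, has no effect. *)
Fixpoint euler z (l : nat) : 'cV[R]_d :=
  if l is l'.+1 then
    euler z l' + h *: b (euler z l') + sigma *m (z l'.+1 - z l')
  else 0.

(** The total weight of the discounted memory is bounded uniformly in the mesh, since alpha / 2
    times the sum telescopes to 1 - g^N. *)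
Lemma sum_geometric_le N : \sum_(i < N) h * g ^+ i <= 2 / alpha.
Proof.
have E : (alpha / 2) * \sum_(i < N) h * g ^+ i = 1 - g ^+ N.
  rewrite mulr_sumr; elim: N => [|N IH]; first by rewrite big_ord0 expr0 subrr.
  by rewrite big_ord_recr /= IH exprS; field.
have a2 : 0 < alpha / 2 by rewrite divr_gt0.
rewrite -(ler_pM2l a2) E (_ : alpha / 2 * (2 / alpha) = 1); last by field; rewrite gt_eqF.
by rewrite gerBl exprn_ge0.
Qed.

Lemma sum_reflect_le (f : nat -> R) l : (forall m, 0 <= f m) ->
  \sum_(i < l) g ^+ i * f (l - i.+1)%N <= \sum_(m < l) f m.
Proof.
move=> f0; rewrite [leRHS](reindex_inj rev_ord_inj) /=.
apply: ler_sum => i _; rewrite ler_piMl // exprn_ile1 //.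
Qed.

(* A noise difference v is absorbed by the comparison up to a bounded factor. *)
Lemma euler_difference z z' (v : nat -> 'cV[R]_d) (q : nat -> R) :
  (forall m, enorm (v m) <= q m) ->
  (forall m, enorm (sigma *m (z' m.+1 - z' m) - sigma *m (z m.+1 - z m) - (v m.+1 - v m))
     <= h * q m) ->
  forall l, enorm (euler z' l - euler z l) <= q l + g ^+ l * q 0%N
    + (L + 1) * \sum_(i < l) h * g ^+ i * q (l - i.+1)%N.
Proof.
move=> vq dq l.
have := euler_comparison L_ge0 h_ge0 h_alpha h_L hb
  (y := euler z) (y' := euler z')
  (xi := fun m => sigma *m (z m.+1 - z m)) (xi' := fun m => sigma *m (z' m.+1 - z' m))
  v (fun=> erefl) (fun=> erefl) l.
rewrite /= subrr sub0r enormN => H.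
have -> : euler z' l - euler z l = (euler z' l - euler z l - v l) + v l by rewrite subrK.
apply: le_trans (ler_enormD _ _) _; rewrite [leLHS]addrC -[leRHS]addrA; apply: lerD => //.
apply: le_trans H _; apply: lerD; first by rewrite ler_wpM2l ?exprn_ge0.
rewrite mulr_sumr; apply: ler_sum => i _.
rewrite (_ : (L + 1) * _ = g ^+ i * (h * L * q (l - i.+1)%N + h * q (l - i.+1)%N)); last by ring.
by rewrite ler_wpM2l ?exprn_ge0 // lerD // ler_wpM2l ?mulr_ge0.
Qed.

(** Taking the whole noise difference for v leaves no residual increment. The bound grows with the
    number of steps and serves only for errors sent to 0 at a fixed mesh. *)
Lemma euler_noise_lip z z' l : enorm (euler z' l - euler z l)
  <= opnorm sigma * (L + 3) * \sum_(m < l.+1) enorm (z' m - z m).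
Proof.
pose q m := opnorm sigma * enorm (z' m - z m).
have q0 m : 0 <= q m by rewrite mulr_ge0 ?opnorm_ge0 ?enorm_ge0.
have := @euler_difference z z' (fun m => sigma *m (z' m - z m)) q _ _ l.
move=> /(_ (fun m => enorm_mulmx _ _)) H; apply: le_trans (H _) _.
  move=> m; rewrite -!mulmxBr.
  have -> : z' m.+1 - z' m - (z m.+1 - z m) - (z' m.+1 - z m.+1 - (z' m - z m)) = 0.
    by apply/matrixP => i j; rewrite !mxE; ring.
  by rewrite mulmx0 enorm0 mulr_ge0.
have -> : opnorm sigma * (L + 3) * \sum_(m < l.+1) enorm (z' m - z m)
    = (L + 3) * \sum_(m < l.+1) q m.
  by rewrite -mulr_sumr; ring.
have S1 : \sum_(i < l) h * g ^+ i * q (l - i.+1)%N <= \sum_(m < l.+1) q m.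
  apply: le_trans (_ : \sum_(i < l) g ^+ i * q (l - i.+1)%N <= _).
    apply: ler_sum => i _; rewrite -mulrA ler_piMl // mulr_ge0 ?exprn_ge0 //.
  by rewrite big_ord_recr /=; apply: ler_wpDr => //; exact: sum_reflect_le.
have S2 : q l <= \sum_(m < l.+1) q m by rewrite big_ord_recr lerDr sumr_ge0.
have S3 : g ^+ l * q 0%N <= \sum_(m < l.+1) q m.
  rewrite big_ord_recl; apply: ler_wpDr; first exact: sumr_ge0.
  by rewrite ler_piMl // exprn_ile1.
have : (L + 1) * (\sum_(i < l) h * g ^+ i * q (l - i.+1)%N)
    <= (L + 1) * \sum_(m < l.+1) q m by rewrite ler_wpM2l // addr_ge0.
lra.
Qed.

Variables (p cH : R).
Hypotheses (p_lo : - 2^-1 < p) (p_hi : p < 2^-1) (cH_ge0 : 0 <= cH).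

Definition kernel_noise (s : R) (eps : nat -> R) (m : nat) : R :=
  cH * noise_ker p (m%:R * h - s) + `|eps m|.

Definition euler_response (s : R) (eps : nat -> R) (l : nat) : R :=
  kernel_noise s eps l + g ^+ l * kernel_noise s eps 0
  + (L + 1) * \sum_(i < l) h * g ^+ i * kernel_noise s eps (l - i.+1)%N.

(** Response of the scheme when one increment of W is moved by delta in direction e. The absorbed
    part v consists of [loc_ker], whose increments need not be of order h, and of the error eps; the
    residual is then the increment of [ramp]. *)
Lemma euler_kernel_perturbation z z' (e : 'cV[R]_d) (delta s : R) (a eps : nat -> R) :
  enorm e <= 1 ->
  (forall m, z' m - z m = (delta * a m) *: e) ->
  (forall m, a m = cH * (pos_powR (m%:R * h - s) p - pos_powR (- s) p) + eps m) ->
  forall l, enorm (euler z' l - euler z l)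
    <= `|delta| * opnorm sigma * euler_response s eps l.
Proof.
move=> e1 zz' aE l; rewrite /euler_response; set q := kernel_noise s eps.
pose Q m := `|delta| * opnorm sigma * q m.
have op0 : 0 <= opnorm sigma by exact: opnorm_ge0.
have se : enorm (sigma *m e) <= opnorm sigma.
  by apply: le_trans (enorm_mulmx _ _) _; rewrite ler_piMr.
have sc (x : R) : enorm (x *: (sigma *m e)) <= `|x| * opnorm sigma.
  by rewrite enormZ ler_wpM2l.
pose lk m := cH * loc_ker p (m%:R * h - s) + eps m.
have := @euler_difference z z' (fun m => (delta * lk m) *: (sigma *m e)) Q _ _ l.
move=> H; apply: le_trans (H _ _) _.
- move=> m; apply: le_trans (sc _) _; rewrite /Q normrM mulrAC ler_wpM2l ?mulr_ge0 //.
  apply: le_trans (ler_normD _ _) _; rewrite lerD2r normrM ger0_norm //.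
  by rewrite ler_wpM2l // loc_ker_le.
- move=> m; rewrite -mulmxBr -scalerBl.
  have -> : z' m.+1 - z' m - (z m.+1 - z m) = (delta * (a m.+1 - a m)) *: e.
    rewrite mulrBr scalerBl -!zz'; apply/matrixP => i j; rewrite !mxE; ring.
  rewrite -scalemxAr -scalerBl.
  have -> : delta * (a m.+1 - a m) - (delta * lk m.+1 - delta * lk m)
      = delta * (cH * (ramp p (m%:R * h - s + h) - ramp p (m%:R * h - s))).
    have E : m.+1%:R * h - s = m%:R * h - s + h by rewrite -natr1; ring.
    by rewrite !aE /lk /loc_ker E; ring.
  apply: le_trans (sc _) _; rewrite !normrM (ger0_norm cH_ge0) /Q.
  have := ramp_increment p_lo p_hi (m%:R * h - s) (h := h).
  rewrite h_ge0 h_le1 => /(_ isT) hr.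
  have hq : h * noise_ker p (m%:R * h - s) * cH <= h * q m.
    by rewrite /q /kernel_noise -mulrA ler_wpM2l // mulrC lerDl.
  have hr' : cH * `|ramp p (m%:R * h - s + h) - ramp p (m%:R * h - s)| <= h * q m.
    by apply: le_trans hq; rewrite mulrC ler_wpM2r.
  have : `|delta| * opnorm sigma * (cH * `|ramp p (m%:R * h - s + h) - ramp p (m%:R * h - s)|)
      <= `|delta| * opnorm sigma * (h * q m) by rewrite ler_wpM2l // mulr_ge0.
  lra.
rewrite /Q le_eqVlt; apply/orP; left; apply/eqP.
rewrite [in RHS]mulrDr [in RHS]mulrDr; congr (_ + _ + _); first by ring.
rewrite mulrCA; congr (_ * _); rewrite mulr_sumr; apply: eq_bigr => i _; ring.
Qed.

Variables (n N0 q : nat) (D : R).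
Hypotheses (n_gt0 : (0 < n)%N) (qh : q%:R * h = D).
Hypothesis N0_large : n%:R * g ^+ (N0 * q) <= 1.

Let Ntot := ((N0 + n) * q)%N.

(* A pair (a, t) stands for the contribution a * ker_sum (s + t): the noise at
   the sampling time, the noise at time 0, and the discounted memory of the
   scheme after i + 1 steps. *)
Definition memory_shifts : seq (R * R) :=
  [:: (1, - (N0%:R * D)), (1, D) &
    [seq ((L + 1) * (h * g ^+ i), i.+1%:R * h - N0%:R * D) | i <- iota 0 Ntot]].

Lemma memory_shifts_ge0 w : w \in memory_shifts -> 0 <= w.1.
Proof.
rewrite !inE => /or3P[/eqP -> //|/eqP -> //|/mapP[i _ -> /=]].
by rewrite !mulr_ge0 ?exprn_ge0 // addr_ge0.
Qed.

Lemma sum_memory_shifts : \sum_(w <- memory_shifts) w.1 <= 2 + (L + 1) * (2 / alpha).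
Proof.
rewrite !big_cons big_map /= addrA lerD2l -mulr_sumr ler_wpM2l ?addr_ge0 //.
by have := sum_geometric_le Ntot; rewrite -(big_mkord xpredT (fun i => h * g ^+ i)) /index_iota subn0.
Qed.

(* The terms in eps account for an approximation error of the kernels. *)
Definition sensitivity (eps : nat -> R) (s : R) : R :=
  cH * \sum_(w <- memory_shifts) w.1 * ker_sum p n D (s + w.2)
  + n%:R * (L + 3) * \sum_(m < Ntot.+1) `|eps m|.

(** The memory sums are all extended to [Ntot] steps, whatever the sampling time, so that summing
    over k turns each lag into a translate of [ker_sum]. *)
Lemma sum_euler_kernel_le (eps : nat -> R) (s : R) :
  \sum_(k < n) euler_response s eps ((N0 + k.+1) * q) <= sensitivity eps s.
Proof.
pose q' := kernel_noise s eps; pose lk (k : nat) := ((N0 + k.+1) * q)%N.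
have lkN (k : 'I_n) : (lk k <= Ntot)%N by rewrite leq_mul2r leq_add2l ltn_ord orbT.
have kap0 u : 0 <= noise_ker p u by exact: noise_ker_ge0.
have e0 m : 0 <= `|eps m| by [].
set ES := \sum_(m < Ntot.+1) `|eps m|.
have ES0 : 0 <= ES by exact: sumr_ge0.
have eES m : (m <= Ntot)%N -> `|eps m| <= ES.
  move=> mN; rewrite /ES (bigD1 (Ordinal (mN : (m < Ntot.+1)%N))) //= lerDl.
  exact: sumr_ge0.
have lkh k : (lk k)%:R * h = k.+1%:R * D + N0%:R * D.
  by rewrite /lk natrM -mulrA qh natrD mulrDl addrC.
have L1 : 0 <= L + 1 by rewrite addr_ge0.
have one (k : 'I_n) : q' (lk k) + g ^+ lk k * q' 0%N
      + (L + 1) * \sum_(i < lk k) h * g ^+ i * q' (lk k - i.+1)%N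
    <= cH * (noise_ker p (k.+1%:R * D - (s - N0%:R * D))
         + g ^+ (N0 * q) * noise_ker p (- s)
         + \sum_(i <- iota 0 Ntot) (L + 1) * (h * g ^+ i)
             * noise_ker p (k.+1%:R * D - (s + (i.+1%:R * h - N0%:R * D))))
       + (L + 3) * ES.
  have A1 : q' (lk k) <= cH * noise_ker p (k.+1%:R * D - (s - N0%:R * D)) + ES.
    rewrite /q' /kernel_noise lkh; apply: lerD; last exact/eES.
    by rewrite (_ : _ + N0%:R * D - s = k.+1%:R * D - (s - N0%:R * D)) //; ring.
  have A2 : g ^+ lk k * q' 0%N <= cH * (g ^+ (N0 * q) * noise_ker p (- s)) + ES.
    rewrite /q' /kernel_noise mul0r sub0r mulrDr; apply: lerD.
      rewrite mulrCA ler_wpM2l // ler_wpM2r // ler_wiXn2l //.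
      by rewrite leq_mul2r leq_addr orbT.
    by apply: le_trans (eES 0%N isT); rewrite ler_piMl // exprn_ile1.
  have A3 : (L + 1) * \sum_(i < lk k) h * g ^+ i * q' (lk k - i.+1)%N
      <= cH * (\sum_(i <- iota 0 Ntot) (L + 1) * (h * g ^+ i)
             * noise_ker p (k.+1%:R * D - (s + (i.+1%:R * h - N0%:R * D))))
         + (L + 1) * ES.
    have E : (L + 1) * \sum_(i < lk k) h * g ^+ i * q' (lk k - i.+1)%N
       = cH * (\sum_(i < lk k) (L + 1) * (h * g ^+ i)
             * noise_ker p (k.+1%:R * D - (s + (i.+1%:R * h - N0%:R * D))))
         + (L + 1) * \sum_(i < lk k) h * g ^+ i * `|eps (lk k - i.+1)%N|.
      rewrite !mulr_sumr -big_split /=; apply: eq_bigr => i _.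
      rewrite /q' /kernel_noise (_ : (lk k - i.+1)%:R * h - s
        = k.+1%:R * D - (s + (i.+1%:R * h - N0%:R * D))); first by ring.
      by rewrite natrB ?ltn_ord // mulrBl lkh; ring.
    rewrite E; apply: lerD.
      rewrite ler_wpM2l //.
      pose f i := (L + 1) * (h * g ^+ i)
             * noise_ker p (k.+1%:R * D - (s + (i.+1%:R * h - N0%:R * D))).
      have f0 i : 0 <= f i by rewrite /f !mulr_ge0 ?exprn_ge0.
      have -> : iota 0 Ntot = index_iota 0 Ntot by rewrite /index_iota subn0.
      rewrite -[leLHS](big_mkord xpredT f).
      rewrite [leRHS](big_cat_nat (n := lk k)) //= lerDl.
      by apply: sumr_ge0 => i _; exact: f0.
    rewrite ler_wpM2l //.
    apply: le_trans (_ : \sum_(i < lk k) g ^+ i * `|eps (lk k - i.+1)%N| <= _).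
      by apply: ler_sum => i _; rewrite -mulrA ler_piMl // mulr_ge0 ?exprn_ge0.
    apply: le_trans (sum_reflect_le _ e0) _.
    rewrite /ES -!(big_mkord xpredT (fun m => `|eps m|)).
    by rewrite [leRHS](big_cat_nat (n := lk k)) ?(leq_trans (lkN k)) //= lerDl sumr_ge0.
  lra.
apply: le_trans (ler_sum _ (fun k _ => one k)) _.
rewrite big_split /= sumr_const card_ord -[_ *+ n]mulr_natl mulrA /sensitivity lerD2r.
rewrite -mulr_sumr ler_wpM2l // big_split big_split /= /memory_shifts !big_cons big_map /=.
rewrite !mul1r addrA; apply: lerD; last first.
  rewrite exchange_big /=; apply: ler_sum => i _.
  by rewrite /ker_sum mulr_sumr.
(* The n contributions of time 0 carry the weight n g^(N0 q) <= 1 and so cost a single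
   [noise_ker p (- s)], which is the first term of [ker_sum] at s + D. *)
apply: lerD => //; rewrite sumr_const card_ord -[_ *+ n]mulr_natl mulrA.
apply: (@le_trans _ _ (noise_ker p (- s))); first by rewrite ler_piMl.
rewrite /ker_sum (bigD1 (Ordinal n_gt0)) //= mul1r.
rewrite (_ : D - (s + D) = - s); last by ring.
by rewrite lerDl sumr_ge0.
Qed.

End euler_scheme.

(** * Square integral of the sensitivity *)

Lemma integral_sqr_sum_norm_le {disp : measure_display} {T : measurableType disp}
    {R : realType} (mu : {measure set T -> \bar R}) (I : finType) (f : I -> T -> R) (r : R) :
  (forall i, measurable_fun setT (f i)) ->
  (forall i, (\int[mu]_s (f i s ^+ 2)%:E <= r%:E)%E) ->
  (\int[mu]_s ((\sum_i `|f i s|) ^+ 2)%:E <= (#|I|%:R ^+ 2 * r)%:E)%E.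
Proof.
move=> mf fr.
have mf2 i : measurable_fun setT (fun s => f i s ^+ 2) by exact: measurable_funX.
have mS2 : measurable_fun setT (fun s => \sum_i f i s ^+ 2).
  by apply: measurable_sum => i; exact: mf2.
apply: (@le_trans _ _ (\int[mu]_s (#|I|%:R * \sum_i f i s ^+ 2)%:E)%E).
  apply: ge0_integral_le.
  - apply: measurable_funX; apply: measurable_sum => i.
    by apply: measurableT_comp => //; exact: mf.
  - exact: measurable_funM.
  - by move=> s; exact: sqr_ge0.
  - move=> s; have := @sqr_wsum_le R _ (index_enum I) (fun=> 1) (fun i => `|f i s|) (fun=> ler01).
    under eq_bigr do rewrite mul1r.
    move/le_trans; apply; rewrite sumr_const ler_wpM2l //.
    by apply: ler_sum => i _; rewrite mul1r real_normK ?num_real.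
rewrite ge0_integral_scale //; last by move=> s; apply: sumr_ge0 => i _; exact: sqr_ge0.
rewrite ge0_integral_bigsum; last 2 first.
- by move=> i; exact: mf2.
- by move=> i s; exact: sqr_ge0.
rewrite expr2 -mulrA EFinM lee_wpmul2l ?lee_fin //.
apply: (@le_trans _ _ (\sum_(i : I) r%:E)%E); first exact: lee_sum.
by rewrite sumEFin sumr_const mulr_natl.
Qed.

Section integral_sensitivity.
Context {R : realType}.
Local Notation leb := (@lebesgue_measure R).

(** Minkowski's inequality for weighted translates, from [sqr_wsum_le] and translation
    invariance. *)
Lemma integral_weighted_shifts (ws : seq (R * R)) (K : R -> R) :
  measurable_fun [set: R] K -> (forall w, w \in ws -> 0 <= w.1) ->
  (\int[leb]_s ((\sum_(w <- ws) w.1 * K (s + w.2)) ^+ 2)%:E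
    <= ((\sum_(w <- ws) w.1) ^+ 2)%:E * \int[leb]_s (K s ^+ 2)%:E)%E.
Proof.
move=> mK ws0.
have mKs a : measurable_fun [set: R] (fun s => K (s + a)).
  by apply: (measurableT_comp mK); exact: measurable_funD.
have mKs2 a : measurable_fun [set: R] (fun s => K (s + a) ^+ 2) by exact: measurable_funX.
(* The weights are known to be nonnegative only on ws, whereas the integration lemmas ask it of
   every index; absolute values provide this. *)
have E (f : R -> R) : \sum_(w <- ws) w.1 * f w.2 = \sum_(w <- ws) `|w.1| * f w.2.
  by apply: eq_big_seq => w /ws0 w0; rewrite ger0_norm.
have E1 : \sum_(w <- ws) w.1 = \sum_(w <- ws) `|w.1|.
  by apply: eq_big_seq => w /ws0 w0; rewrite ger0_norm.
pose A := \sum_(w <- ws) `|w.1|.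
have A0 : 0 <= A by exact: sumr_ge0.
have mS : measurable_fun [set: R] (fun s => \sum_(w <- ws) `|w.1| * K (s + w.2) ^+ 2).
  by apply: measurable_sum => w; apply: measurable_funM => //; exact: mKs2.
have S0 s : 0 <= \sum_(w <- ws) `|w.1| * K (s + w.2) ^+ 2.
  by apply: sumr_ge0 => w _; rewrite mulr_ge0 ?sqr_ge0.
apply: (@le_trans _ _ (\int[leb]_s (A * \sum_(w <- ws) `|w.1| * K (s + w.2) ^+ 2)%:E)%E).
  apply: ge0_integral_le.
  - apply: measurable_funX; apply: measurable_sum => w.
    by apply: measurable_funM => //; exact: mKs.
  - exact: measurable_funM.
  - by move=> s; exact: sqr_ge0.
  - by move=> s; rewrite (E (fun a => K (s + a))); exact: sqr_wsum_le.
rewrite ge0_integral_scale // ge0_integral_bigsum; last 2 first.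
- by move=> w; apply: measurable_funM => //; exact: mKs2.
- by move=> w s; rewrite mulr_ge0 ?sqr_ge0.
rewrite E1 -/A expr2 EFinM -muleA lee_wpmul2l ?lee_fin // le_eqVlt; apply/orP; left.
apply/eqP; have K0 : (0 <= \int[leb]_s (K s ^+ 2)%:E)%E.
  by apply: integral_ge0 => s _; rewrite lee_fin sqr_ge0.
transitivity (\sum_(w <- ws) (`|w.1|%:E * \int[leb]_s (K s ^+ 2)%:E))%E.
  apply: eq_bigr => w _; rewrite ge0_integral_scale //; last 2 first.
  - exact: mKs2.
  - by move=> s; exact: sqr_ge0.
  congr (_ * _)%E; apply: (@ge0_integral_shift R w.2 (fun s => (K s ^+ 2)%:E)).
  - by apply/measurable_EFinP; exact: measurable_funX.
  - by move=> s; rewrite lee_fin sqr_ge0.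
by rewrite /A -sumEFin ge0_sume_distrl // => w _; rewrite lee_fin.
Qed.

Variables (alpha L h p cH D : R) (n N0 q : nat).
Hypotheses (alpha_gt0 : 0 < alpha) (L_ge0 : 0 <= L) (h_ge0 : 0 <= h)
  (h_alpha : h * alpha <= 1) (cH_ge0 : 0 <= cH).

Let Ntot := ((N0 + n) * q)%N.

Definition memory_bound : R := 2 + (L + 1) * (2 / alpha).

Lemma measurable_sensitivity (eps : nat -> R -> R) :
  (forall m, measurable_fun [set: R] (eps m)) ->
  measurable_fun [set: R] (fun s => sensitivity alpha L h p cH n N0 q D (eps^~ s) s).
Proof.
move=> me; apply: measurable_funD; apply: measurable_funM => //.
  apply: measurable_sum => w; apply: measurable_funM => //.
  by apply: (measurableT_comp (measurable_ker_sum p n D)); exact: measurable_funD.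
by apply: measurable_sum => m; apply: measurableT_comp => //; exact: me.
Qed.

Lemma integral_sensitivity (eps : nat -> R -> R) (I r : R) :
  (forall m, measurable_fun [set: R] (eps m)) ->
  (\int[leb]_s (ker_sum p n D s ^+ 2)%:E <= I%:E)%E ->
  (forall m, (m < Ntot.+1)%N -> (\int[leb]_s (eps m s ^+ 2)%:E <= r%:E)%E) ->
  (\int[leb]_s (sensitivity alpha L h p cH n N0 q D (eps^~ s) s ^+ 2)%:E
    <= (2 * ((cH * memory_bound) ^+ 2 * I + (n%:R * (L + 3) * Ntot.+1%:R) ^+ 2 * r))%:E)%E.
Proof.
move=> me HI He.
set ws := memory_shifts alpha L h n N0 q D.
have ws0 w : w \in ws -> 0 <= w.1 by exact: memory_shifts_ge0.
have mK := measurable_ker_sum p n D.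
pose f1 s := \sum_(w <- ws) w.1 * ker_sum p n D (s + w.2).
pose f2 s := \sum_(m < Ntot.+1) `|eps m s|.
have mf1 : measurable_fun [set: R] f1.
  apply: measurable_sum => w; apply: measurable_funM => //.
  by apply: (measurableT_comp mK); exact: measurable_funD.
have mf2 : measurable_fun [set: R] f2.
  by apply: measurable_sum => m; apply: measurableT_comp => //; exact: me.
have mf12 : measurable_fun [set: R] (fun s => f1 s ^+ 2) by exact: measurable_funX.
have mf22 : measurable_fun [set: R] (fun s => f2 s ^+ 2) by exact: measurable_funX.
set c2 := n%:R * (L + 3).
have m1 : measurable_fun [set: R] (fun s => cH ^+ 2 * f1 s ^+ 2) by exact: measurable_funM.
have m2 : measurable_fun [set: R] (fun s => c2 ^+ 2 * f2 s ^+ 2) by exact: measurable_funM.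
have p1 s : 0 <= cH ^+ 2 * f1 s ^+ 2 by rewrite mulr_ge0 ?sqr_ge0.
have p2 s : 0 <= c2 ^+ 2 * f2 s ^+ 2 by rewrite mulr_ge0 ?sqr_ge0.
have I0 : 0 <= I.
  rewrite -lee_fin; apply: le_trans HI; apply: integral_ge0 => s _.
  by rewrite lee_fin sqr_ge0.
apply: (@le_trans _ _ (\int[leb]_s (2 * (cH ^+ 2 * f1 s ^+ 2 + c2 ^+ 2 * f2 s ^+ 2))%:E)%E).
  apply: ge0_integral_le.
  - by apply: measurable_funX; exact: measurable_sensitivity.
  - by apply: measurable_funM => //; exact: measurable_funD.
  - by move=> s; exact: sqr_ge0.
  - by move=> s; rewrite -!exprMn; exact: sqrD_le.
rewrite ge0_integral_scale //; last 2 first.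
- exact: measurable_funD.
- by move=> s; rewrite addr_ge0.
rewrite EFinM lee_wpmul2l // ge0_integral_add // EFinD; apply: leeD.
  rewrite ge0_integral_scale ?sqr_ge0 //; last by move=> s; exact: sqr_ge0.
  rewrite [leRHS](_ : _ = ((cH ^+ 2)%:E * (memory_bound ^+ 2 * I)%:E)%E); last first.
    by rewrite -EFinM; congr EFin; ring.
  rewrite lee_wpmul2l ?lee_fin ?sqr_ge0 //.
  apply: le_trans (integral_weighted_shifts mK ws0) _.
  rewrite [leRHS]EFinM; apply: lee_pmul => //.
  - by rewrite lee_fin sqr_ge0.
  - by apply: integral_ge0 => s _; rewrite lee_fin sqr_ge0.
  - rewrite lee_fin ler_pXn2r ?nnegrE //; first exact: sum_memory_shifts.
      by rewrite big_seq; apply: sumr_ge0 => w; exact: ws0.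
    by rewrite /memory_bound addr_ge0 // mulr_ge0 ?addr_ge0 // divr_ge0 // ltW.
rewrite ge0_integral_scale ?sqr_ge0 //; last by move=> s; exact: sqr_ge0.
rewrite [leRHS](_ : _ = ((c2 ^+ 2)%:E * (Ntot.+1%:R ^+ 2 * r)%:E)%E); last first.
  by rewrite -EFinM; congr EFin; ring.
rewrite lee_wpmul2l ?lee_fin ?sqr_ge0 //.
have := @integral_sqr_sum_norm_le _ _ R leb 'I_Ntot.+1 (fun m => eps m) r
  (fun m => me m) (fun m => He m (ltn_ord m)).
by rewrite card_ord.
Qed.

End integral_sensitivity.

(** * Approximation of the solution by the Euler scheme *)

Section modulus.
Context {R : realType}.

Lemma uniform_continuity_segment (f : R -> R) (T e : R) :
  {within `[0, T], continuous f} -> 0 < e ->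
  \forall delta \near 0^'+, forall s t : R, 0 <= s <= T -> 0 <= t <= T ->
    `|s - t| <= delta -> `|f s - f t| <= e.
Proof.
move=> cf e0.
have cA : compact `[0, T] by exact: segment_compact.
move/compact_near_coveringP : cA.
pose Q (delta s : R) := 0 <= s <= T -> forall t, 0 <= t <= T ->
  `|s - t| <= delta -> `|f s - f t| <= e.
move=> /(_ R (0^'+) Q _) H.
have : \forall delta \near 0^'+, `[0, T] `<=` Q delta.
  apply: H => x xT.
  have /subspace_continuousP := cf; move=> /(_ x xT) /cvgrPdist_le /(_ (e / 2)).
  rewrite divr_gt0 // => /(_ isT); rewrite near_withinE => /nbhs_ballP [r /= r0 hr].
  exists (ball x (r / 2), [set d : R | 0 < d < r / 2]); first split => /=.
  - by apply: nbhsx_ballx; rewrite divr_gt0.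
  - near=> d; apply/andP; split.
      by near: d; exact: nbhs_right_gt.
    by near: d; apply: nbhs_right_lt; rewrite divr_gt0.
  - move=> [s d] [/= xs /andP[d0 dr]] sT t tT st.
    have hs : `|f x - f s| <= e / 2.
      apply: hr; last by rewrite /= in_itv.
      by apply: lt_trans xs _; lra.
    have ht : `|f x - f t| <= e / 2.
      apply: hr; last by rewrite /= in_itv.
      rewrite /ball /= in xs *.
      rewrite (_ : x - t = (x - s) + (s - t)); last by ring.
      by apply: le_lt_trans (ler_normD _ _) _; lra.
    rewrite (_ : f s - f t = (f x - f t) - (f x - f s)); last by ring.
    by apply: le_trans (ler_normB _ _) _; lra.
apply: filterS => delta h s t sT tT.
by apply: h => //=; rewrite in_itv.
Unshelve. all: by end_near. Qed.

Lemma Rintegral_increment (f : R -> R) (a c k e : R) :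
  {within `[0, c], continuous f} -> 0 <= a -> a <= c ->
  (forall s, a <= s <= c -> `|f s - k| <= e) ->
  `|\int[lebesgue_measure]_(s in `[0, c]) f s
    - \int[lebesgue_measure]_(s in `[0, a]) f s - (c - a) * k| <= (c - a) * e.
Proof.
move=> cf a0 ac fk; have c0 := le_trans a0 ac.
have intf : lebesgue_measure.-integrable `[0, c] (EFin \o f).
  by apply: continuous_compact_integrable => //; exact: segment_compact.
rewrite Rintegral_itvB ?bnd_simp //.
have mE : measurable (`]a, c]%classic : set R) by exact: measurable_itv.
have sub : `]a, c]%classic `<=` `[0, c]%classic.
  by move=> s /=; rewrite !in_itv /= => /andP[a1 ->]; rewrite andbT (le_trans a0) // ltW.
have intf' : lebesgue_measure.-integrable `]a, c] (EFin \o f).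
  by apply: integrableS intf.
have fin : fine (lebesgue_measure (`]a, c]%classic : set R)) = c - a.
  rewrite lebesgue_measure_itv /= lte_fin; case: ltP => // ca.
  by rewrite (_ : a = c) ?subrr //; apply/eqP; rewrite eq_le ac ca.
have intk (r : R) : lebesgue_measure.-integrable `]a, c] (EFin \o (fun=> r)).
  apply: (@integrableS _ _ R lebesgue_measure `[0, c]) => //.
  apply: continuous_compact_integrable; first exact: segment_compact.
  by move=> ?; exact: cvg_cst.
rewrite mulrC -fin -Rintegral_cst // -RintegralB //.
apply: le_trans (le_normr_Rintegral _ _) _ => //.
  have -> : EFin \o (fun s => f s - k) = (fun s => ((f s)%:E - k%:E)%E).
    by apply/funext => s /=; rewrite EFinB.
  apply: (integrableB _ intf' (intk k)); exact: measurable_itv.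
rewrite mulrC -Rintegral_cst //; apply: le_Rintegral => //.
  have -> : EFin \o (fun s => `|f s - k|) = abse \o (fun s => ((f s)%:E - k%:E)%E).
    by apply/funext.
  by apply: integrable_abse; apply: (integrableB _ intf' (intk k)); exact: measurable_itv.
by move=> s /=; rewrite in_itv /= => /andP[a1 s1]; apply: fk; rewrite s1 ltW.
Qed.

End modulus.

Section euler_error.
Context {R : realType} {d : nat}.
Variables (alpha L : R) (b : 'cV[R]_d -> 'cV[R]_d) (sigma : 'M[R]_d).
Hypotheses (alpha_gt0 : 0 < alpha) (L_ge0 : 0 <= L).
Hypothesis (hb : drift_assumption alpha L b).
Hypothesis (cb : continuous b).
Variables (x B : R -> 'cV[R]_d).
Hypothesis cx : {within `[0, +oo[, continuous x}.
Hypothesis xE : forall t, 0 <= t -> x t = x 0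
  + \col_(i < d) (\int[lebesgue_measure]_(s in `[0, t]) b (x s) i 0) + sigma *m B t.

Lemma continuous_coord_within (f : R -> 'cV[R]_d) (A : set R) i :
  {within A, continuous f} -> {within A, continuous (fun t => f t i 0 : R)}.
Proof.
move=> cf t; apply: (@continuous_comp (subspace A) _ _ f (fun M : 'cV[R]_d => M i 0 : R)).
  exact: cf.
exact: coord_continuous.
Qed.

Lemma continuous_drift_within (A : set R) : {within A, continuous x} ->
  {within A, continuous (b \o x)}.
Proof. by move=> cA t; apply: (@continuous_comp (subspace A) _ _ x b); [exact: cA|exact: cb]. Qed.

(** The sampled solution is itself an Euler scheme with noise [xi'], which differs from [xi] by the
    local error of the drift integral, at most h d L e. The contraction sums these errors to 2 /
    alpha times d L e and damps the initial gap. *)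
Lemma euler_error_le (h T e : R) (l : nat) : 0 < h -> h * alpha <= 1 ->
  h * L ^+ 2 <= alpha -> 0 <= e ->
  (forall s t, 0 <= s <= T -> 0 <= t <= T -> `|s - t| <= h -> enorm (x s - x t) <= e) ->
  l%:R * h <= T ->
  enorm (x (l%:R * h) - euler h b sigma (fun m => B (m%:R * h)) l)
    <= (1 - alpha * h / 2) ^+ l * enorm (x 0) + 2 / alpha * (d%:R * L * e).
Proof.
move=> h0 ha hL e0 osc lT.
set y := euler h b sigma (fun m => B (m%:R * h)).
set g := 1 - alpha * h / 2.
have g0 : 0 <= g by exact: contraction_ge0.
pose t (m : nat) := m%:R * h : R.
have t0 m : 0 <= t m by rewrite mulr_ge0 // ltW.
have tS m : t m.+1 = t m + h by rewrite /t -natr1; ring.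
pose xi (m : nat) := sigma *m (B (t m.+1) - B (t m)).
pose xi' m := x (t m.+1) - x (t m) - h *: b (x (t m)).
have := euler_comparison L_ge0 (ltW h0) ha hL hb (y := y) (y' := x \o t) (xi := xi) (xi' := xi')
  (fun=> 0) (fun=> erefl) _ l.
have x'E m : (x \o t) m.+1 = (x \o t) m + h *: b ((x \o t) m) + xi' m.
  by rewrite /xi' /=; apply/matrixP => i j; rewrite !mxE; ring.
move=> /(_ x'E); rewrite {2}/comp {2}/t mul0r !subr0 => H.
apply: le_trans H _; rewrite -/g lerD2l.
have rho m : (m < l)%N -> enorm (xi' m - xi m) <= h * (d%:R * L * e).
  move=> ml.
  apply: le_trans (enorm_le_sum _) _.
  apply: (@le_trans _ _ (\sum_(i < d) h * (L * e))); last first.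
    by rewrite sumr_const card_ord -mulr_natl; lra.
  apply: ler_sum => i _.
  have mT : t m.+1 <= T by apply: le_trans lT; rewrite ler_pM2r // ler_nat.
  have -> : (xi' m - xi m) i 0
      = \int[lebesgue_measure]_(s in `[0, t m.+1]) b (x s) i 0
        - \int[lebesgue_measure]_(s in `[0, t m]) b (x s) i 0 - (t m.+1 - t m) * b (x (t m)) i 0.
    move: (xE (t0 m.+1)) (xE (t0 m)); rewrite /xi' /xi mulmxBr.
    move: (sigma *m B (t m.+1)) (sigma *m B (t m)) => S1 S2 E1 E2.
    have e1 : x (t m.+1) i 0 = x 0 i 0
        + \int[lebesgue_measure]_(s in `[0, t m.+1]) b (x s) i 0 + S1 i 0.
      by rewrite E1 !mxE.
    have e2 : x (t m) i 0 = x 0 i 0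
        + \int[lebesgue_measure]_(s in `[0, t m]) b (x s) i 0 + S2 i 0.
      by rewrite E2 !mxE.
    by rewrite !mxE e1 e2 tS; ring.
  have hE : t m.+1 - t m = h by rewrite tS; ring.
  rewrite -[X in _ <= X * _]hE.
  have tmS : t m <= t m.+1 by rewrite tS lerDl ltW.
  have := @Rintegral_increment R (fun s => b (x s) i 0) (t m) (t m.+1) (b (x (t m)) i 0) (L * e).
  apply => //.
    apply: continuous_coord_within; apply: continuous_drift_within.
    apply: continuous_subspaceW cx => s /=.
    by rewrite !in_itv /= andbT => /andP[].
  move=> s /andP[s1 s2].
  have := ler_coord_enorm (b (x s) - b (x (t m))) i; rewrite !mxE => /le_trans; apply.
  apply: le_trans (hb _ _).2 _; rewrite ler_wpM2l //.
  have s0 := le_trans (t0 m) s1.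
  apply: osc.
  - by rewrite s0 (le_trans s2).
  - by rewrite t0 (le_trans tmS).
  - by rewrite ger0_norm ?subr_ge0 // lerBlDl -tS.
have c0 : 0 <= d%:R * L * e by rewrite !mulr_ge0.
apply: (@le_trans _ _ (\sum_(i < l) h * g ^+ i * (d%:R * L * e))).
  apply: ler_sum => i _; rewrite enorm0 mulr0 add0r.
  rewrite [leRHS](_ : _ = g ^+ i * (h * (d%:R * L * e))); last by ring.
  apply: ler_wpM2l; [exact: exprn_ge0|rewrite subr0; apply: rho].
  by rewrite ltn_subrL /= (leq_ltn_trans _ (ltn_ord i)).
rewrite -mulr_suml ler_wpM2r //.
exact: sum_geometric_le.
Qed.

Lemma euler_converges (D T e : R) : 0 < D -> 0 < e ->
  \forall q \near \oo, forall (h : R) (l : nat), h = D / q.+1%:R -> l%:R * h <= T ->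
    enorm (x (l%:R * h) - euler h b sigma (fun m => B (m%:R * h)) l)
    <= (1 - alpha * h / 2) ^+ l * enorm (x 0) + e.
Proof.
move=> D0 e0.
pose K : R := 2 / alpha * (d%:R * L) + 1.
have K0 : 0 < K by rewrite /K ltr_wpDl // !mulr_ge0 // ltW // invr_gt0.
pose e1 := e / K / d.+1%:R.
have e10 : 0 < e1 by rewrite !divr_gt0.
have cT : {within `[0, T], continuous x}.
  by apply: continuous_subspaceW cx => s /=; rewrite !in_itv /= andbT => /andP[].
have near_i i := uniform_continuity_segment (continuous_coord_within (i := i) cT) e10.
have nearall : \forall delta \near 0^'+, forall (i : 'I_d) (s t : R),
    0 <= s <= T -> 0 <= t <= T -> `|s - t| <= delta -> `|x s i 0 - x t i 0| <= e1.
  by apply: filter_forall => i; exact: near_i.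
have near_h : \forall delta \near (0 : R)^'+,
    delta * alpha <= 1 /\ delta * L ^+ 2 <= alpha.
  have a1 : 0 < alpha^-1 by rewrite invr_gt0.
  have L1 : 0 < L ^+ 2 + 1 by rewrite ltr_wpDl ?sqr_ge0.
  have a2 : 0 < alpha / (L ^+ 2 + 1) by rewrite divr_gt0.
  near=> delta; have d0 : 0 < delta by near: delta; exact: nbhs_right_gt.
  have d1 : delta < alpha^-1 by near: delta; exact: nbhs_right_lt.
  have d2 : delta < alpha / (L ^+ 2 + 1) by near: delta; exact: nbhs_right_lt.
  split; first by rewrite -ler_pdivlMr // mul1r ltW.
  move/ltW: d2; rewrite ler_pdivlMr //; apply: le_trans.
  by rewrite ler_pM2l // lerDl.
have [r /= r0 hr] := filterI nearall near_h.
near=> q => h l hE lT.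
have h0 : 0 < h by rewrite hE divr_gt0.
have [|osc [ha hL]] := hr h _ h0.
  rewrite /= sub0r normrN gtr0_norm // hE ltr_pdivrMr // -ltr_pdivrMl // mulrC.
  apply: lt_trans (truncnS_gt _) _; rewrite ltr_nat ltnS.
  by near: q; exact: nbhs_infty_gt.
apply: le_trans (euler_error_le (e := d%:R * e1) h0 ha hL _ _ lT) _.
- by rewrite mulr_ge0 // ltW.
- move=> s t sT tT st; apply: le_trans (enorm_le_sum _) _.
  rewrite mulr_natl -[X in _ *+ X](card_ord d) -sumr_const.
  by apply: ler_sum => i _; rewrite !mxE; exact: osc.
rewrite lerD2l.
have dd : d%:R * e1 <= e / K.
  by rewrite /e1 mulrA ler_pdivrMr // [leLHS]mulrC ler_pM2l ?divr_gt0 // ler_nat.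
have K1 : 2 / alpha * (d%:R * L) <= K by rewrite /K lerDl.
rewrite [leLHS](_ : _ = 2 / alpha * (d%:R * L) * (d%:R * e1)); last by ring.
have -> : e = K * (e / K) by rewrite mulrC divfK // gt_eqF.
have A0 : 0 <= 2 / alpha * (d%:R * L) by rewrite !mulr_ge0 // invr_ge0 ltW.
have B0 : 0 <= d%:R * e1 by rewrite mulr_ge0 // ltW.
exact: (ler_pM A0 B0 K1 dd).
Unshelve. all: by end_near. Qed.

End euler_error.

Section measurable_euler.
Context {disp : measure_display} {T : measurableType disp} {R : realType} {d : nat}.
Variables (L h : R) (b : 'cV[R]_d -> 'cV[R]_d) (sigma : 'M[R]_d).
Hypothesis L_ge0 : 0 <= L.
Hypothesis b_lip : forall x y, enorm (b x - b y) <= L * enorm (x - y).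

(** A coordinate of b is a Lipschitz functional of a one-point sample. *)
Lemma measurable_drift (Y : T -> 'cV[R]_d) :
  (forall i, measurable_fun setT (fun w => Y w i 0)) ->
  forall i, measurable_fun setT (fun w => b (Y w) i 0).
Proof.
move=> mY i.
apply: (@measurable_lipschitz_comp _ _ R d 1 (fun x => b (x ord0) i 0) (fun _ w => Y w)) => //.
exists L; split=> // x y; rewrite /dist_sum big_ord1.
apply: le_trans (b_lip _ _).
by have := ler_coord_enorm (b (x ord0) - b (y ord0)) i; rewrite !mxE.
Qed.

Lemma measurable_euler (z : nat -> T -> 'cV[R]_d) :
  (forall l i, measurable_fun setT (fun w => z l w i 0)) ->
  forall l i, measurable_fun setT (fun w => euler h b sigma (fun m => z m w) l i 0).
Proof.
move=> mz; elim=> [|l IH] i /=.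
  by under eq_fun do rewrite mxE; exact: measurable_cst.
under eq_fun do rewrite mxE [X in X + _]mxE [X in _ + X + _]mxE [X in _ + X]mxE.
apply: measurable_funD.
  by apply: measurable_funD; [exact: IH|apply: measurable_funM => //; exact: measurable_drift].
apply: measurable_sum => j; apply: measurable_funM => //.
under eq_fun do rewrite !mxE.
by apply: measurable_funB.
Qed.

End measurable_euler.

(** * Shifted laws and approximation of Wiener integrals *)

Section stationarity.
Context {disp : measure_display} {Omega : measurableType disp} {R : realType} {d n : nat}.
Variable P : probability Omega R.

(** The path space is itself made a measurable space by its generating cylinders, and
    [measurable_lipschitz_comp] is applied to the evaluation maps on it. *)
Lemma path_sigma_lipschitz (F : ('I_n -> 'cV[R]_d) -> R) (D : R) (A : set R) :
  lipschitz_dn F -> 0 <= D -> measurable A ->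
  path_sigma [set x : R -> 'cV[R]_d | A (F (fun k => x (k.+1%:R * D)))].
Proof.
move=> FL D0 mA.
pose G : set (set (R -> 'cV[R]_d)) := [set E | exists t : R, exists i : 'I_d,
  exists2 A : set R, 0 <= t /\ measurable A & E = [set x : R -> 'cV[R]_d | A (x t i 0)]].
have mF : measurable_fun [set: g_sigma_algebraType G]
    (fun x : g_sigma_algebraType G => F (fun k => x (k.+1%:R * D))).
  apply: measurable_lipschitz_comp => // k i _ B mB; rewrite setTI.
  apply: sub_sigma_algebra; exists (k.+1%:R * D), i, B => //.
  by split => //; rewrite mulr_ge0.
by have := mF measurableT _ mA; rewrite setTI.
Qed.

Lemma sampled_shift_law (X : process R Omega d) (F : ('I_n -> 'cV[R]_d) -> R) (D s : R) :
  shift_invariant_law P X -> lipschitz_dn F -> 0 <= D -> 0 <= s ->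
  forall A : set R, measurable A ->
    P (sampled F X D @^-1` A) = P ((fun w => F (fun k => X (s + k.+1%:R * D) w)) @^-1` A).
Proof.
by move=> XS FL D0 s0 A mA; exact/esym/(XS s s0 _ (path_sigma_lipschitz FL D0 mA)).
Qed.

End stationarity.

Section wiener_approximation.
Context {disp : measure_display} {Omega : measurableType disp} {R : realType}.
Variable P : probability Omega R.

Lemma wiener_integral_approx (Z : R -> Omega -> R) (f : R -> R) (Y : Omega -> R) (r : R) :
  is_wiener_integral P Z f Y -> 0 < r ->
  exists g : seq (R * R * R), [/\ forall p, p \in g -> p.1.2 <= p.2,
    (\int[lebesgue_measure]_s ((step_fun g s - f s) ^+ 2)%:E <= r%:E)%E &
    (\int[P]_w ((step_integral Z g w - Y w) ^+ 2)%:E <= r%:E)%E].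
Proof.
move=> [_ [_ [g [gle fg Yg]]]] r0.
have r0' : (0 < r%:E)%E by rewrite lte_fin.
have [m1 _ H1] := fg _ (open_ereal_lt' r0').
rewrite unlock in Yg; have [m2 _ H2] := Yg _ (open_ereal_lt' r0').
pose m := maxn m1 m2.
have /ltW h1 := H1 m (leq_maxl _ _); have /ltW h2 := H2 m (leq_maxr _ _).
exists (g m); split; first exact: gle.
- by under eq_integral do rewrite -sqrrN opprB.
- by under eq_integral do rewrite -sqrrN opprB.
Qed.

Lemma measurable_step_fun (g : seq (R * R * R)) : measurable_fun [set: R] (step_fun g).
Proof.
apply: measurable_sum => p; apply: measurable_fun_ifT => //.
by apply: measurable_and; [exact: measurable_fun_ltr|exact: measurable_fun_ler].
Qed.

End wiener_approximation.

(** * The product bound for functionals of the solution *)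

Section brownian_functional.
Context {disp : measure_display} {Omega : measurableType disp} {R : realType} {d : nat}.
Variable P : probability Omega R.
Variable W : process R Omega d.
Hypothesis WBM : two_sided_BM P W.

Variables (alpha L h : R) (b : 'cV[R]_d -> 'cV[R]_d) (sigma : 'M[R]_d).
Hypotheses (alpha_gt0 : 0 < alpha) (L_ge0 : 0 <= L) (h_ge0 : 0 <= h) (h_le1 : h <= 1).
Hypotheses (h_alpha : h * alpha <= 1) (h_L : h * L ^+ 2 <= alpha).
Hypothesis (hb : drift_assumption alpha L b).

Variables (p cH : R).
Hypotheses (p_lo : - 2^-1 < p) (p_hi : p < 2^-1) (cH_ge0 : 0 <= cH).

Variables (n N0 q : nat) (D : R).
Hypotheses (n_gt0 : (0 < n)%N) (qh : q%:R * h = D).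
Hypothesis N0_large : n%:R * (1 - alpha * h / 2) ^+ (N0 * q) <= 1.

Variables (F : ('I_n -> 'cV[R]_d) -> R) (K : R).
Hypothesis FK : lip_consts F K.

Variables (gs : nat -> 'I_d -> seq (R * R * R)) (u : nat -> R) (J : nat).
Hypothesis u_incr : {homo u : j k / (j < k)%N >-> j < k}.
Hypothesis gs_grid : forall l i, (l <= (N0 + n) * q)%N -> on_grid u J (gs l i).

Definition brownian_increment (x : 'I_J * 'I_d) (w : Omega) : R :=
  W (u x.1.+1) w x.2 0 - W (u x.1) w x.2 0.

Definition step_noise (x : 'I_J * 'I_d -> R) (l : nat) : 'cV[R]_d :=
  \col_(i < d) \sum_(j < J) step_fun (gs l i) (u j.+1) * x (j, i).

Definition euler_sample (z : nat -> 'cV[R]_d) : R :=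
  F (fun k => euler h b sigma z ((N0 + k.+1) * q)).

Definition kernel_error (i : 'I_d) (s : R) (m : nat) : R :=
  step_fun (gs m i) s - cH * (pos_powR (m%:R * h - s) p - pos_powR (- s) p).

Definition response (i : 'I_d) (s : R) : R :=
  sensitivity alpha L h p cH n N0 q D (kernel_error i s) s.

Let op0 : 0 <= opnorm sigma. Proof. exact: opnorm_ge0. Qed.
Let K0 : 0 <= K. Proof. by case: FK. Qed.

Lemma euler_sample_lip z z' : `|euler_sample z' - euler_sample z|
  <= K * \sum_(k < n) enorm (euler h b sigma z' ((N0 + k.+1) * q)
                             - euler h b sigma z ((N0 + k.+1) * q)).
Proof. by case: FK => _; apply. Qed.

Lemma enorm_delta_mx_le1 (i : 'I_d) : enorm (delta_mx i 0 : 'cV[R]_d) <= 1.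
Proof.
apply: le_trans (enorm_le_sum _) _.
rewrite (bigD1 i) //= big1 ?addr0 => [|k ki].
  by rewrite mxE !eqxx normr1.
by rewrite mxE (negPf ki) normr0.
Qed.

Lemma response_ge0 i s : 0 <= response i s.
Proof.
apply: addr_ge0; last by rewrite !mulr_ge0 ?addr_ge0 ?sumr_ge0.
rewrite mulr_ge0 // big_seq; apply: sumr_ge0 => w wS.
rewrite mulr_ge0 ?ker_sum_ge0 //.
exact: (memory_shifts_ge0 L_ge0 h_ge0 h_alpha wS).
Qed.

(** The point s of the cell is arbitrary: the coefficient of the increment is constant on the cell,
    and its distance to the exact kernel at s is charged to [kernel_error]. *)
Lemma euler_sample_coord_lip (x y : 'I_J * 'I_d -> R) (j : 'I_J) (i : 'I_d) (s : R) :
  (forall r, r != (j, i) -> x r = y r) -> u j < s -> s <= u j.+1 ->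
  `|euler_sample (step_noise x) - euler_sample (step_noise y)|
    <= K * opnorm sigma * response i s * `|x (j, i) - y (j, i)|.
Proof.
move=> xy js sj.
pose a m := step_fun (gs m i) (u j.+1).
pose delta := x (j, i) - y (j, i).
have noiseE m : step_noise x m - step_noise y m = (delta * a m) *: delta_mx i 0.
  apply/matrixP => k o; rewrite (ord1 o) !mxE eqxx andbT.
  rewrite -sumrB; have [->|ki] := eqVneq k i.
    rewrite (bigD1 j) //= big1 ?addr0 => [|j' jj'].
      by rewrite /delta /a mulr1 -mulrBr mulrC.
    rewrite xy ?subrr //; apply: contraNN jj' => /eqP [->].
    exact: eqxx.
  rewrite mulr0 big1 // => j' _; rewrite xy ?subrr //.
  by apply: contraNN ki => /eqP [_ ->]; exact: eqxx.
pose eps m := a m - cH * (pos_powR (m%:R * h - s) p - pos_powR (- s) p).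
have aE m : a m = cH * (pos_powR (m%:R * h - s) p - pos_powR (- s) p) + eps m.
  by rewrite /eps addrC subrK.
have H := euler_kernel_perturbation sigma L_ge0 h_ge0 h_le1 h_alpha h_L hb
  p_lo p_hi cH_ge0 (enorm_delta_mx_le1 i) noiseE aE.
apply: le_trans (euler_sample_lip _ _) _.
rewrite -!mulrA ler_wpM2l //.
apply: le_trans (ler_sum _ (fun (k : 'I_n) _ => H ((N0 + k.+1) * q)%N)) _.
rewrite -mulr_sumr [leRHS](_ : _ = `|delta| * opnorm sigma * response i s); last first.
  by rewrite /delta; ring.
rewrite ler_wpM2l ?mulr_ge0 //.
have S := sum_euler_kernel_le alpha_gt0 L_ge0 h_ge0 h_le1 h_alpha p cH_ge0
  n_gt0 qh N0_large eps s.
apply: le_trans S _.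
rewrite /response /sensitivity lerD2l ler_wpM2l ?mulr_ge0 ?addr_ge0 //.
apply: ler_sum => m _; rewrite /eps /kernel_error /a.
by rewrite -(@step_fun_cell R u u_incr J (gs m i) j s) //; apply: gs_grid; rewrite -ltnS.
Qed.

(** With the infimum over the cell, the sum of the squared constants times the cell lengths is a
    lower sum for the integral of the squared response. *)
Let coord_const (x : 'I_J * 'I_d) : R :=
  K * opnorm sigma * inf [set response x.2 s | s in `]u x.1, u x.1.+1]].

Let inf_response_ge0 k i : 0 <= inf [set response i s | s in `]u k, u k.+1]].
Proof.
apply: lb_le_inf; last by move=> _ [s _ <-]; exact: response_ge0.
exists (response i (u k.+1)), (u k.+1) => //=.
by rewrite in_itv /= lexx andbT u_incr.
Qed.

Let inf_response_le k i s : u k < s -> s <= u k.+1 ->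
  inf [set response i s | s in `]u k, u k.+1]] <= response i s.
Proof.
move=> ks sk; apply: ge_inf; first by exists 0 => _ [t _ <-]; exact: response_ge0.
by exists s => //=; rewrite in_itv /= ks.
Qed.

Lemma measurable_response i : measurable_fun [set: R] (response i).
Proof.
apply: (measurable_sensitivity alpha L h p cH D n N0 q (eps := fun m s => kernel_error i s m)).
move=> m; apply: measurable_funB; first exact: measurable_step_fun.
apply: measurable_funM => //; apply: measurable_funB.
  by apply: (measurableT_comp (measurable_pos_powR p)); exact: measurable_funB.
by apply: (measurableT_comp (measurable_pos_powR p)); exact: measurable_funN.
Qed.

Lemma measurable_step_noise l i :
  measurable_fun setT (fun w => step_noise (brownian_increment ^~ w) l i 0).
Proof.
have [mW _ _ _ _] := WBM.
under eq_fun do rewrite mxE.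
apply: measurable_sum => j; apply: measurable_funM => //.
by apply: measurable_funB; exact: mW.
Qed.

Lemma measurable_euler_sample (z : nat -> Omega -> 'cV[R]_d) :
  (forall l i, measurable_fun setT (fun w => z l w i 0)) ->
  measurable_fun setT (fun w => euler_sample (fun m => z m w)).
Proof.
move=> mz; apply: (measurable_lipschitz_comp
  (Y := fun k w => euler h b sigma (fun m => z m w) ((N0 + k.+1) * q))).
  by exists K.
by move=> k i; exact: (measurable_euler h sigma L_ge0 (fun x y => (hb x y).2) mz).
Qed.

Lemma brownian_exp_product (I : R) :
  (forall i, (\int[lebesgue_measure]_s (response i s ^+ 2)%:E <= I%:E)%E) ->
  exp_product_le P (expR (K ^+ 2 * opnorm sigma ^+ 2 * (d%:R * I)))
    (fun w => euler_sample (step_noise (brownian_increment ^~ w))).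
Proof.
move=> HI; have [mW _ _ lawW indW] := WBM.
pose s (x : 'I_J * 'I_d) := u x.1.+1 - u x.1.
have s0 x : 0 < s x by rewrite subr_gt0 u_incr.
have c0 x : 0 <= coord_const x by rewrite mulr_ge0 ?mulr_ge0.
have mxi x : measurable_fun setT (brownian_increment x).
  by apply: measurable_funB; exact: mW.
have Glip x (y y' : 'I_J * 'I_d -> R) : (forall r, r != x -> y r = y' r) ->
    `|euler_sample (step_noise y) - euler_sample (step_noise y')| <= coord_const x * `|y x - y' x|.
  case: x => j i yy'.
  pose S := [set response i s | s in `]u j, u j.+1]].
  have S0 : S !=set0.
    exists (response i (u j.+1)), (u j.+1) => //=.
    by rewrite in_itv /= lexx andbT u_incr.
  rewrite /coord_const /= mulrAC.
  set A := K * opnorm sigma * `|y (j, i) - y' (j, i)|.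
  have A0 : 0 <= A by rewrite !mulr_ge0.
  have H r : S r -> `|euler_sample (step_noise y) - euler_sample (step_noise y')| <= A * r.
    move=> [t /=]; rewrite in_itv /= => /andP[t1 t2] <-.
    by apply: le_trans (euler_sample_coord_lip yy' t1 t2) _; rewrite mulrAC.
  have [AE|An0] := eqVneq A 0.
    by case: S0 => r /H; rewrite AE !mul0r.
  have Agt : 0 < A by rewrite lt_def An0.
  rewrite mulrC -ler_pdivrMr //; apply: lb_le_inf => // r Sr.
  by rewrite ler_pdivrMr // mulrC H.
have := @gaussian_exp_product _ _ R P ('I_J * 'I_d)%type brownian_increment s coord_const
  s0 c0 mxi _ (indW J u u_incr) (fun x => euler_sample (step_noise x)) Glip _.
move=> H M M0; apply: le_trans (H _ _ M M0) _.
- by move=> [j i] A mA; rewrite /brownian_increment lawW // u_incr.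
- by apply: (measurable_euler_sample
    (z := fun m w => step_noise (brownian_increment ^~ w) m)); exact: measurable_step_noise.
rewrite ler_expR -(pair_big xpredT xpredT (fun j i => coord_const (j, i) ^+ 2 * s (j, i))) /=.
rewrite exchange_big /=.
have one i : \sum_(j < J) coord_const (j, i) ^+ 2 * s (j, i)
    <= K ^+ 2 * opnorm sigma ^+ 2 * I.
  rewrite /coord_const /s /=.
  rewrite (eq_bigr (fun j : 'I_J => K ^+ 2 * opnorm sigma ^+ 2
    * (inf [set response i s | s in `]u j, u j.+1]] ^+ 2 * (u j.+1 - u j)))); last first.
    by move=> j _; rewrite !exprMn; ring.
  rewrite -mulr_sumr ler_wpM2l ?mulr_ge0 ?sqr_ge0 //.
  rewrite -lee_fin; apply: le_trans (HI i).
  apply: (@sum_cells_le_integral R u u_incr J (fun s => response i s ^+ 2)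
    (fun k => inf [set response i s | s in `]u k, u k.+1]] ^+ 2)).
  - by apply: measurable_funX; exact: measurable_response.
  - by move=> t; exact: sqr_ge0.
  - by move=> k; exact: sqr_ge0.
  - move=> k t kt tk; rewrite ler_pXn2r ?nnegrE ?response_ge0 //.
    exact: inf_response_le.
apply: le_trans (ler_sum _ (fun i _ => one i)) _.
by rewrite sumr_const card_ord -[X in X <= _]mulr_natl mulrCA.
Qed.

Lemma step_noise_integral w l i : (l <= (N0 + n) * q)%N ->
  step_noise (brownian_increment ^~ w) l i 0
    = step_integral (fun t w => W t w i 0) (gs l i) w.
Proof.
move=> lN; rewrite mxE (step_integral_cells u_incr _ _ (gs_grid (i := i) lN)).
by apply: eq_bigr => j _.
Qed.

Lemma euler_sample_noise_lip z z' : `|euler_sample z' - euler_sample z|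
  <= K * (n%:R * (opnorm sigma * (L + 3)
       * \sum_(m < ((N0 + n) * q).+1) \sum_(i < d) `|z' m i 0 - z m i 0|)).
Proof.
apply: le_trans (euler_sample_lip _ _) _; rewrite ler_wpM2l //.
set S := \sum_(m < _) _.
apply: (@le_trans _ _ (\sum_(k < n) opnorm sigma * (L + 3) * S)); last first.
  by rewrite sumr_const card_ord -[X in X <= _]mulr_natl.
apply: ler_sum => k _.
apply: le_trans (euler_noise_lip sigma alpha_gt0 L_ge0 h_ge0 h_le1 h_alpha h_L hb z z' _) _.
rewrite ler_wpM2l ?mulr_ge0 ?addr_ge0 //.
pose f m := \sum_(i < d) `|z' m i 0 - z m i 0|.
have f0 m : 0 <= f m by exact: sumr_ge0.
apply: (@le_trans _ _ (\sum_(m < ((N0 + k.+1) * q).+1) f m)).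
  apply: ler_sum => m _; apply: le_trans (enorm_le_sum _) _.
  by apply: ler_sum => i _; rewrite !mxE.
rewrite /S -!(big_mkord xpredT f).
rewrite [leRHS](big_cat_nat (n := ((N0 + k.+1) * q).+1)) //=.
  by rewrite lerDl sumr_ge0.
by rewrite ltnS leq_mul2r leq_add2l ltn_ord orbT.
Qed.

End brownian_functional.

Lemma exp_product_le_mono {disp : measure_display} {T : measurableType disp}
    {R : realType} (P : probability T R) (V V' : R) (U : T -> R) :
  V <= V' -> exp_product_le P V U -> exp_product_le P V' U.
Proof. by move=> VV' H M M0; apply: le_trans VV'; exact: H. Qed.

Lemma exists_small_factor {R : realType} (A1 A2 a1 a2 : R) : 0 <= A1 -> 0 <= A2 -> 0 < a1 -> 0 < a2 ->
  exists r, [/\ 0 < r, A1 * r <= a1 & A2 * r <= a2].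
Proof.
move=> A10 A20 a10 a20.
have A0 : 0 < A1 + A2 + 1 by rewrite ltr_wpDl ?addr_ge0.
have m0 : 0 < Num.min a1 a2 by rewrite lt_min a10.
exists (Num.min a1 a2 / (A1 + A2 + 1)); split; first exact: divr_gt0.
- rewrite mulrA ler_pdivrMr //; apply: (@le_trans _ _ (A1 * a1)).
    by rewrite ler_wpM2l // ge_min lexx.
  by rewrite mulrC ler_wpM2l ?(ltW a10) //; lra.
- rewrite mulrA ler_pdivrMr //; apply: (@le_trans _ _ (A2 * a2)).
    by rewrite ler_wpM2l // ge_min lexx orbT.
  by rewrite mulrC ler_wpM2l ?(ltW a20) //; lra.
Qed.

(** * The Euler scheme driven by fractional Brownian motion *)

Section fractional_euler.
Context {disp : measure_display} {Omega : measurableType disp} {R : realType} {d : nat}.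
Variable P : probability Omega R.
Variables (H : R) (W B : process R Omega d).
Hypotheses (WBM : two_sided_BM P W) (BM : mvn_fBM P H W B).

Variables (alpha L h : R) (b : 'cV[R]_d -> 'cV[R]_d) (sigma : 'M[R]_d).
Hypotheses (alpha_gt0 : 0 < alpha) (L_ge0 : 0 <= L) (h_ge0 : 0 <= h) (h_le1 : h <= 1).
Hypotheses (h_alpha : h * alpha <= 1) (h_L : h * L ^+ 2 <= alpha).
Hypothesis (hb : drift_assumption alpha L b).
Hypothesis H01 : 0 < H < 1.

Variables (n N0 q : nat) (D : R).
Hypotheses (n_gt0 : (0 < n)%N) (qh : q%:R * h = D).
Hypothesis N0_large : n%:R * (1 - alpha * h / 2) ^+ (N0 * q) <= 1.

Variables (F : ('I_n -> 'cV[R]_d) -> R) (K : R).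
Hypothesis FK : lip_consts F K.

Lemma measurable_fBM t i : measurable_fun setT (fun w => B t w i 0).
Proof. by have [/(_ t i) [_ [+ _]] _] := BM. Qed.

Lemma mvn_const_ge0 : 0 <= mvn_const H.
Proof. by rewrite invr_ge0 sqrtr_ge0. Qed.

Lemma approx_fBM (N : nat) (r : R) : 0 < r ->
  exists (gs : nat -> 'I_d -> seq (R * R * R)) (u : nat -> R) (J : nat),
  [/\ {homo u : j k / (j < k)%N >-> j < k},
      forall l i, (l <= N)%N -> on_grid u J (gs l i),
      forall m i, (\int[lebesgue_measure]_s
        ((step_fun (gs m i) s - mvn_const H * mvn_kernel H (m%:R * h) s) ^+ 2)%:E <= r%:E)%E &
      forall m i, (\int[P]_w ((step_integral (fun t w => W t w i 0) (gs m i) w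
                     - B (m%:R * h) w i 0) ^+ 2)%:E <= r%:E)%E].
Proof.
move=> r0.
have [gs hgs] := choice (fun x : nat * 'I_d =>
  wiener_integral_approx (BM.1 (x.1%:R * h) x.2) r0).
(* All end points of the step functions for the times 0 to N, so that a single grid serves every
   time and coordinate. *)
pose pts := flatten [seq flatten [seq flatten [seq [:: p.1.2; p.2] | p <- gs (m, i)]
  | i <- enum 'I_d] | m <- iota 0 N.+1].
have [u [J [u_incr uP]]] := grid_exists pts.
exists (fun m i => gs (m, i)), u, J; split=> //.
- move=> l i lN p pg; have [ple _ _] := hgs (l, i).
  have inpts x : x \in [:: p.1.2; p.2] -> x \in pts.
    move=> xp; apply/flatten_mapP; exists l; first by rewrite mem_iota.
    apply/flatten_mapP; exists i; first by rewrite mem_enum.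
    by apply/flatten_mapP; exists p.
  have [j1 _ E1] := uP _ (inpts p.1.2 (mem_head _ _)).
  have [j2 j2J E2] := uP _ (inpts p.2 (mem_last p.1.2 [:: p.2])).
  exists j1, j2; split=> //.
  by rewrite -(grid_leE u_incr) -E1 -E2; exact: ple.
- by move=> m i; have [_ + _] := hgs (m, i).
- by move=> m i; have [_ _ +] := hgs (m, i).
Qed.

Lemma euler_fBM_exp_product (I : R) :
  (\int[lebesgue_measure]_s (ker_sum (H - 2^-1) n D s ^+ 2)%:E <= I%:E)%E ->
  exp_product_le P (expR (K ^+ 2 * opnorm sigma ^+ 2
                     * (d%:R * (2 * ((mvn_const H * memory_bound alpha L) ^+ 2 * I)))))
    (fun w => euler_sample h b sigma N0 q F (fun m => B (m%:R * h) w)).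
Proof.
move=> HI.
have /andP[H0 H1] := H01.
have p_lo : - 2^-1 < H - 2^-1 by lra.
have p_hi : H - 2^-1 < 2^-1 by lra.
have op0 : 0 <= opnorm sigma by exact: opnorm_ge0.
have K0 : 0 <= K by case: FK.
set v := K ^+ 2 * _ * _.
pose Y w := euler_sample h b sigma N0 q F (fun m => B (m%:R * h) w).
have mY : measurable_fun setT Y.
  apply: (measurable_euler_sample h sigma L_ge0 hb N0 q FK (z := fun m w => B (m%:R * h) w)).
  by move=> l i; exact: measurable_fBM.
apply: exp_product_le_closed => // e e0 e1.
pose N := ((N0 + n) * q)%N.
pose c0 := K * (n%:R * (opnorm sigma * (L + 3))).
have c00 : 0 <= c0 by rewrite !mulr_ge0 ?addr_ge0.
pose card : R := #|{: 'I_N.+1 * 'I_d}|%:R.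
(* A1 r is the Chebyshev bound for replacing B by the step noise, and A2 r the increase of the
   exponent due to [kernel_error]. The latter must stay below ln(exp v + e) - v, since the closure
   lemma allows an additive error e outside the exponential. *)
pose A1 := e ^- 2 * c0 ^+ 2 * card ^+ 2.
pose A2 := K ^+ 2 * opnorm sigma ^+ 2 * (d%:R * (2 * (n%:R * (L + 3) * N.+1%:R) ^+ 2)).
have a20 : 0 < ln (expR v + e) - v.
  by rewrite subr_gt0 -ltr_expR lnK ?posrE ?addr_gt0 ?expR_gt0 // ltrDl.
have [r [r0 A1r A2r]] : exists r, [/\ 0 < r, A1 * r <= e & A2 * r <= ln (expR v + e) - v].
  apply: exists_small_factor => //.
  - by rewrite /A1; apply: mulr_ge0; [apply: mulr_ge0|];
      rewrite ?invr_ge0 ?exprn_ge0 // ltW.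
  - by rewrite /A2; apply: mulr_ge0; [apply: mulr_ge0; exact: sqr_ge0|];
      apply: mulr_ge0 => //; apply: mulr_ge0 => //; exact: sqr_ge0.
have [gs [u [J [u_incr gs_grid kerr ierr]]]] := approx_fBM N r0.
pose z' w := step_noise gs u (brownian_increment W u (J := J) ^~ w).
exists Y, (fun w => euler_sample h b sigma N0 q F (z' w)); split=> //.
- apply: (measurable_euler_sample h sigma L_ge0 hb N0 q FK (z := fun m w => z' w m)).
  by move=> l i; exact: (measurable_step_noise WBM gs u J l i).
- apply: (@exp_product_le_mono _ _ _ _ (expR (K ^+ 2 * opnorm sigma ^+ 2 * (d%:R *
    (2 * ((mvn_const H * memory_bound alpha L) ^+ 2 * I
          + (n%:R * (L + 3) * N.+1%:R) ^+ 2 * r)))))).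
    rewrite [X in expR X](_ : _ = v + A2 * r); last by rewrite /v /A2; ring.
    rewrite -[leRHS]lnK ?posrE ?addr_gt0 ?expR_gt0 // ler_expR.
    by rewrite -lerBrDl.
  apply: (brownian_exp_product WBM sigma alpha_gt0 L_ge0 h_ge0 h_le1 h_alpha h_L hb
    p_lo p_hi mvn_const_ge0 n_gt0 qh N0_large FK u_incr gs_grid) => i.
  apply: (integral_sensitivity (mvn_const H) alpha_gt0 L_ge0 h_ge0 h_alpha
    (eps := fun m s => kernel_error h (H - 2^-1) (mvn_const H) gs i s m)) => //.
  + move=> m; apply: measurable_funB; first exact: measurable_step_fun.
    apply: measurable_funM => //; apply: measurable_funB.
      by apply: (measurableT_comp (measurable_pos_powR _)); exact: measurable_funB.
    by apply: (measurableT_comp (measurable_pos_powR _)); exact: measurable_funN.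
  + by move=> m _; exact: kerr.
have mz' : measurable_fun setT (fun w => euler_sample h b sigma N0 q F (z' w)).
  apply: (measurable_euler_sample h sigma L_ge0 hb N0 q FK (z := fun m w => z' w m)).
  by move=> l i; exact: (measurable_step_noise WBM gs u J l i).
pose Z w := Y w - euler_sample h b sigma N0 q F (z' w).
have mZ : measurable_fun setT Z by exact: measurable_funB.
apply: le_trans (probability_gt_sqr P mZ e0) _.
pose f (x : 'I_N.+1 * 'I_d) w :=
  step_integral (fun t w => W t w x.2 0) (gs x.1 x.2) w - B (x.1%:R * h) w x.2 0.
have mf x : measurable_fun setT (f x).
  have [mW _ _ _ _] := WBM.
  apply: measurable_funB; last exact: measurable_fBM.
  apply: measurable_sum => p; apply: measurable_funM => //.
  by apply: measurable_funB; exact: mW.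
have mS : measurable_fun setT (fun w => \sum_x `|f x w|).
  by apply: measurable_sum => x; apply: measurableT_comp => //; exact: mf.
have ZS w : `|Z w| <= c0 * \sum_x `|f x w|.
  apply: le_trans (euler_sample_noise_lip sigma alpha_gt0 L_ge0 h_ge0 h_le1 h_alpha h_L hb
    N0 q FK _ _) _.
  rewrite /c0 -!mulrA !ler_wpM2l ?addr_ge0 // le_eqVlt; apply/orP; left; apply/eqP.
  rewrite pair_big /=; apply: eq_bigr => -[m i] _ /=.
  rewrite distrC /f /= /z'; congr `|_ - _|.
  by apply: (step_noise_integral W u_incr gs_grid); rewrite -ltnS.
apply: (@le_trans _ _ ((e ^- 2)%:E * \int[P]_w (c0 ^+ 2 * (\sum_x `|f x w|) ^+ 2)%:E)%E).
  apply: lee_wpmul2l; first by rewrite lee_fin invr_ge0 exprn_ge0 // ltW.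
  apply: ge0_integral_le.
  - exact: measurable_funX.
  - by apply: measurable_funM => //; exact: measurable_funX.
  - by move=> w; exact: sqr_ge0.
  - move=> w; rewrite -exprMn -(real_normK (num_real (Z w))).
    apply: lerXn2r; rewrite ?nnegrE //.
    by apply: mulr_ge0 => //; exact: sumr_ge0.
rewrite ge0_integral_scale ?sqr_ge0 //; last 2 first.
- exact: measurable_funX.
- by move=> w; exact: sqr_ge0.
have := integral_sqr_sum_norm_le mf (fun x => ierr x.1 x.2).
move=> SI.
apply: (@le_trans _ _ ((e ^- 2)%:E * ((c0 ^+ 2)%:E * (card ^+ 2 * r)%:E))%E).
  apply: lee_wpmul2l; first by rewrite lee_fin invr_ge0 exprn_ge0 // ltW.
  by apply: lee_wpmul2l; first by rewrite lee_fin sqr_ge0.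
rewrite -!EFinM lee_fin; apply: le_trans A1r.
by rewrite /A1 -!mulrA.
Qed.

End fractional_euler.

Lemma near_mesh_le {R : realType} (D c : R) : 0 < D -> 0 < c ->
  \forall q \near \oo, D / q.+1%:R <= c.
Proof.
move=> D0 c0; near=> q.
rewrite ler_pdivrMr // -ler_pdivrMl // mulrC ltW //.
apply: lt_trans (truncnS_gt _) _; rewrite ltr_nat ltnS.
by near: q; exact: nbhs_infty_gt.
Unshelve. all: by end_near. Qed.

Section sampled_solution.
Context {disp : measure_display} {Omega : measurableType disp} {R : realType} {d : nat}.
Variable P : probability Omega R.
Variables (H alpha L : R) (b : 'cV[R]_d -> 'cV[R]_d) (sigma : 'M[R]_d) (W B X : process R Omega d).
Hypotheses (H01 : 0 < H < 1) (alpha_gt0 : 0 < alpha) (L_ge0 : 0 <= L).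
Hypotheses (cb : continuous b) (hb : drift_assumption alpha L b).
Hypothesis SS : stationary_solution P H b sigma W B X.

Variables (n : nat) (D : R) (F : ('I_n -> 'cV[R]_d) -> R) (K : R).
Hypotheses (n_gt0 : (0 < n)%N) (D_gt0 : 0 < D) (FK : lip_consts F K).

(** A bound for the contraction over one sampling step D valid for every admissible mesh
    ([contraction_pow_le]), so that N0 can be chosen before the mesh. *)
Let rho : R := expR (- (alpha * D / 2)).

Let rho_lt1 : rho < 1.
Proof. by rewrite expR_lt1 oppr_lt0 divr_gt0 // mulr_gt0. Qed.

Let rho_cvg0 (c : R) : c * rho ^+ N @[N --> \oo] --> 0.
Proof.
rewrite -[X in _ --> X](mulr0 c); apply: cvgM; first exact: cvg_cst.
by apply: cvg_expr; rewrite ger0_norm ?expR_ge0.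
Qed.

Lemma contraction_pow_le (h : R) (q : nat) : h = D / q.+1%:R -> 0 <= 1 - alpha * h / 2 ->
  (1 - alpha * h / 2) ^+ q.+1 <= rho.
Proof.
move=> hE g0.
have -> : rho = expR (- (alpha * h / 2)) ^+ q.+1.
  by rewrite -expRM_natl /rho hE; congr expR; field; rewrite nat1r pnatr_eq0.
apply: lerXn2r; rewrite ?nnegrE ?expR_ge0 //.
exact: expR_ge1Dx.
Qed.

Lemma sampled_euler_near (w : Omega) (N0 : nat) (e : R) :
  {within `[0, +oo[, continuous (X ^~ w)} ->
  (forall t, 0 <= t -> X t w = X 0 w
     + \col_(i < d) (\int[lebesgue_measure]_(s in `[0, t]) b (X s w) i 0) + sigma *m B t w) ->
  0 < e ->
  \forall q \near \oo, forall h : R, h = D / q.+1%:R ->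
    `|F (fun k => X (N0%:R * D + k.+1%:R * D) w)
      - euler_sample h b sigma N0 q.+1 F (fun m => B (m%:R * h) w)|
    <= K * n%:R * enorm (X 0 w) * rho ^+ N0 + e.
Proof.
move=> cx xE e0.
have K0 : 0 <= K by case: FK.
have nK0 : 0 < K * n%:R + 1 by rewrite ltr_wpDl // mulr_ge0.
pose e1 := e / (K * n%:R + 1).
have e10 : 0 < e1 by rewrite divr_gt0.
have a1 : 0 < alpha^-1 by rewrite invr_gt0.
near=> q => h hE.
have h0 : 0 < h by rewrite hE divr_gt0.
have ha : h * alpha <= 1.
  by rewrite -ler_pdivlMr // mul1r hE; near: q; exact: near_mesh_le.
have g0 : 0 <= 1 - alpha * h / 2 by exact: contraction_ge0.
have g1 : 1 - alpha * h / 2 <= 1 by rewrite lerBlDr lerDl divr_ge0 // mulr_ge0 // ltW.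
have gq := contraction_pow_le hE g0.
have close (k : 'I_n) : enorm (X (N0%:R * D + k.+1%:R * D) w
    - euler h b sigma (fun m => B (m%:R * h) w) ((N0 + k.+1) * q.+1))
    <= rho ^+ N0 * enorm (X 0 w) + e1.
  have tE : N0%:R * D + k.+1%:R * D = ((N0 + k.+1) * q.+1)%:R * h.
    by rewrite hE !natrM !natrD; field; rewrite nat1r pnatr_eq0.
  rewrite tE.
  apply: (@le_trans _ _ ((1 - alpha * h / 2) ^+ ((N0 + k.+1) * q.+1) * enorm (X 0 w) + e1)).
    have lT : ((N0 + k.+1) * q.+1)%:R * h <= (N0 + n)%:R * D.
      by rewrite -tE -mulrDl -natrD ler_pM2r // ler_nat leq_add2l.
    move: h ((N0 + k.+1) * q.+1)%N hE lT {tE h0 ha g0 g1 gq}.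
    by near: q; exact: (euler_converges alpha_gt0 L_ge0 hb cb cx xE).
  rewrite lerD2r ler_wpM2r ?enorm_ge0 // mulnC exprM.
  apply: (@le_trans _ _ (((1 - alpha * h / 2) ^+ q.+1) ^+ N0)).
    by apply: ler_wiXn2l; rewrite ?exprn_ge0 ?exprn_ile1 // leq_addr.
  by apply: lerXn2r; rewrite ?nnegrE ?exprn_ge0 ?expR_ge0.
case: FK => _ FL; apply: le_trans (FL _ _) _.
apply: (@le_trans _ _ (K * \sum_(k < n) (rho ^+ N0 * enorm (X 0 w) + e1))).
  by rewrite ler_wpM2l //; apply: ler_sum => k _; exact: close.
rewrite sumr_const card_ord -[X in K * X <= _]mulr_natl.
rewrite [leLHS](_ : _ = K * n%:R * enorm (X 0 w) * rho ^+ N0 + K * n%:R * e1); last by ring.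
rewrite lerD2l /e1 mulrA ler_pdivrMr // mulrC ler_wpM2l ?(ltW e0) //; lra.
Unshelve. all: by end_near. Qed.

Lemma measurable_sampled s : 0 <= s ->
  measurable_fun setT (fun w => F (fun k => X (s + k.+1%:R * D) w)).
Proof.
move=> s0; have [_ _ _ [mX _ _] _] := SS.
apply: (measurable_lipschitz_comp (Y := fun k w => X (s + k.+1%:R * D) w)); first by exists K.
by move=> k i; apply: mX; rewrite addr_ge0 // mulr_ge0 // ltW.
Qed.

Lemma exp_product_sampled (D1 : R) : D <= D1 -> 1 <= n%:R * D ->
  exp_product_le P (expR (K ^+ 2 * opnorm sigma ^+ 2
      * (d%:R * (2 * ((mvn_const H * memory_bound alpha L) ^+ 2
                      * (ker_const (H - 2^-1) D1 * conc_rate H n D))))))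
    (sampled F X D).
Proof.
move=> DD1 nD.
have [WBM BM _ [mX cX eX] shX] := SS.
have /andP[H0 H1] := H01.
have p_lo : - 2^-1 < H - 2^-1 by lra.
have p_hi : H - 2^-1 < 2^-1 by lra.
have K0 : 0 <= K by case: FK.
have D0 := ltW D_gt0.
have mU : measurable_fun setT (sampled F X D).
  rewrite /sampled; have := measurable_sampled (lexx 0).
  by apply: eq_measurable_fun => w _; congr F; apply/funext => k; rewrite add0r.
set V := expR _.
apply: exp_product_le_closed; [exact: mU|exact: expR_ge0|move=> e e0 e1].
have e20 : 0 < e / 2 by rewrite divr_gt0.
pose Z1 N w : R := K * n%:R * enorm (X 0 w) * rho ^+ N.
have mZ1 N : measurable_fun setT (Z1 N).
  apply: measurable_funM => //; apply: measurable_funM => //.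
  under eq_fun do rewrite -[X 0 _]subr0.
  by apply: measurable_enorm_sub; exact: mX.
(* The time shift must make the initial gap small in probability and also bring n rho^N0 below 1, as
   the sensitivity bound requires. *)
have [N1 HN1] : exists q0, forall q, (q0 <= q)%N -> (P [set w | (e / 2 < Z1 q w)%R] <= (e / 2)%:E)%E.
  by apply: probability_gt_ae_cvg0 => //; apply: aeW => w; exact: rho_cvg0.
have [N2 _ HN2] : \forall N \near \oo, n%:R * rho ^+ N <= 1.
  have := rho_cvg0 n%:R; move/cvgr_le; apply.
  exact: ltr01.
pose N0 := maxn N1 N2.
have nrho : n%:R * rho ^+ N0 <= 1 by apply: HN2; exact: leq_maxr.
have PZ1 : (P [set w | (e / 2 < Z1 N0 w)%R] <= (e / 2)%:E)%E by apply: HN1; exact: leq_maxl.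
pose U1 w := F (fun k => X (N0%:R * D + k.+1%:R * D) w).
have mU1 : measurable_fun setT U1 by apply: measurable_sampled; rewrite mulr_ge0.
pose Y q w := let h := D / q.+1%:R in
  euler_sample h b sigma N0 q.+1 F (fun m => B (m%:R * h) w).
have mY q : measurable_fun setT (Y q).
  apply: (measurable_euler_sample _ sigma L_ge0 hb N0 q.+1 FK
    (z := fun m w => B (m%:R * (D / q.+1%:R)) w)).
  by move=> l i; exact: (measurable_fBM BM).
(* The excess of the error over the initial gap: at fixed N0 it tends to 0 with the mesh, whereas
   the estimate of the error itself keeps the gap. *)
pose Z2 q w := Num.max 0 (`|U1 w - Y q w| - Z1 N0 w).
have mUY q : measurable_fun setT (fun w => `|U1 w - Y q w|).
  by apply: measurableT_comp => //; exact: measurable_funB.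
have mZ2 q : measurable_fun setT (Z2 q).
  by apply: measurable_maxr => //; exact: measurable_funB.
have Z2cvg : {ae P, forall w, Z2 q w @[q --> \oo] --> 0}.
  apply: filterS2 cX eX => w cx xE.
  apply/cvgrPdist_le => eps eps0.
  near=> q; rewrite sub0r normrN ger0_norm ?le_max ?lexx // ge_max (ltW eps0) /=.
  rewrite lerBlDl.
  have : forall h : R, h = D / q.+1%:R -> `|U1 w
      - euler_sample h b sigma N0 q.+1 F (fun m => B (m%:R * h) w)|
      <= K * n%:R * enorm (X 0 w) * rho ^+ N0 + eps.
    by near: q; exact: sampled_euler_near.
  by move=> /(_ _ erefl).
have [q0 Hq0] := probability_gt_ae_cvg0 mZ2 Z2cvg e20.
have a1 : 0 < alpha^-1 by rewrite invr_gt0.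
have L1 : 0 < L ^+ 2 + 1 by rewrite ltr_wpDl ?sqr_ge0.
have [q1 _ Hq1] : \forall q \near \oo, [/\ D / q.+1%:R <= 1, D / q.+1%:R <= alpha^-1
    & D / q.+1%:R <= alpha / (L ^+ 2 + 1)].
  near=> q; split; near: q; apply: near_mesh_le => //.
  by rewrite divr_gt0.
pose q := maxn q0 q1; pose h := D / q.+1%:R.
have [h1 hal hL'] := Hq1 q (leq_maxr _ _).
have h0 : 0 <= h by rewrite divr_ge0.
have ha : h * alpha <= 1 by rewrite -ler_pdivlMr // mul1r.
have hL : h * L ^+ 2 <= alpha.
  by move: hL'; rewrite ler_pdivlMr //; apply: le_trans; rewrite ler_wpM2l // lerDl.
have g0 : 0 <= 1 - alpha * h / 2 by exact: contraction_ge0.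
have qh : q.+1%:R * h = D by rewrite mulrC divfK ?pnatr_eq0.
exists U1, (Y q); split=> //.
- by apply: sampled_shift_law => //; [exists K|rewrite mulr_ge0].
- apply: (@exp_product_le_mono _ _ _ _ V); first by rewrite lerDl ltW.
  apply: (euler_fBM_exp_product WBM BM sigma alpha_gt0 L_ge0 h0 h1 ha hL hb H01 n_gt0 qh _ FK).
    apply: le_trans nrho; rewrite ler_wpM2l // mulnC exprM.
    by apply: lerXn2r; rewrite ?nnegrE ?exprn_ge0 ?expR_ge0 //; exact: contraction_pow_le.
  by rewrite conc_rateE //; exact: integral_ker_sum_sqr.
have mE1 : measurable [set w | e / 2 < Z1 N0 w] by exact: measurable_gt.
have mE2 : measurable [set w | e / 2 < Z2 q w] by exact: measurable_gt.
apply: (@le_trans _ _ (P ([set w | (e / 2 < Z1 N0 w)%R] `|` [set w | (e / 2 < Z2 q w)%R]))).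
  apply: le_measure; rewrite ?inE //.
  - exact: measurable_gt.
  - exact: measurableU.
  - move=> w /= eUY; have [zl|zl] := leP (Z1 N0 w) (e / 2); [right|by left].
    rewrite /Z2 lt_max; apply/orP; right; lra.
apply: le_trans (measureU2 _ mE1 mE2) _.
rewrite [leRHS](_ : _ = (e / 2)%:E + (e / 2)%:E)%E; last by rewrite -EFinD -splitr.
by apply: leeD => //; apply: Hq0; exact: leq_maxl.
Unshelve. all: by end_near. Qed.

End sampled_solution.

(** * Deviation inequalities *)

Section deviation.
Context {disp : measure_display} {T : measurableType disp} {R : realType}.
Variables (P : probability T R) (U : T -> R) (c : R).
Hypotheses (mU : measurable_fun setT U) (c_ge0 : 0 <= c).
Hypothesis expU : forall l, 0 < l -> exp_product_le P (expR (c * l ^+ 2)) (fun w => l * U w).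

Let mean := fine (\int[P]_w (U w)%:E).

Let mexp (l a : R) : measurable_fun setT (fun w => expR (l * (U w - a))).
Proof.
apply: measurableT_comp => //; apply: measurable_funM => //.
exact: measurable_funB.
Qed.

(** The product bound makes both exponential moments finite, and |U| <= exp U + exp(- U). *)
Lemma exp_product_integrable : P.-integrable setT (EFin \o U).
Proof.
have mU1 : measurable_fun setT (fun w => 1 * U w) by exact: measurable_funM.
have [A [A' [EA EA' _ _ _]]] := exp_product_integrals mU1 (expU ltr01).
apply/integrableP; split; first exact/measurable_EFinP.
apply: (@le_lt_trans _ _ (\int[P]_w (expR (1 * U w) + expR (- (1 * U w)))%:E)%E).
  apply: (@ge0_integral_le _ _ _ P (fun w => `|U w|)).
  - exact: measurableT_comp.
  - apply: measurable_funD; apply: measurableT_comp => //; exact: measurable_funN.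
  - by move=> w; exact: normr_ge0.
  - move=> w; rewrite mul1r ler_norml.
    have := expR_ge1Dx (U w); have := expR_ge1Dx (- U w).
    have := expR_gt0 (U w); have := expR_gt0 (- U w).
    move: (expR (U w)) (expR (- U w)) => x y x0 y0 h1 h2; apply/andP; split; lra.
rewrite ge0_integral_add //.
- by rewrite EA EA' -EFinD ltry.
- exact: measurableT_comp.
- by apply: measurableT_comp => //; exact: measurable_funN.
Qed.

Let integral_affine (l : R) : (\int[P]_w (1 - l * (U w - mean))%:E = 1%:E)%E.
Proof.
have intU := exp_product_integrable.
have IE : (\int[P]_w (U w)%:E = mean%:E)%E by rewrite fineK // integrable_fin_num.
transitivity (\int[P]_w ((1 + l * mean)%:E + (- l)%:E * (U w)%:E))%E.
  by apply: eq_integral => w _; rewrite -EFinM -EFinD; congr EFin; ring.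
rewrite (@integralD _ _ R P setT measurableT (cst (1 + l * mean)%:E)
  (fun w => (- l)%:E * (U w)%:E)%E); last 2 first.
- exact: (finite_measure_integrable_cst P (1 + l * mean) measurableT).
- exact: integrableZl.
rewrite (@integralZl _ _ R P setT measurableT (EFin \o U) intU) integral_cst_prob.
by rewrite IE -EFinM -EFinD; congr EFin; ring.
Qed.

(* By Jensen's inequality E exp(- l (U - E U)) >= 1, so that the product bound
   controls the other factor. *)
Lemma centered_exp_le (l : R) : 0 < l ->
  (\int[P]_w (expR (l * (U w - mean)))%:E <= (expR (c * l ^+ 2))%:E)%E.
Proof.
move=> l0; have mlU : measurable_fun setT (fun w => l * U w) by exact: measurable_funM.
have [A [A' [EA EA' A0 A'0 AA]]] := exp_product_integrals mlU (expU l0).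
have split_exp (s : R) w : expR (s * (U w - mean)) = expR (- (s * mean)) * expR (s * U w).
  by rewrite -expRD; congr expR; ring.
(* Jensen's inequality through exp y >= 1 + y at y = - l (U - mean); the affine minorant has mean 1
   by [integral_affine]. *)
have low : 1 <= expR (l * mean) * A'.
  rewrite -lee_fin EFinM -EA' -ge0_integral_scale ?expR_ge0 //; last first.
    by apply: measurableT_comp => //; exact: measurable_funN.
  rewrite -(integral_affine l); apply: le_integral => //.
  - have intU := exp_product_integrable.
    apply: (eq_integrable measurableT
      (fun w => (1 + l * mean)%:E + (- l)%:E * (U w)%:E)%E).
      by move=> w _; rewrite -EFinM -EFinD; congr EFin; ring.
    apply: integrableD => //.
      exact: (finite_measure_integrable_cst P (1 + l * mean) measurableT).
    exact: integrableZl.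
  - apply/integrableP; split.
      apply/measurable_EFinP; apply: measurable_funM => //.
      by apply: measurableT_comp => //; exact: measurable_funN.
    under eq_integral do rewrite gee0_abs ?lee_fin ?mulr_ge0 ?expR_ge0 //.
    rewrite ge0_integral_scale ?expR_ge0 //; last first.
      by apply: measurableT_comp => //; exact: measurable_funN.
    by rewrite EA' -EFinM ltry.
  - move=> w _; rewrite lee_fin -expRD.
    apply: le_trans (expR_ge1Dx _); rewrite le_eqVlt; apply/orP; left; apply/eqP; ring.
under eq_integral do rewrite split_exp.
rewrite ge0_integral_scale ?expR_ge0 //; last first.
  exact: measurableT_comp.
rewrite EA -EFinM lee_fin; apply: le_trans AA.
rewrite expRN mulrC ler_pdivrMr ?expR_gt0 // -mulrA ler_peMr ?(ltW A0) //.
by rewrite mulrC.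
Qed.

Let chernoff_le (r l : R) : 0 < l ->
  (P [set w | (r < U w - mean)%R] <= (expR (c * l ^+ 2 - l * r))%:E)%E.
Proof.
move=> l0.
have mA : measurable [set w | r < U w - mean] by apply: measurable_gt; exact: measurable_funB.
have : ((expR (l * r))%:E * P [set w | (r < U w - mean)%R] <= (expR (c * l ^+ 2))%:E)%E.
  apply: le_trans (centered_exp_le l0).
  have := @integral_indic _ _ R P setT measurableT _ mA; rewrite setIT => <-.
  rewrite -ge0_integral_scale ?expR_ge0 //.
  apply: ge0_integral_le.
  - by apply: measurable_funM => //; exact: measurable_indic.
  - exact: mexp.
  - by move=> w; rewrite indicE mulr_ge0 ?expR_ge0.
  - move=> w; rewrite indicE; case: (boolP (w \in _)) => [|_]; last by rewrite mulr0 expR_ge0.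
    by rewrite inE /= mulr1 => h; rewrite ler_expR ler_pM2l // ltW.
have PE : P [set w | (r < U w - mean)%R] = (fine (P [set w | (r < U w - mean)%R]))%:E.
  by rewrite fineK // fin_num_measure.
rewrite PE -EFinM !lee_fin => h.
by rewrite expRD expRN ler_pdivlMr ?expR_gt0 // mulrC.
Qed.

Lemma deviation_le (r : R) : 0 < r ->
  (P [set w | (r < U w - mean)%R] <= (if c == 0 then 0 else expR (- r ^+ 2 / (4 * c)))%:E)%E.
Proof.
move=> r0; case: eqVneq => [cE|cn0]; last first.
  have c0 : 0 < c by rewrite lt_def cn0.
  (* The value l = r / (2c) minimizes c l^2 - l r. *)
  apply: le_trans (@chernoff_le r (r / (2 * c)) _) _; first by rewrite divr_gt0 // mulr_gt0.
  by rewrite lee_fin le_eqVlt; apply/orP; left; apply/eqP; congr expR; field.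
have PE : P [set w | (r < U w - mean)%R] = (fine (P [set w | (r < U w - mean)%R]))%:E.
  rewrite fineK // fin_num_measure //.
  by apply: measurable_gt; exact: measurable_funB.
have H l : 0 < l -> (fine (P [set w | (r < U w - mean)%R])) * expR (l * r) <= 1.
  move=> l0; have := chernoff_le r l0; rewrite PE lee_fin cE mul0r add0r.
  by rewrite expRN -[X in _ <= X]mul1r ler_pdivlMr ?expR_gt0.
rewrite PE lee_fin; move: (fine _) H => x H.
rewrite leNgt; apply/negP => x0.
(* For c = 0 and a probability x > 0, the choice l = 1 / (x r) gives x exp(1 / x) <= 1, against
   exp(1 / x) >= 1 + 1 / x. *)
have := H (x * r)^-1; rewrite invr_gt0 mulr_gt0 // => /(_ isT).
rewrite invfM mulrAC -mulrA divff ?gt_eqF // mulr1.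
have := expR_ge1Dx x^-1; rewrite -(ler_pM2l x0) mulrDr mulr1 divff ?gt_eqF // => h1 h2.
lra.
Qed.

End deviation.

Theorem theorem1 (R : realType) (d : nat) (hd : (1 <= d)%N)
    (Delta : nat -> R) (hDelta : sampling_steps Delta)
    (H L alpha b0 sigma0 : R)
    (hH : 0 < H < 1) (halpha : 0 < alpha) (hL : 0 <= L) :
  exists C : R, 0 < C /\
    forall (b : 'cV[R]_d -> 'cV[R]_d) (sigma : 'M[R]_d),
      continuous b ->
      drift_assumption alpha L b ->
      sigma \in unitmx ->
      enorm (b 0) = b0 ->
      opnorm sigma = sigma0 ->
    forall (disp : measure_display) (Omega : measurableType disp)
      (P : probability Omega R) (W B X : R -> Omega -> 'cV[R]_d),
      stationary_solution P H b sigma W B X ->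
    forall (n : nat), (1 <= n)%N -> 1 <= n%:R * Delta n ->
    forall (F : ('I_n -> 'cV[R]_d) -> R), lipschitz_dn F ->
      let FX := sampled F X (Delta n) in
      let EFX := fine 'E_P[FX]%E in
      let rate := conc_rate H n (Delta n) in
      [/\ P.-integrable [set: Omega] (EFin \o FX),
          forall lambda : R, 0 < lambda ->
            ('E_P[(fun w => expR (lambda * (FX w - EFX)))%R]
              <= (expR (C * lip_norm F ^+ 2 * lambda ^+ 2 * rate))%:E)%E
        & forall r : R, 0 < r ->
            (P [set w | (r < FX w - EFX)%R]
              <= (if lip_norm F == 0 then 0
                  else expR (- r ^+ 2 / (4 * C * rate * lip_norm F ^+ 2)))%:E)%E].
Proof.
have p_lo : - 2^-1 < H - 2^-1 by case/andP: hH; lra.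
have p_hi : H - 2^-1 < 2^-1 by case/andP: hH; lra.
have [Delta_gt0 Delta_noninc _] := hDelta.
(* The factor d counts the coordinates of W, and 2 comes from separating the kernel error in the
   squared sensitivity. *)
pose Q := d%:R * (2 * ((mvn_const H * memory_bound alpha L) ^+ 2
                       * ker_const (H - 2^-1) (Delta 1%N))).
have Q0 : 0 <= Q.
  apply: mulr_ge0 => //; apply: mulr_ge0 => //; apply: mulr_ge0; first exact: sqr_ge0.
  exact/ker_const_ge0/ltW/Delta_gt0.
have Q'0 : 0 <= sigma0 ^+ 2 * Q by apply: mulr_ge0 => //; exact: sqr_ge0.
(* Adding 1 to a quantity known to be nonnegative makes the constant positive. *)
exists (sigma0 ^+ 2 * Q + 1); split; first by rewrite ltr_wpDl.
set C := sigma0 ^+ 2 * Q + 1.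
move=> b sigma cb hb _ _ opE disp Omega P W B X SS n n1 nD F FL FX EFX rate.
have D0 := Delta_gt0 n n1; have DD1 := Delta_noninc 1%N n isT n1.
have FK := lip_norm_const FL.
have rate_gt0 : 0 < rate by rewrite mulr_gt0 // powR_gt0 // ltr0n.
pose c := C * lip_norm F ^+ 2 * rate.
have C0 : 0 < C by rewrite ltr_wpDl.
have c0 : 0 <= c by rewrite mulr_ge0 ?(ltW rate_gt0) // mulr_ge0 ?sqr_ge0 ?ltW.
have mFX : measurable_fun setT FX.
  have [_ _ _ [mX _ _] _] := SS.
  apply: (measurable_lipschitz_comp (Y := fun k w => X (k.+1%:R * Delta n) w)) => // k i.
  by apply: mX; rewrite mulr_ge0 // ltW.
have expFX l : 0 < l -> exp_product_le P (expR (c * l ^+ 2)) (fun w => l * FX w).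
  move=> l0.
  (* The parameter of the exponential is absorbed into the functional: the bound for l F carries the
     squared Lipschitz constant, hence l^2. *)
  have lFK : lip_consts (fun x => l * F x) (l * lip_norm F).
    case: FK => K0 FK; split=> [|x y]; first by rewrite mulr_ge0 // ltW.
    by rewrite -mulrBr normrM gtr0_norm // -mulrA ler_pM2l.
  have := exp_product_sampled hH halpha hL cb hb SS n1 D0 lFK DD1 nD.
  apply: exp_product_le_mono; rewrite ler_expR opE.
  rewrite [leLHS](_ : _ = sigma0 ^+ 2 * Q * (lip_norm F ^+ 2 * rate * l ^+ 2)); last first.
    by rewrite /Q /rate; ring.
  rewrite [leRHS](_ : _ = C * (lip_norm F ^+ 2 * rate * l ^+ 2)); last by rewrite /c; ring.
  rewrite ler_wpM2r ?lerDl // mulr_ge0 ?sqr_ge0 // mulr_ge0 ?sqr_ge0 //.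
  exact: ltW.
have EFXE : EFX = fine (\int[P]_w (FX w)%:E) by rewrite /EFX unlock.
split.
- exact: exp_product_integrable mFX expFX.
- move=> l l0; rewrite unlock EFXE.
  rewrite (_ : C * lip_norm F ^+ 2 * l ^+ 2 * rate = c * l ^+ 2); last by rewrite /c; ring.
  exact: centered_exp_le.
- move=> r r0; rewrite EFXE; have := deviation_le mFX c0 expFX r0.
  have -> : (c == 0) = (lip_norm F == 0).
    by rewrite mulf_eq0 (gt_eqF rate_gt0) orbF mulf_eq0 (gt_eqF C0) expf_eq0.
  rewrite /c (_ : 4 * (C * lip_norm F ^+ 2 * rate) = 4 * C * rate * lip_norm F ^+ 2) //.
  by ring.
Qed.
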